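(* Let $S$ be special and fix $y\in\mathbb R^3$ with $S^*(y)=4D$. Then for every $x\in\mathcal C(S)$, \[ \#\{x'\in\mathcal C(S,x):\ 0<x'y^t\le T\}\sim \kappa\, T\qquad (T\to\infty), \] where $\kappa>0$ depends only on the genus of $S$ (in particular not on $x$, nor on the class of $S$ within its genus).
   Context: $S$ is a symmetric $3\times3$ integer matrix with $D=\det S>0$; $S(x)=xSx^t$, and $S^*=(\det S)S^{-1}$ with $S^*(y)=yS^*y^t$. Primitive: gcd of entries is $1$; isotropic: $S(x)=0$ for some primitive $x\in\mathbb Z^3$. $-\Omega>0$ is the gcd of the entries of $S^*$; $\Delta=D/\Omega^2\in\mathbb Z_{>0}$; $N=\gcd(\Omega,\Delta)>0$. $S$ is special if it is primitive, isotropic, $D>0$ and $N$, $|\Omega|/N$, $\Delta/N$ are square-free. $\mathcal C(S)$ is the set of primitive $x\in\mathbb Z^3$ with $S(x)=0$; $O(S)=\{A\in\mathrm{GL}_3(\mathbb Z):A^tSA=S\}$; the orbit of $x$ is $\mathcal C(S,x)=\{xA^t: A\in O(S)\}$. The genus of $S$ is the set of $S'$ such that for each prime $p$ and $p=\infty$ there is $A\in\mathrm{GL}_3(\mathbb Z_p)$ ($\mathbb Z_\infty=\mathbb R$) with $A^tSA=S'$. *)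

(* Defs.v *)
From mathcomp Require Import all_boot all_order all_algebra.
From mathcomp Require Import reals.
Set Implicit Arguments. Unset Strict Implicit. Unset Printing Implicit Defensive.
Import Order.TTheory GRing.Theory Num.Theory.
Local Open Scope ring_scope.

Definition qform (S : 'M[int]_3) (x : 'rV[int]_3) : int := (x *m S *m x^T) ord0 ord0.

Definition qformR (R : realType) (M : 'M[int]_3) (y : 'rV[R]_3) : R :=
  (y *m map_mx (fun z : int => z%:~R) M *m y^T) ord0 ord0.

Definition Sstar (S : 'M[int]_3) : 'M[int]_3 := \adj S.

Definition Ddet (S : 'M[int]_3) : int := \det S.

Definition gcd_entries (M : 'M[int]_3) : nat :=
  \big[gcdn/0%N]_(i < 3) \big[gcdn/0%N]_(j < 3) `|M i j|%N.

Definition primitive_mx (M : 'M[int]_3) : Prop := gcd_entries M = 1%N.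

Definition primitive_vec (x : 'rV[int]_3) : Prop :=
  (\big[gcdn/0%N]_(i < 3) `|x ord0 i|%N) = 1%N.

Definition isotropic (S : 'M[int]_3) : Prop :=
  exists x : 'rV[int]_3, primitive_vec x /\ qform S x = 0.

Definition absOmega (S : 'M[int]_3) : nat := gcd_entries (Sstar S).
Definition Omega (S : 'M[int]_3) : int := - (absOmega S)%:Z.
Definition Delta (S : 'M[int]_3) : nat := (`|Ddet S|%N %/ (absOmega S ^ 2))%N.
Definition Ngcd (S : 'M[int]_3) : nat := gcdn (absOmega S) (Delta S).

Definition squarefree (n : nat) : Prop :=
  (0 < n)%N /\ forall d : nat, (d * d %| n)%N -> d = 1%N.

Definition special (S : 'M[int]_3) : Prop :=
  [/\ S^T = S, primitive_mx S, isotropic S & 0 < Ddet S] /\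
  [/\ squarefree (Ngcd S),
      squarefree (absOmega S %/ Ngcd S)%N &
      squarefree (Delta S %/ Ngcd S)%N].

Definition in_cone (S : 'M[int]_3) (x : 'rV[int]_3) : Prop :=
  primitive_vec x /\ qform S x = 0.

Definition in_OS (S : 'M[int]_3) (A : 'M[int]_3) : Prop :=
  (\det A \is a GRing.unit) /\ A^T *m S *m A = S.

Definition in_Sorbit (S : 'M[int]_3) (x x' : 'rV[int]_3) : Prop :=
  exists A : 'M[int]_3, in_OS S A /\ x' = x *m A^T.

Definition pairR (R : realType) (x : 'rV[int]_3) (y : 'rV[R]_3) : R :=
  \sum_(i < 3) (x ord0 i)%:~R * y ord0 i.

Definition has_card (P : 'rV[int]_3 -> Prop) (n : nat) : Prop :=
  exists s : seq 'rV[int]_3, [/\ uniq s, size s = n & forall v, v \in s <-> P v].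

(* Z_p is realised as the inverse limit of the Z/p^k: an element of
   M_3(Z_p) is a sequence (A k)_k of integer matrices, A k representing the
   reduction mod p^k, with A (k+1) = A k mod p^k. *)
Definition padic_mx (p : nat) (A : nat -> 'M[int]_3) : Prop :=
  forall k (i j : 'I_3), (A k.+1 i j == A k i j %[mod (p ^ k)%N%:Z])%Z.

(* A in GL_3(Z_p) with A^t S A = S' *)
Definition padic_equiv (p : nat) (S S' : 'M[int]_3) : Prop :=
  exists A : nat -> 'M[int]_3,
    [/\ padic_mx p A,
        ~~ (p%:Z %| \det (A 1%N))%Z &
        forall k (i j : 'I_3),
          (((A k)^T *m S *m A k) i j == S' i j %[mod (p ^ k)%N%:Z])%Z].

Definition real_equiv (R : realType) (S S' : 'M[int]_3) : Prop :=
  exists A : 'M[R]_3, A \in unitmx /\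
    A^T *m map_mx (fun z : int => z%:~R) S *m A = map_mx (fun z : int => z%:~R) S'.

Definition same_genus (R : realType) (S S' : 'M[int]_3) : Prop :=
  (forall p, prime p -> padic_equiv p S S') /\ real_equiv R S S'.

(* Main.v *)
(** Completing a primitive isotropic x to a basis of Z^3 turns S into the form
    2 m x0 x2 - q x1^2 + s x2^2 with x = e_0.  For special S the pair (m, q) is
    determined by D, and only s is left, modulo 2m.  Comparing local equivalences
    with explicit unipotent matrices shows that the orbit of e_0 consists of those
    primitive isotropic u with u_0^2 = 1 modulo every odd prime p such that p^3
    divides D.  The primitive isotropic vectors are
    (X - tau z, alpha w, beta z) with X, z coprime and z X = K w^2 for a square-free
    K; hence z = e d a^2, X = e (K/d) b^2, w = e a b with d dividing K, e = 1 or -1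
    and (a, b) primitive, unique up to sign.  On such a vector y is e times a binary
    quadratic form in (a, b), definite because of S^*(y) = 4D, whose discriminant
    depends neither on y nor on d.  The orbit is thereby counted by primitive lattice points
    in ellipses, restricted to residue classes: this gives the asymptotics with a
    constant depending only on the discriminant and on the number of residue classes.

    Inside a genus, D and therefore m, q agree; gcd(2m, s) and so alpha, beta, K
    agree as well, while tau is changed, modulo each of the primes above, by the square
    of a unit.  If the integer u is congruent to these units, (a, b) |-> (u a, b) is a
    bijection between the two sets of residue classes. *)
Require Import Defs.
From mathcomp Require Import all_boot all_order all_algebra.
From mathcomp Require Import boolp reals.
From mathcomp Require Import zify ring lra.
From mathcomp Require all_classical all_reals all_analysis.
Set Implicit Arguments. Unset Strict Implicit. Unset Printing Implicit Defensive.
Import Order.TTheory GRing.Theory Num.Theory.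
Local Open Scope ring_scope.

(** * The area under the semicircle *)

Section Semicircle.
Import all_classical all_reals all_analysis numFieldNormedType.Exports.

(** An equivalence between two normal forms links s and s', modulo powers of p, through the square
    of its corner entry. For an automorphism of one form the corner is the coordinate u_0 of the
    image of e_0; this is where the conditions u_0^2 = 1 come from. At p = 2 the square of a unit is
    1 modulo 2, so no condition survives, but parity arguments of their own are needed there.

    The square-free K comes from the isotropy equation in the form q u_1^2 = u_2 (2 m u_0 + s u_2):
    once gcd(2m, s) is cancelled, a constant times the product z X has to be a square.

    The forms of a genus lead to different ellipses and different residue sets. The density of
    primitive points is therefore attached to the modulus alone, before the form and the residue set
    are chosen. Only its existence and positivity matter: pi enters as 4 (F 1 - F 0) for a primitive
    F of the semicircle, and the Euler product as the limit of a monotone sequence. *)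

Lemma continuous_semicircle (R : realType) :
  continuous ((fun t => Num.sqrt (1 - t ^+ 2)) : R -> R).
Proof.
move=> x; apply: (@continuous_comp _ _ _ (fun t : R => 1 - t ^+ 2) Num.sqrt).
  by apply: continuousB; [exact: cst_continuous|exact: exprn_continuous].
exact: sqrt_continuous.
Qed.

(** F is the integral from 0. The integrand decreases on the nonnegative axis, so its integral over
    [a, b] lies between the end values times the length. No other property of the integral is used
    later. *)
Lemma semicircle_primitive (R : realType) : exists F : R -> R,
  forall a b, 0 <= a -> a <= b ->
    (b - a) * Num.sqrt (1 - b ^+ 2) <= F b - F a <= (b - a) * Num.sqrt (1 - a ^+ 2).
Proof.
set f := fun t : R => Num.sqrt (1 - t ^+ 2).
exists (fun t => \int[@lebesgue_measure R]_(x in `[0, t]) f x) => a b a0 ab.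
have cint (g : R -> R) (c d : R) : continuous g ->
    (@lebesgue_measure R).-integrable `[c, d] (EFin \o g).
  move=> cg; apply: continuous_compact_integrable; first exact: segment_compact.
  exact: continuous_subspaceT.
have oint (g : R -> R) : continuous g ->
    (@lebesgue_measure R).-integrable `]a, b] (EFin \o g).
  by move=> /(cint g a b) gi; apply: integrableS gi => //; exact: subset_itv_oc_cc.
have cf : continuous f := @continuous_semicircle R.
have lenE : fine (@lebesgue_measure R `]a, b]%classic) = b - a.
  rewrite lebesgue_measure_itv /= lte_fin; case: ifPn => //; rewrite -leNgt /= => ba; lra.
rewrite Rintegral_itvB ?bnd_simp //; last exact: cint.
have fmono c d : 0 <= c -> c <= d -> f d <= f c.
  by move=> c0 cd; apply: ler_wsqrtr; nra.
rewrite -lenE ![fine _ * _]mulrC -!Rintegral_cst //; apply/andP; split.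
  apply: le_Rintegral => //=; [|exact: oint|].
    by apply: (oint (cst _)); exact: cst_continuous.
  by move=> x; rewrite in_itv /= => /andP[ax xb]; apply: fmono => //; lra.
apply: le_Rintegral => //=; [exact: oint| |].
  by apply: (oint (cst _)); exact: cst_continuous.
by move=> x; rewrite in_itv /= => /andP[ax xb]; apply: fmono => //; lra.
Qed.

End Semicircle.

(** * Counting in ellipses *)

(** The encoding of [has_card] over an arbitrary [eqType]; for integer rows the two are
    convertible. *)
Definition cnt (T : eqType) (P : T -> Prop) (n : nat) : Prop :=
  exists s : seq T, [/\ uniq s, size s = n & forall v, v \in s <-> P v].

Lemma cnt_le (T : eqType) (P Q : T -> Prop) n m :
  (forall v, P v -> Q v) -> cnt P n -> cnt Q m -> (n <= m)%N.
Proof.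
move=> PQ [s [us <- sP]] [t [ut <- tQ]]; apply: uniq_leq_size => // v.
by move=> /sP /PQ /tQ.
Qed.

Lemma cnt_inj (T : eqType) (P : T -> Prop) n m : cnt P n -> cnt P m -> n = m.
Proof. by move=> Pn Pm; apply/eqP; rewrite eqn_leq !(@cnt_le _ P P). Qed.

Lemma eq_cnt (T : eqType) (P Q : T -> Prop) n :
  (forall v, P v <-> Q v) -> cnt P n -> cnt Q n.
Proof.
by move=> PQ [s [us sn sP]]; exists s; split=> // v; rewrite sP.
Qed.

Lemma cnt_sub (T : eqType) (P : T -> Prop) (b : pred T) n : cnt P n ->
  exists n', cnt (fun v => P v /\ b v) n'.
Proof.
move=> [s [us _ sP]]; exists (size [seq v <- s | b v]), [seq v <- s | b v].
split=> //; first exact: filter_uniq.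
by move=> v; rewrite mem_filter; split=> [/andP[-> /sP]|[/sP -> ->]].
Qed.

Lemma cnt_map (T U : eqType) (P : T -> Prop) (f : T -> U) n :
  (forall v w, P v -> P w -> f v = f w -> v = w) -> cnt P n ->
  cnt (fun u => exists2 v, P v & u = f v) n.
Proof.
move=> fi [s [us sn sP]]; exists (map f s); split; last 1 first.
- move=> u; split=> [/mapP[v /sP Pv ->]|[v /sP vs ->]]; first by exists v.
  exact: map_f.
- by rewrite map_inj_in_uniq // => v w /sP Pv /sP Pw; apply: fi.
- by rewrite size_map.
Qed.

Lemma cnt_ex (I T : eqType) (r : seq I) (P : I -> T -> Prop) (n : I -> nat) :
  (forall i, i \in r -> cnt (P i) (n i)) ->
  exists2 m, cnt (fun v => exists2 i, i \in r & P i v) m &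
    (m <= \sum_(i <- r) n i)%N.
Proof.
elim: r => [|i r IH] Pn.
  by exists 0%N => //; exists [::]; split=> // v; split=> // -[].
have [j jr|m [s [us sm sP]] mle] := IH; first by apply: Pn; rewrite inE jr orbT.
have [t [ut tn tP]] := Pn i (mem_head _ _).
exists (size (undup (t ++ s))).
  exists (undup (t ++ s)); split=> //; first exact: undup_uniq.
  move=> v; rewrite mem_undup mem_cat; split=> [/orP[/tP Pv|/sP[j jr Pv]]|[j]].
  - by exists i; rewrite ?mem_head.
  - by exists j; rewrite ?inE ?jr ?orbT.
  rewrite inE => /predU1P[->|jr] Pv; first by rewrite (tP v).2.
  by rewrite (sP v).2 ?orbT //; exists j.
by rewrite big_cons (leq_trans (size_undup _)) // size_cat tn sm leq_add2l.
Qed.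

Lemma cnt_sum (I T : eqType) (r : seq I) (P : I -> T -> Prop) (n : I -> nat) :
  uniq r -> (forall i, i \in r -> cnt (P i) (n i)) ->
  (forall i j v, i \in r -> j \in r -> P i v -> P j v -> i = j) ->
  cnt (fun v => exists2 i, i \in r & P i v) (\sum_(i <- r) n i).
Proof.
elim: r => [|i r IH] /=.
  by move=> *; exists [::]; rewrite big_nil; split=> // v; split=> // -[].
move=> /andP[ir ur] Pn dis.
have [||s [us sm sP]] := IH ur.
- by move=> j jr; apply: Pn; rewrite inE jr orbT.
- by move=> j k v jr kr; apply: dis; rewrite inE ?jr ?kr orbT.
have [t [ut tn tP]] := Pn i (mem_head _ _).
exists (t ++ s); split; last 1 first.
- move=> v; rewrite mem_cat; split=> [/orP[/tP Pv|/sP[j jr Pv]]|[j]].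
  + by exists i; rewrite ?mem_head.
  + by exists j; rewrite ?inE ?jr ?orbT.
  rewrite inE => /predU1P[->|jr] Pv; first by rewrite (tP v).2.
  by rewrite (sP v).2 ?orbT //; exists j.
- rewrite cat_uniq ut us andbT; apply/hasPn => v /sP[j jr Pj]; apply/negP => /tP Pi.
  by move: ir; rewrite (dis i j v) ?jr // inE ?eqxx ?jr ?orbT.
- by rewrite size_cat tn sm big_cons.
Qed.

Section Interval.
Context {R : realType}.

Lemma cnt_interval (c w : R) : 0 <= w ->
  exists2 n, cnt (fun k : int => `|k%:~R - c| <= w) n & `|n%:R - 2 * w| <= 1.
Proof.
move=> w0; set lo := Num.ceil (c - w); set hi := Num.floor (c + w).
have /andP[lo1 lo2] : (lo - 1)%:~R < c - w <= lo%:~R := Num.Theory.ceil_itv _.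
have /andP[hi1 hi2] : hi%:~R <= c + w < (hi + 1)%:~R := Num.Theory.floor_itv _.
(* An interval without integers has hi = lo - 1, which gives the correct count 0. *)
have n0 : 0 <= hi - lo + 1.
  rewrite -ltzD1 -(ltr_int R) !intrD !intrN; move: lo1 hi2.
  by rewrite !intrD !intrN; lra.
have nE : ((absz (hi - lo + 1)))%:R = (hi - lo + 1)%:~R :> R.
  by rewrite -[in RHS](gez0_abs n0).
exists (absz (hi - lo + 1)); last first.
  rewrite nE; move: lo1 hi2; rewrite !intrD !intrN => *.
  by rewrite ler_norml; apply/andP; split; lra.
exists [seq lo + i%:Z | i <- iota 0 (absz (hi - lo + 1))]; split.
- by rewrite map_inj_uniq ?iota_uniq // => i j; lia.
- by rewrite size_map size_iota.
move=> k; rewrite ler_norml; split.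
  move=> /mapP[i]; rewrite mem_iota => ib ->.
  have : lo + i%:Z <= hi by lia.
  rewrite -(ler_int R) intrD => h.
  have : 0 <= (i%:Z)%:~R :> R by rewrite ler0z.
  lra.
move=> /andP[k1 k2].
have lk : lo <= k by rewrite -ltzD1 -ltrBlDr -(ltr_int R); lra.
have kh : k <= hi by rewrite -ltzD1 -(ltr_int R); lra.
by apply/mapP; exists (absz (k - lo)); rewrite ?mem_iota; lia.
Qed.

Definition semi (t : R) := Num.sqrt (1 - t ^+ 2).

(* For the decreasing [semi] this amounts to F' = semi on [0, 1]; Riemann sums are compared
   with F directly through these bounds. *)
Definition primitive_of_semi (F : R -> R) := forall a b, 0 <= a -> a <= b ->
  (b - a) * semi b <= F b - F a <= (b - a) * semi a.

(** The sum is compared with the rescaled primitive Y F(y / Y). It exceeds the integral from th on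
    by at most its first term, which is at most 1, and the missing piece over [0, th] is at most 1;
    these errors have opposite signs and do not add up. *)
Lemma riemann_semi (F : R -> R) : primitive_of_semi F ->
  forall (Y th : R) (n : nat), 0 < Y -> 0 <= th <= 1 -> Y <= n%:R ->
  `|\sum_(j < n) semi ((th + j%:R) / Y) - (F 1 - F 0) * Y| <= 1.
Proof.
move=> hF Y th n Y0 /andP[th0 th1] Yn.
pose G y := Y * F (y / Y).
have GP y z : 0 <= y -> y <= z ->
    (z - y) * semi (z / Y) <= G z - G y <= (z - y) * semi (y / Y).
  move=> y0 yz; have /andP[] : (z / Y - y / Y) * semi (z / Y) <= F (z / Y) - F (y / Y)
      <= (z / Y - y / Y) * semi (y / Y).
    by apply: hF; [rewrite divr_ge0 // ltW|rewrite ler_pM2r ?invr_gt0].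
  have -> : z - y = Y * (z / Y - y / Y) by field; rewrite gt_eqF.
  by rewrite /G -mulrBr -!mulrA !ler_pM2l // => -> ->.
have semi0 t : 0 <= semi t by exact: sqrtr_ge0.
have semi1 t : semi t <= 1.
  by rewrite /semi -[leRHS]sqrtr1 ler_wsqrtr // gerBl sqr_ge0.
have G0 : G 0 = Y * F 0 by rewrite /G mul0r.
(* Beyond 1 the function [semi] is 0, being the square root of a negative number, so F is constant
   there. *)
have GY y : Y <= y -> G y = Y * F 1.
  move=> Yy; have := @hF 1 (y / Y) ler01; rewrite ler_pdivlMr // mul1r => /(_ Yy).
  rewrite {2}/semi expr1n subrr sqrtr0 mulr0 => /andP[h1 h2].
  congr (_ * _); apply/eqP; rewrite eq_le -subr_le0 h2 /= -subr_ge0.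
  by apply: le_trans h1; rewrite mulr_ge0 // subr_ge0 ler_pdivlMr // mul1r.
have GYn : G (th + n%:R) = Y * F 1 by apply: GY; lra.
have stepP j : semi ((th + j.+1%:R) / Y) <= G (th + j.+1%:R) - G (th + j%:R)
    <= semi ((th + j%:R) / Y).
  have := @GP (th + j%:R) (th + j.+1%:R).
  rewrite opprD addrACA subrr add0r -natrB // subSnn !mul1r; apply.
    by rewrite addr_ge0.
  by rewrite lerD2l ler_nat.
have tele m : \sum_(j < m) (G (th + j.+1%:R) - G (th + j%:R)) = G (th + m%:R) - G th.
  by rewrite -(big_mkord xpredT (fun j => G (th + j.+1%:R) - G (th + j%:R)))
     (telescope_sumr (fun j => G (th + j%:R))) // addr0.
have lo : G (th + n%:R) - G th <= \sum_(j < n) semi ((th + j%:R) / Y).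
  by rewrite -tele; apply: ler_sum => j _; case/andP: (stepP j).
have hi : \sum_(j < n) semi ((th + j%:R) / Y) <= 1 + (G (th + n%:R) - G th).
  apply: (@le_trans _ _ (\sum_(j < n.+1) semi ((th + j%:R) / Y))).
    by rewrite big_ord_recr /= lerDl.
  rewrite big_ord_recl lerD // -tele; apply: ler_sum => j _.
  by case/andP: (stepP j).
have /andP[Gth0 Gth1] := GP 0 th (lexx _) th0.
have := semi0 (th / Y); have := semi1 (0 / Y); rewrite subr0 in Gth0 Gth1 => s1 s2.
rewrite GYn in lo hi; rewrite G0 in Gth0 Gth1.
rewrite ler_norml; apply/andP; split; nra.
Qed.

(** A horizontal line meets the ellipse in an interval of half-width (r / a) [semi] (|y| / Y), where
    Y = a r / d is the height of the ellipse. Rows beyond Y are empty, so only finitely many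
    remain. *)
Lemma cnt_row (a b d r x0 y : R) : 0 < a -> 0 < d -> 0 < r ->
  exists2 n, cnt (fun k : int =>
      (a * (k%:~R + x0) + b * y) ^+ 2 + (d / a * y) ^+ 2 <= r ^+ 2) n &
    `|n%:R - 2 * (r / a * semi (`|y| / (a * r / d)))| <= 1 /\
    (a * r / d < `|y| -> n = 0%N).
Proof.
move=> a0 d0 r0; set Y := a * r / d.
have Y0 : 0 < Y by rewrite divr_gt0 // mulr_gt0.
have ra0 : 0 < r / a by rewrite divr_gt0.
have eY : (d / a * y) ^+ 2 = r ^+ 2 * (`|y| / Y) ^+ 2.
  rewrite expr_div_n real_normK ?num_real // /Y; field.
  by rewrite !gt_eqF.
have [yY|Yy] := lerP `|y| Y.
  have t1 : (`|y| / Y) ^+ 2 <= 1.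
    apply: exprn_ile1; first by rewrite divr_ge0 // ltW.
    by rewrite ler_pdivrMr // mul1r.
  have w0 : 0 <= r / a * semi (`|y| / Y) by rewrite mulr_ge0 ?sqrtr_ge0 // ltW.
  have [n nP nE] := cnt_interval (- (x0 + b * y / a)) w0; exists n => //.
  apply: eq_cnt nP => k; rewrite eY opprK.
  have -> : (`|k%:~R + (x0 + b * y / a)| <= r / a * semi (`|y| / Y)) =
     (`|k%:~R + (x0 + b * y / a)| ^+ 2 <= (r / a * semi (`|y| / Y)) ^+ 2).
    by rewrite ler_pXn2r // nnegrE.
  rewrite real_normK ?num_real // [(_ * semi _) ^+ 2]exprMn sqr_sqrtr ?subr_ge0 //.
  have -> : a * (k%:~R + x0) + b * y = a * (k%:~R + (x0 + b * y / a)).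
    by field; rewrite gt_eqF.
  have -> : r ^+ 2 = a ^+ 2 * (r / a) ^+ 2 by field; rewrite gt_eqF.
  rewrite [(a * _) ^+ 2]exprMn -[a ^+ 2 * _ * (_ / _) ^+ 2]mulrA -mulrDr.
  rewrite ler_pM2l ?exprn_gt0 //.
  by rewrite mulrBr mulr1 lerBrDr.
have s0 : semi (`|y| / Y) = 0.
  rewrite /semi ler0_sqrtr // subr_le0 -[leLHS](expr1n _ 2%N) ler_pXn2r ?nnegrE //.
    by rewrite ler_pdivlMr // mul1r ltW.
  by rewrite divr_ge0 // ltW.
exists 0%N; last by rewrite s0 !mulr0 subrr normr0 ler01.
exists [::]; split=> // k; split=> //; rewrite eY; apply: contraTT => _.
rewrite -ltNge; apply: ltr_wpDl; first exact: sqr_ge0.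
rewrite -[ltLHS]mulr1 ltr_pM2l ?exprn_gt0 // -[ltLHS](expr1n _ 2%N).
have t1 : 1 < `|y| / Y by rewrite ltr_pdivlMr // mul1r.
by rewrite ltr_pXn2r // nnegrE ?ler01 // ltW // (lt_trans ltr01).
Qed.

End Interval.

Lemma choice_in (T : eqType) (U : Type) (r : seq T) (P : T -> U -> Prop) (u0 : U) :
  (forall x, x \in r -> exists u, P x u) ->
  exists f : T -> U, forall x, x \in r -> P x (f x).
Proof.
elim: r => [|x r IH] h; first by exists (fun=> u0).
have [|f fP] := IH; first by move=> y yr; apply: h; rewrite inE yr orbT.
have [u uP] := h x (mem_head _ _).
exists (fun y => if y == x then u else f y) => y; rewrite inE.
by case: eqP => [-> //|_ /= /fP].
Qed.

Section Ellipse.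
Context {R : realType}.
Variables (F : R -> R) (hF : primitive_of_semi F).

(** The map (x, y) |-> (a x + b y, (d / a) y) has determinant d, so the area is pi r^2 / d, with 4
    (F 1 - F 0) in the place of pi. C is independent of the centre because the centre will run over
    residue classes. *)
Lemma cnt_ellipse (a b d : R) : 0 < a -> 0 < d -> exists2 C, 0 <= C &
  forall x0 y0 r : R, 0 < r -> exists2 n,
    cnt (fun v : int * int => (a * (v.1%:~R + x0) + b * (v.2%:~R + y0)) ^+ 2 +
      (d / a * (v.2%:~R + y0)) ^+ 2 <= r ^+ 2) n &
    `|n%:R - 4 * (F 1 - F 0) * r ^+ 2 / d| <= C * (r + 1).
Proof.
move=> a0 d0; exists (4 / a + 2 * (a / d) + 2).
  by rewrite !addr_ge0 ?mulr_ge0 ?invr_ge0 ?(ltW a0) ?(ltW d0).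
move=> x0 y0 r r0; set Y := a * r / d.
have Y0 : 0 < Y by rewrite divr_gt0 // mulr_gt0.
have [N YN NY] : exists2 N : nat, Y < N%:R & N%:R <= Y + 1.
  exists (Num.truncn Y).+1; first by case/andP: (truncn_itv (ltW Y0)).
  by rewrite -natr1 lerD2r; case/andP: (truncn_itv (ltW Y0)).
pose l0 := Num.ceil (- y0).
have /andP[l1 l2] : (l0 - 1)%:~R < - y0 <= l0%:~R := Num.Theory.ceil_itv _.
(* The distances from the centre to the first row above and to the first row below are th and 1 -
   th; each half is a Riemann sum. *)
pose th := l0%:~R + y0.
have th01 : 0 <= th <= 1 by rewrite /th; apply/andP; split; lra.
have th01' : 0 <= 1 - th <= 1 by apply/andP; split; lra.
pose w (l : int) := r / a * semi (`|l%:~R + y0| / Y).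
pose s1 := [seq l0 + j%:Z | j <- iota 0 N].
pose s2 := [seq l0 - 1 - j%:Z | j <- iota 0 N].
have us : uniq (s1 ++ s2).
  clear; rewrite cat_uniq; apply/and3P; split.
  - by rewrite map_inj_uniq ?iota_uniq // => i j; lia.
  - by apply/hasPn => l /mapP[j _ ->]; apply/negP => /mapP[i _]; lia.
  - by rewrite map_inj_uniq ?iota_uniq // => i j; lia.
have [|n nP] := @choice_in int nat (s1 ++ s2) (fun l n =>
    cnt (fun k : int => (a * (k%:~R + x0) + b * (l%:~R + y0)) ^+ 2 +
      (d / a * (l%:~R + y0)) ^+ 2 <= r ^+ 2) n /\ `|n%:R - 2 * w l| <= 1) 0%N.
  move=> l _; have [n h1 [h2 _]] := @cnt_row _ a b d r x0 (l%:~R + y0) a0 d0 r0.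
  by exists n.
exists (\sum_(l <- s1 ++ s2) n l)%N.
  have h l : l \in s1 ++ s2 -> cnt (fun v : int * int =>
     v.2 = l /\ (a * (v.1%:~R + x0) + b * (v.2%:~R + y0)) ^+ 2 +
      (d / a * (v.2%:~R + y0)) ^+ 2 <= r ^+ 2) (n l).
    move=> /nP[+ _] => /(@cnt_map _ _ _ (fun k => (k, l))) h.
    apply: eq_cnt (h _) => [[k l'] /=|k k' _ _ [] //].
    by split=> [[k' h' [-> ->]] //|[-> h']]; exists k.
  apply: eq_cnt (cnt_sum us h _) => [[k l] /=|i j v _ _ [<- _] [<- _] //].
  split=> [[l' _ [] //]|hkl]; exists l => //.
  have ly : `|l%:~R + y0| <= Y.
    have [n' [s [_ sn' sP]] [_ n0]] := @cnt_row _ a b d r x0 (l%:~R + y0) a0 d0 r0.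
    rewrite leNgt; apply/negP => /n0; rewrite -sn'; move/(sP k): hkl.
    by case: s {sP sn'}.
  move: ly; rewrite ler_norml => /andP[ly1 ly2]; rewrite mem_cat.
  have [ll|ll] := leP l0 l; apply/orP; [left|right]; apply/mapP.
    exists (absz (l - l0)%R); last by clear -ll; lia.
    rewrite mem_iota add0n /=.
    have : l < l0 + N by rewrite -(ltr_int R) intrD; lra.
    by clear -ll; lia.
  exists (absz (l0 - 1 - l)%R); last by clear -ll; lia.
  rewrite mem_iota add0n /=.
  have : l0 - 1 - N%:Z < l.
    rewrite -(ltr_int R) !intrD !intrN; move: th01; rewrite /th; lra.
  by clear -ll; lia.
have S1 := @riemann_semi _ F hF Y th N Y0 th01 (ltW YN).
have S2 := @riemann_semi _ F hF Y (1 - th) N Y0 th01' (ltW YN).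
have ws1 : \sum_(l <- s1) w l = r / a * \sum_(j < N) semi ((th + j%:R) / Y).
  rewrite big_map -(big_mkord xpredT (fun j => semi ((th + j%:R) / Y))) mulr_sumr.
  rewrite /index_iota subn0; apply: eq_bigr => j _; rewrite /w intrD ger0_norm.
    by congr (_ * semi (_ / _)); rewrite /th; ring.
  by have : 0 <= j%:R :> R by []; move: th01; rewrite /th; lra.
have ws2 : \sum_(l <- s2) w l = r / a * \sum_(j < N) semi ((1 - th + j%:R) / Y).
  rewrite big_map -(big_mkord xpredT (fun j => semi ((1 - th + j%:R) / Y))) mulr_sumr.
  rewrite /index_iota subn0; apply: eq_bigr => j _; rewrite /w !intrD !intrN ler0_norm.
    by congr (_ * semi (_ / _)); rewrite /th; ring.
  by have : 0 <= j%:R :> R by []; move: th01; rewrite /th; lra.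
have nw : `|(\sum_(l <- s1 ++ s2) n l)%:R - 2 * \sum_(l <- s1 ++ s2) w l| <= (N + N)%:R.
  rewrite natr_sum mulr_sumr -sumrB; apply: le_trans (ler_norm_sum _ _ _) _.
  have -> : (N + N)%:R = \sum_(l <- s1 ++ s2) (1 : R).
    by rewrite big_const_seq count_predT iter_addr_0 size_cat !size_map !size_iota.
  by rewrite big_seq [leRHS]big_seq; apply: ler_sum => l /nP[].
have {ws1 ws2} ws : \sum_(l <- s1 ++ s2) w l =
    r / a * (\sum_(j < N) semi ((th + j%:R) / Y) + \sum_(j < N) semi ((1 - th + j%:R) / Y)).
  by rewrite big_cat /= mulrDr -ws1 -ws2.
move: nw; rewrite natrD ws.
move: S1 S2; set A1 := \sum_(j < N) _; set A2 := \sum_(j < N) _; set J := F 1 - F 0.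
set n0 := (\sum_(l <- _) _)%:R.
have E : 4 * J * r ^+ 2 / d = 2 * (r / a * (2 * (J * Y))).
  by rewrite /Y; field; rewrite !gt_eqF.
have Yr : Y = a / d * r by rewrite /Y; field; rewrite gt_eqF.
have ad0 : 0 < a / d by rewrite divr_gt0.
have ra0 : 0 < r / a by rewrite divr_gt0.
have M (x : R) : `|x| <= 1 -> - (r / a) <= r / a * x <= r / a.
  by rewrite ler_norml => /andP[x1 x2]; apply/andP; split; nra.
move=> /M /andP[S1 S2] /M /andP[S3 S4]; rewrite E !ler_norml => /andP[S5 S6].
have -> : (4 / a + 2 * (a / d) + 2) * (r + 1) =
    4 * (r / a) + 4 / a + 2 * Y + 2 * (a / d) + 2 * r + 2 by rewrite Yr; ring.
have a40 : 0 < 4 / a by rewrite divr_gt0.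
rewrite mulrDr mulrN in S1 S2 S3 S4.
apply/andP; split; lra.
Qed.

End Ellipse.

(** * Sieving to primitive vectors *)

Lemma cnt_leU (T : eqType) (P Q S : T -> Prop) n m k :
  (forall v, S v -> P v \/ Q v) -> cnt P n -> cnt Q m -> cnt S k -> (k <= n + m)%N.
Proof.
move=> SPQ [s [us <- sP]] [t [ut <- tQ]] [u [uu <- uS]].
rewrite -size_cat; apply: uniq_leq_size => // v /uS /SPQ; rewrite mem_cat.
by move=> [/sP ->|/tQ ->]; rewrite ?orbT.
Qed.

(** * Residue classes of pairs *)

Lemma crt_sum (m n : nat) (f : nat -> nat -> nat) : coprime m n ->
  (\sum_(0 <= i < m * n) f (i %% m) (i %% n) =
   \sum_(0 <= i < m) \sum_(0 <= j < n) f i j)%N.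
Proof.
move=> cmn; have [->|m0] := posnP m; first by rewrite mul0n !big_geq.
have [->|n0] := posnP n.
  by rewrite muln0 big_geq // big1 // => i _; rewrite big_geq.
rewrite /index_iota !subn0 -[RHS](@big_allpairs _ _ _ _ _ _ _ (fun p => f p.1 p.2)).
rewrite -(big_map (fun i => (i %% m, i %% n))%N xpredT (fun p => f p.1 p.2)).
have us : uniq [seq (i %% m, i %% n)%N | i <- iota 0 (m * n)].
  rewrite map_inj_in_uniq ?iota_uniq // => i j; rewrite !mem_iota !add0n /=.
  move=> im jm [ijm ijn].
  have : (i == j %[mod m * n])%N by rewrite chinese_remainder // ijm ijn !eqxx.
  by rewrite /= !modn_small // => /eqP.
have ut : uniq [seq (i, j) | i <- iota 0 m, j <- iota 0 n].
  by apply: allpairs_uniq; rewrite ?iota_uniq // => -[? ?] [? ?] _ _ [-> ->].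
have [||_ st] := @uniq_min_size _ [seq (i %% m, i %% n)%N | i <- iota 0 (m * n)]
    [seq (i, j) | i <- iota 0 m, j <- iota 0 n] us.
- move=> _ /mapP[i _ ->]; apply/allpairsP; exists (i %% m, i %% n)%N.
  by rewrite !mem_iota /= !ltn_mod m0 n0.
- by rewrite size_allpairs size_map !size_iota.
by apply: perm_big; apply: uniq_perm.
Qed.

Definition residues (m : nat) (V : int -> int -> bool) :=
  [seq p <- [seq (i%:Z, j%:Z) | i <- iota 0 m, j <- iota 0 m] | V p.1 p.2].

Definition nres m V := size (residues m V).

Definition periodic (m : nat) (V : int -> int -> bool) :=
  forall x y k l : int, V (x + m%:Z * k) (y + m%:Z * l) = V x y.

Lemma nresE m V : nres m V =
  (\sum_(0 <= i < m) \sum_(0 <= j < m) V i%:Z j%:Z)%N.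
Proof.
rewrite /nres /residues size_filter -sum1_count big_mkcond.
rewrite big_allpairs_dep /index_iota subn0; apply: eq_bigr => i _.
by apply: eq_bigr => j _ /=; case: (V _ _).
Qed.

Lemma periodic_modn m V (i j : nat) : periodic m V ->
  V i%:Z j%:Z = V (i %% m)%:Z (j %% m)%:Z.
Proof.
have E n : n%:Z = (n %% m)%:Z + m%:Z * (n %/ m)%:Z.
  by rewrite {1}(divn_eq n m) addnC mulnC PoszD PoszM.
by move=> pV; rewrite (E i) (E j) pV.
Qed.

Lemma nres_crt m n V G : coprime m n -> periodic m V -> periodic n G ->
  nres (m * n) (fun x y => V x y && G x y) = (nres m V * nres n G)%N.
Proof.
move=> cmn pV pG; rewrite !nresE big_distrlr /=.
rewrite -(crt_sum (fun i1 i2 =>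
  (\sum_(0 <= j < m) V i1%:Z j%:Z) * (\sum_(0 <= j < n) G i2%:Z j%:Z))%N cmn).
apply: eq_bigr => i _; rewrite big_distrlr /=.
rewrite -(crt_sum (fun j1 j2 => V (i %% m)%:Z j1%:Z * G (i %% n)%:Z j2%:Z)%N cmn).
by apply: eq_bigr => j _; rewrite (periodic_modn i j pV) (periodic_modn i j pG) mulnb.
Qed.

Lemma periodicM m k V : periodic m V -> periodic (m * k) V.
Proof. by move=> pV x y i j; rewrite PoszM -!mulrA pV. Qed.

Definition not_both (p : nat) (x y : int) := ~~ ((p %| x)%Z && (p %| y)%Z).

Lemma periodic_not_both p : periodic p (not_both p).
Proof. by move=> x y k l; rewrite /not_both !rpredDr // dvdz_mulr. Qed.

Lemma nres_not_both p : (0 < p)%N -> nres p (not_both p) = (p ^ 2).-1.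
Proof.
move=> p0; rewrite nresE.
have h i j : (i < p)%N -> (j < p)%N ->
    (not_both p i%:Z j%:Z + ((i == 0) && (j == 0)) = 1)%N.
  move=> ip jp; rewrite /not_both !dvdzE /=.
  case: i ip => [|i] ip; case: j jp => [|j] jp; rewrite ?dvdn0 //= ?andbT ?andbF.
  - by rewrite gtnNdvd.
  - by rewrite gtnNdvd.
  by rewrite gtnNdvd.
have : (\sum_(0 <= i < p) \sum_(0 <= j < p) not_both p i%:Z j%:Z
   + \sum_(0 <= i < p) \sum_(0 <= j < p) ((i == 0) && (j == 0)))%N = (p ^ 2)%N.
  have -> : (p ^ 2 = \sum_(0 <= i < p) \sum_(0 <= j < p) 1)%N.
    by rewrite !sum_nat_const_nat subn0 muln1 mulnn.
  rewrite -big_split; apply: eq_big_nat => i /= ip; rewrite -big_split.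
  by apply: eq_big_nat => j /= jp; rewrite -[RHS](h i j).
have -> : (\sum_(0 <= i < p) \sum_(0 <= j < p) ((i == 0) && (j == 0)))%N = 1%N.
  case: p p0 {h} => // p _; rewrite big_nat_recl // big_nat_recl //=.
  by rewrite !big1 // => i _; rewrite big1.
by rewrite addn1 => <-.
Qed.

Definition coprime_to (ps : seq nat) (x y : int) := all (fun p => not_both p x y) ps.

Lemma periodic_coprime_to ps : periodic (\prod_(p <- ps) p) (coprime_to ps).
Proof.
elim: ps => [|p ps IH] x y k l //=; rewrite big_cons.
congr (_ && _); first by rewrite PoszM -!mulrA periodic_not_both.
by rewrite PoszM -!mulrA ![p%:Z * _]mulrCA IH.
Qed.

Lemma coprime_prod_primes p ps : prime p -> all prime ps -> p \notin ps ->
  coprime p (\prod_(r <- ps) r).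
Proof.
move=> pp; elim: ps => [|r ps IH] /=; first by rewrite big_nil coprimen1.
move=> /andP[pr aps]; rewrite inE negb_or => /andP[npr nps].
by rewrite big_cons coprimeMr IH // andbT prime_coprime // dvdn_prime2.
Qed.

Lemma nres_coprime_to ps : uniq ps -> all prime ps ->
  nres (\prod_(p <- ps) p) (coprime_to ps) = (\prod_(p <- ps) (p ^ 2).-1)%N.
Proof.
elim: ps => [|p ps IH] /=; first by rewrite !big_nil.
move=> /andP[nps ups] /andP[pp aps]; rewrite !big_cons nres_crt; last 1 first.
- exact: periodic_coprime_to.
- by rewrite IH // nres_not_both // prime_gt0.
- exact: coprime_prod_primes.
- exact: periodic_not_both.
Qed.

(** * Lattice points of an ellipse in residue classes *)

Section Count.
Context {R : realType}.
Variables (F : R -> R) (hF : primitive_of_semi F).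
Let J := 4 * (F 1 - F 0).

(** A positive definite binary form with its square completed: a^2 is the leading coefficient and
    d^2 the determinant of the Gram matrix, so that d alone governs the area. *)
Definition sqform (a b d : R) (v : int * int) : R :=
  (a * v.1%:~R + b * v.2%:~R) ^+ 2 + (d / a * v.2%:~R) ^+ 2.

Lemma sqform_scale a b d (e : int) v :
  sqform a b d (e * v.1, e * v.2) = e%:~R ^+ 2 * sqform a b d v.
Proof. by rewrite /sqform /= !intrM; ring. Qed.

(** A residue class is a translate of m Z^2; division by m turns its count into that of an ellipse
    of radius sqrt T / m around a shifted centre. *)
Lemma cnt_periodic (a b d : R) (m : nat) (V : int -> int -> bool) :
  0 < a -> 0 < d -> (0 < m)%N -> periodic m V -> exists2 C, 0 <= C &
  forall T : R, 0 < T -> exists2 n,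
    cnt (fun v : int * int => V v.1 v.2 /\ sqform a b d v <= T) n &
    `|n%:R - J * (nres m V)%:R / m%:R ^+ 2 / d * T| <= C * (Num.sqrt T + 1).
Proof.
move=> a0 d0 m0 pV; have [C C0 hC] := @cnt_ellipse R F hF a b d a0 d0.
exists (C * (nres m V)%:R); first by rewrite mulr_ge0.
have mz : m%:Z != 0 by clear -m0; lia.
move=> T T0; have mR : 0 < m%:R :> R by rewrite ltr0n.
have m1 : 1 <= m%:R :> R by rewrite ler1n.
set r := Num.sqrt T / m%:R.
have sT : 0 < Num.sqrt T by rewrite sqrtr_gt0.
have r0 : 0 < r by rewrite divr_gt0.
have r2 : m%:R ^+ 2 * r ^+ 2 = T.
  by rewrite /r expr_div_n sqr_sqrtr ?ltW // mulrC divfK // expf_neq0 // gt_eqF.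
pose Q (p v : int * int) := exists k l : int,
  v = (p.1 + m%:Z * k, p.2 + m%:Z * l) /\ sqform a b d v <= T.
have [|n nP] := @choice_in _ nat (residues m V) (fun p n =>
    cnt (Q p) n /\ `|n%:R - J * r ^+ 2 / d| <= C * (r + 1)) 0%N.
  move=> [i j] _; have [n h1 h2] := hC (i%:~R / m%:R) (j%:~R / m%:R) r r0.
  exists n; split=> //.
  have inj (v w : int * int) : (i + m%:Z * v.1, j + m%:Z * v.2) =
      (i + m%:Z * w.1, j + m%:Z * w.2) -> v = w.
    case: v w => [v1 v2] [w1 w2] /= [/addrI h3 /addrI h4].
    by rewrite (mulfI mz h3) (mulfI mz h4).
  have := cnt_map (fun v w _ _ => inj v w) h1; apply: eq_cnt => v.
  have key k l : ((a * (k%:~R + i%:~R / m%:R) + b * (l%:~R + j%:~R / m%:R)) ^+ 2 +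
      (d / a * (l%:~R + j%:~R / m%:R)) ^+ 2 <= r ^+ 2) =
      (sqform a b d (i + m%:Z * k, j + m%:Z * l) <= T).
    rewrite -r2 /sqform /= !intrD !intrM -[RHS](ler_pM2l (x := (m%:R ^+ 2)^-1)).
      rewrite mulKf ?expf_neq0 ?gt_eqF //; congr (_ <= _).
      by field; rewrite !gt_eqF.
    by rewrite invr_gt0 exprn_gt0.
  split=> [[[k l] /= h ->]|[k [l [-> h]]]].
    by exists k, l; split=> //; rewrite -key.
  by exists (k, l) => //=; rewrite key.
exists (\sum_(p <- residues m V) n p)%N.
  have ur : uniq (residues m V).
    rewrite filter_uniq // allpairs_uniq ?iota_uniq //.
    by move=> [i j] [i' j'] _ _ /= [-> ->].
  apply: eq_cnt (cnt_sum (P := Q) ur _ _) => [v|p /nP[] //|].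
    split=> [[p] /[swap] -[k [l [-> h]]]|[Vv qv]].
      by rewrite mem_filter => /andP[Vp _]; rewrite /= pV.
    have E (x : int) : x = (x %% m)%Z + m%:Z * (x %/ m)%Z.
      by rewrite {1}(divz_eq x m) addrC mulrC.
    exists ((v.1 %% m)%Z, (v.2 %% m)%Z); last first.
      by exists (v.1 %/ m)%Z, (v.2 %/ m)%Z; rewrite /= -!E -surjective_pairing.
    rewrite mem_filter /=; apply/andP; split.
      by rewrite (E v.1) (E v.2) pV in Vv.
    have B x : exists2 i, (x %% m)%Z = i%:Z & i \in iota 0 m.
      exists (absz (x %% m)%Z); first by rewrite gez0_abs // modz_ge0.
      rewrite mem_iota add0n /= -ltz_nat gez0_abs ?modz_ge0 //.
      by rewrite ltz_mod // -lt0n.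
    have [i -> im] := B v.1; have [j -> jm] := B v.2.
    by apply/allpairsP; exists (i, j).
  move=> p p' v; rewrite !mem_filter => /andP[_ /allpairsP[[i j] /= [im jm ->]]].
  move=> /andP[_ /allpairsP[[i' j'] /= [im' jm' ->]]].
  move=> [k [l [-> _]]] [k' [l' [[/= h1 h2] _]]].
  have U (x y : nat) (s t : int) : x \in iota 0 m -> y \in iota 0 m ->
      x%:Z + m%:Z * s = y%:Z + m%:Z * t -> x = y.
    rewrite !mem_iota !add0n /= => xm ym h.
    have : ((x%:Z + m%:Z * s) %% m)%Z = ((y%:Z + m%:Z * t) %% m)%Z by rewrite h.
    rewrite ![m%:Z * _]mulrC ![x%:Z + _]addrC ![y%:Z + _]addrC !modzMDl.
    by rewrite !modz_nat !modn_small // => -[].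
  by rewrite (U _ _ _ _ im im' h1) (U _ _ _ _ jm jm' h2).
have -> : J * (nres m V)%:R / m%:R ^+ 2 / d * T =
    \sum_(p <- residues m V) J * r ^+ 2 / d.
  rewrite big_const_seq count_predT iter_addr_0 -/(nres m V) -r2 -mulr_natr.
  by field; rewrite !gt_eqF.
rewrite natr_sum -sumrB; apply: le_trans (ler_norm_sum _ _ _) _.
have -> : C * (nres m V)%:R * (Num.sqrt T + 1) =
    \sum_(p <- residues m V) C * (Num.sqrt T + 1).
  by rewrite big_const_seq count_predT iter_addr_0 -/(nres m V) -mulr_natr; ring.
rewrite big_seq [leRHS]big_seq; apply: ler_sum => p /nP[_ h].
apply: le_trans h _; apply: ler_wpM2l => //; rewrite lerD2r /r.
by rewrite ler_pdivrMr // ler_peMr // ltW.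
Qed.

End Count.

(** * Bounds for the sieve *)

Section Sieve.
Import classical_sets.
Context {R : realType}.

Lemma nonincreasing_limit (u : nat -> R) (c : R) :
  (forall n, u n.+1 <= u n) -> (forall n, c <= u n) ->
  exists l, [/\ c <= l, forall n, l <= u n &
    forall e, 0 < e -> exists n0, forall n, (n0 <= n)%N -> u n < l + e].
Proof.
move=> um cu; pose A := [set x | exists n, x = u n]%classic.
have A0 : (A !=set0)%classic by exists (u 0%N), 0%N.
have Ac : lbound A c by move=> _ [n ->].
have hA : has_inf A by split=> //; exists c.
exists (inf A); split.
- exact: lb_le_inf.
- by move=> n; apply: ge_inf; [exists c|exists n].
move=> e e0; have [_ [n0 ->] lt0] := inf_adherent e0 hA.
exists n0 => n /subnK <-; apply: le_lt_trans lt0; elim: (n - n0)%N => // k.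
by apply: le_trans; rewrite addSn.
Qed.

Variables (F : R -> R) (hF : primitive_of_semi F).
Let J := 4 * (F 1 - F 0).

Lemma J_gt0 : 0 < J.
Proof.
have /andP[h1 _] := @hF 0 (2^-1) (lexx _) ltac:(lra).
have /andP[h2 _] := @hF (2^-1) 1 ltac:(lra) ltac:(lra).
have s : 0 < semi (2^-1 : R) by rewrite sqrtr_gt0; lra.
rewrite [semi 1](_ : _ = 0) in h2; last by rewrite /semi expr1n subrr sqrtr0.
by rewrite /J; lra.
Qed.

Lemma J_ge0 : 0 <= J. Proof. exact: ltW J_gt0. Qed.

Lemma sqform_min (a b d : R) : 0 < a -> 0 < d -> exists2 l : R, 0 < l &
  forall v : int * int, v != (0, 0) -> l <= sqform a b d v.
Proof.
(* If v.2 is nonzero the second square is at least (d / a)^2; otherwise only a^2 v.1^2 remains. *)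
move=> a0 d0; exists (Num.min (a ^+ 2) ((d / a) ^+ 2)).
  by rewrite lt_min !exprn_gt0 // divr_gt0.
have sq1 (z : int) : z != 0 -> 1 <= z%:~R ^+ 2 :> R.
  move=> z0; rewrite -rmorphXn /= -[leLHS]/(1%:~R) ler_int.
  by clear -z0; rewrite expr2; nia.
move=> [x y] xy; rewrite ge_min /sqform /=.
have [y0|y0] := eqVneq y 0; last first.
  apply/orP; right; rewrite [(_ * y%:~R) ^+ 2]exprMn; apply: ler_wpDl; first exact: sqr_ge0.
  by apply: ler_peMr; rewrite ?sqr_ge0 ?sq1.
apply/orP; left; rewrite y0 mulr0z !mulr0 addr0 expr0n /= addr0 exprMn. apply: ler_peMr; rewrite ?sqr_ge0 //.
by apply: sq1; apply: contraNneq xy => ->; rewrite y0.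
Qed.

(** Leaving out the origin removes the constant term of the error: below the minimum l of the form
    nothing is counted, and from l on sqrt T + 1 is O(T). A bound linear in T is what allows
    summation over the multiples of all large e. *)
Lemma cnt_nonzero_le (a b d : R) : 0 < a -> 0 < d -> exists2 C, 0 <= C &
  forall T : R, 0 < T -> exists2 n,
    cnt (fun v : int * int => v != (0, 0) /\ sqform a b d v <= T) n & n%:R <= C * T.
Proof.
move=> a0 d0; have [l l0 lP] := sqform_min b a0 d0.
have [C C0 hC] := @cnt_periodic R F hF a b d 1 (fun _ _ => true) a0 d0 isT (fun _ _ _ _ => erefl).
set K := J * _ / _ / d in hC.
have K0 : 0 <= K.
  apply: divr_ge0; last exact: ltW.
  by apply: divr_ge0; [apply: mulr_ge0; [exact: J_ge0|]|rewrite exprn_ge0].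
have l2 : 0 <= 2 / l by apply: divr_ge0 => //; exact: ltW.
have KC0 : 0 <= K + C * (1 + 2 / l).
  by apply: addr_ge0 => //; apply: mulr_ge0 => //; lra.
exists (K + C * (1 + 2 / l)) => //.
move=> T T0; have [n nP nE] := hC T T0.
have [m mP] := cnt_sub (fun v => v != (0, 0)) nP; exists m.
  by apply: eq_cnt mP => v; split=> [[[]]|[]].
have [Tl|lT] := ltP T l.
  case: mP => s [_ <- sP]; case: s sP => [|v s sP].
    by move=> _; rewrite mulr0n; apply: mulr_ge0 => //; exact: ltW.
  by have [[_ h1] /lP h2] := (sP v).1 (mem_head _ _); lra.
have mn : m%:R <= n%:R :> R by rewrite ler_nat; apply: cnt_le mP nP => v [].
apply: le_trans mn _; move: nE; rewrite ler_norml => /andP[_ nE].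
have s0 := sqrtr_ge0 T; have s2 := sqr_sqrtr (ltW T0).
have : Num.sqrt T + 1 <= (1 + 2 / l) * T.
  have : 1 <= T / l by rewrite ler_pdivlMr // mul1r.
  have -> : (1 + 2 / l) * T = T + 2 * (T / l) by ring.
  move: s0 s2; set s := Num.sqrt T; nra.
move=> /(ler_wpM2l C0) h.
have -> : (K + C * (1 + 2 / l)) * T = K * T + C * ((1 + 2 / l) * T) by ring.
lra.
Qed.

(** Telescoping, since 1 / e^2 is at most 1 / (e - 1) - 1 / e. *)
Lemma sum_inv_sq (B E : nat) : (0 < B)%N ->
  \sum_(e <- iota B.+1 E) (e%:R ^+ 2)^-1 <= B%:R^-1 :> R.
Proof.
move=> B0; apply: (@le_trans _ _ (B%:R^-1 - (B + E)%:R^-1)); last first.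
  by rewrite gerBl invr_ge0.
elim: E B B0 => [|E IH] B B0; first by rewrite big_nil addn0 subrr.
rewrite /= big_cons; apply: le_trans (lerD (lexx _) (IH _ _)) _ => //.
rewrite addSnnS addrA lerD2r -lerBrDr.
have b0 : 0 < B%:R :> R by rewrite ltr0n.
have -> : B%:R^-1 - B.+1%:R^-1 = (B%:R * B.+1%:R)^-1 :> R.
  by rewrite -natr1; field; rewrite !gt_eqF //; lra.
rewrite lef_pV2 ?posrE ?mulr_gt0 ?exprn_gt0 ?ltr0n //.
by rewrite expr2 ler_wpM2r // ler_nat.
Qed.

(** Primes dividing m are left out because the condition at such a prime is a condition on residues
    modulo m. *)
Definition sieving_primes (m B : nat) :=
  [seq p <- iota 1 B | prime p && ~~ (p %| m)%N].

Definition sieve_density (m B : nat) : R :=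
  \prod_(p <- sieving_primes m B) (1 - (p%:R ^+ 2)^-1).

Lemma sieve_densityS m B : sieve_density m B.+1 = sieve_density m B *
  (if prime B.+1 && ~~ (B.+1 %| m)%N then 1 - (B.+1%:R ^+ 2)^-1 else 1).
Proof.
have E : iota 1 B.+1 = iota 1 B ++ [:: B.+1] by rewrite -[B.+1 in LHS]addn1 iotaD add1n.
rewrite /sieve_density /sieving_primes E filter_cat big_cat /=.
by case: ifP => _; rewrite ?big_seq1 ?big_nil.
Qed.

(** Extending the product to all integers from 2 to B makes it smaller and telescopes it to (B + 1)
    / (2 B). *)
Lemma sieve_density_ge m B : 2^-1 <= sieve_density m B.
Proof.
case: B => [|B]; first by rewrite /sieve_density big_nil; lra.
have step : (B.+2%:R / (2 * B.+1%:R)) <= sieve_density m B.+1.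
  elim: B => [|B IH].
    by rewrite sieve_densityS /sieve_density /= big_nil; lra.
  rewrite sieve_densityS; set c := if _ then _ else _.
  have b0 : 0 < B.+1%:R :> R by rewrite ltr0n.
  have c1 : 1 - (B.+2%:R ^+ 2)^-1 <= c.
    by rewrite /c; case: ifP => // _; rewrite gerBl invr_ge0 exprn_ge0.
  have p0 : 0 < 1 - (B.+2%:R ^+ 2)^-1 :> R.
    by rewrite subr_gt0 invf_lt1 ?exprn_gt0 ?ltr0n // expr_gt1 ?ltr1n.
  apply: le_trans (ler_pM _ (ltW p0) IH c1).
    rewrite le_eqVlt; apply/orP; left; apply/eqP.
    by rewrite -![_.+3%:R]natr1 -![_.+2%:R]natr1; field; rewrite !gt_eqF //; lra.
  by rewrite divr_ge0 ?mulr_ge0.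
apply: le_trans step; have b0 : 0 < B.+1%:R :> R by rewrite ltr0n.
by rewrite ler_pdivlMr ?mulr_gt0 // -[B.+2%:R]natr1; lra.
Qed.

Lemma sieve_density_nonincreasing m B : sieve_density m B.+1 <= sieve_density m B.
Proof.
rewrite sieve_densityS; apply: ler_piMr.
  by apply: le_trans (sieve_density_ge m B); lra.
by case: ifP => // _; rewrite gerBl invr_ge0 exprn_ge0.
Qed.

End Sieve.

Lemma periodic_and m V G : periodic m V -> periodic m G ->
  periodic m (fun x y => V x y && G x y).
Proof. by move=> pV pG x y k l; rewrite pV pG. Qed.

Lemma periodic_dvd m n V : (m %| n)%N -> periodic m V -> periodic n V.
Proof. by move=> /dvdnP[k ->]; rewrite mulnC; apply: periodicM. Qed.

Lemma periodic_primes m : (0 < m)%N -> periodic m (coprime_to (primes m)).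
Proof.
move=> m0 x y k l; apply: eq_in_all => p; rewrite mem_primes => /and3P[_ _ pm].
exact: (periodic_dvd pm (@periodic_not_both p)).
Qed.

Lemma sieving_primesP m B :
  [/\ uniq (sieving_primes m B), all prime (sieving_primes m B) &
      coprime m (\prod_(p <- sieving_primes m B) p)].
Proof.
rewrite /sieving_primes; split; first by rewrite filter_uniq // iota_uniq.
  by apply/allP => p; rewrite mem_filter => /andP[/andP[]].
elim: (iota 1 B) => [|p s IH] /=; first by rewrite big_nil coprimen1.
case: ifP => // /andP[pp pm]; rewrite big_cons coprimeMr IH andbT.
by rewrite coprime_sym prime_coprime.
Qed.

Section Primitive.
Context {R : realType}.

Lemma sieve_densityE m B : sieve_density m B =
  (\prod_(p <- sieving_primes m B) (p ^ 2).-1)%:R /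
  (\prod_(p <- sieving_primes m B) p)%:R ^+ 2 :> R.
Proof.
rewrite /sieve_density; have [_ + _] := sieving_primesP m B.
elim: (sieving_primes m B) => [|p s IH] /=; first by rewrite !big_nil expr1n divr1.
move=> /andP[pp ps]; rewrite !big_cons IH // !natrM.
have p0 : (0 < p)%N := prime_gt0 pp.
have p2 : 0 < p%:R :> R by rewrite ltr0n.
have s0 : 0 < (\prod_(j <- s) j)%:R :> R.
  rewrite ltr0n big_seq prodn_cond_gt0 // => q /(allP ps); exact: prime_gt0.
rewrite -subn1 natrB ?expn_gt0 ?p0 // natrX.
by field; rewrite !gt_eqF.
Qed.

Variables (F : R -> R) (hF : primitive_of_semi F).
Let J := 4 * (F 1 - F 0).

Definition prim_in (W : int -> int -> bool) (v : int * int) :=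
  coprimez v.1 v.2 && W v.1 v.2.

(** Multiples of e of value at most T correspond to nonzero vectors of value at most T / e^2.
    Summing C T / e^2 over e > B gives C T / B, whatever N is. *)
Lemma cnt_multiples (a b d : R) : 0 < a -> 0 < d -> exists2 C, 0 <= C &
  forall (B N : nat) (T : R), (0 < B)%N -> 0 < T -> exists2 n,
    cnt (fun v : int * int => exists2 e, e \in iota B.+1 N &
      [/\ v != (0, 0), (e%:Z %| v.1)%Z, (e%:Z %| v.2)%Z & sqform a b d v <= T]) n &
    n%:R <= C * T / B%:R.
Proof.
move=> a0 d0; have [C C0 hC] := @cnt_nonzero_le R F hF a b d a0 d0.
exists C => // B N T B0 T0.
have [|n nP] := @choice_in _ nat (iota B.+1 N) (fun e n => cnt (fun v : int * int =>
      [/\ v != (0, 0), (e%:Z %| v.1)%Z, (e%:Z %| v.2)%Z & sqform a b d v <= T]) n /\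
    n%:R <= C * (T / e%:R ^+ 2)) 0%N.
  move=> e; rewrite mem_iota => /andP[Be _].
  have e0 : (0 < e)%N by apply: leq_trans Be.
  have eR : 0 < e%:R :> R by rewrite ltr0n.
  have ez : e%:Z != 0 by rewrite eqz_nat -lt0n.
  have [|n nP nle] := hC (T / e%:R ^+ 2); first by rewrite divr_gt0 // exprn_gt0.
  exists n; split=> //.
  have sc k : (sqform a b d k <= T / e%:R ^+ 2) =
      (sqform a b d (e%:Z * k.1, e%:Z * k.2) <= T).
    by rewrite sqform_scale ler_pdivlMr ?exprn_gt0 // mulrC.
  have := cnt_map (f := fun k : int * int => (e%:Z * k.1, e%:Z * k.2)) _ nP.
  move=> h; apply: eq_cnt (h _) => [v|[k l] [k' l'] _ _ /= [h1 h2]]; last first.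
    by rewrite (mulfI ez h1) (mulfI ez h2).
  split=> [[[k l] [kl]]|].
    rewrite sc => h1 ->; rewrite /= !dvdz_mulr //; split=> //.
    apply: contraNneq kl => -[/eqP + /eqP]; rewrite !mulf_eq0 (negbTE ez) /=.
    by move=> /eqP -> /eqP ->.
  case: v => v1 v2 /= [v0 /dvdzP[k kE] /dvdzP[l lE] vT].
  exists (k, l); last by rewrite kE lE /= ![_ * e%:Z]mulrC.
  rewrite sc /= ![e%:Z * _]mulrC -kE -lE; split=> //.
  by apply: contraNneq v0 => -[k0 l0]; rewrite kE lE k0 l0 !mul0r.
have [|k kP kle] := @cnt_ex _ _ (iota B.+1 N) (fun e (v : int * int) =>
  [/\ v != (0, 0), (e%:Z %| v.1)%Z, (e%:Z %| v.2)%Z & sqform a b d v <= T]) n.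
  by move=> e /nP[].
exists k => //; apply: (@le_trans _ _ (\sum_(e <- iota B.+1 N) C * (T / e%:R ^+ 2))).
  rewrite -(ler_nat R) natr_sum in kle; apply: le_trans kle _.
  by rewrite big_seq [leRHS]big_seq; apply: ler_sum => e /nP[].
rewrite -mulr_sumr -mulr_sumr mulrA ler_wpM2l ?mulr_ge0 ?(ltW T0) //.
exact: sum_inv_sq.
Qed.

Definition prim_residues m W :=
  nres m (fun x y => W x y && coprime_to (primes m) x y).

(* Sieving by the primes up to B only; the non-primitive pairs that survive are divisible by
   some e > B and cost O(T / B). *)
Lemma cnt_primitive_sandwich (m : nat) (W : int -> int -> bool) (a b d : R) :
  (1 < m)%N -> periodic m W -> 0 < a -> 0 < d ->
  let K := J / m%:R ^+ 2 * (prim_residues m W)%:R / d in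
  exists2 C1, 0 <= C1 & forall B : nat, (0 < B)%N -> exists2 C, 0 <= C &
  forall T : R, 0 < T -> exists2 n,
    cnt (fun v => prim_in W v /\ sqform a b d v <= T) n &
    K * sieve_density m B * T - C * (Num.sqrt T + 1) - C1 * T / B%:R <= n%:R
      <= K * sieve_density m B * T + C * (Num.sqrt T + 1).
Proof.
move=> m1 pW a0 d0 K; have m0 : (0 < m)%N := ltnW m1.
have [C1 C10 hC1] := @cnt_multiples a b d a0 d0; exists C1 => // B B0.
have [l l0 lP] := @sqform_min R a b d a0 d0.
have [ups aps cps] := sieving_primesP m B.
set ps := sieving_primes m B in ups aps cps *.
set P := (\prod_(p <- ps) p)%N in cps *.
pose W' x y := W x y && coprime_to (primes m) x y.
have pW' : periodic m W' by apply: periodic_and => //; exact: periodic_primes.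
pose V x y := W' x y && coprime_to ps x y.
have pV : periodic (m * P) V.
  apply: periodic_and; first exact: periodicM.
  by rewrite mulnC; apply: periodicM; exact: periodic_coprime_to.
have P0 : (0 < P)%N.
  by rewrite /P big_seq prodn_cond_gt0 // => q /(allP aps); exact: prime_gt0.
have [|C C0 hC] := @cnt_periodic R F hF a b d (m * P) V a0 d0 _ pV.
  by rewrite muln_gt0 m0.
exists C => // T T0; have [k kP kE] := hC T T0.
(* By the Chinese remainder theorem the count modulo m P factors, and the factor at P gives the
   truncated Euler product. *)
have kK : J * (nres (m * P) V)%:R / (m * P)%:R ^+ 2 / d = K * sieve_density m B.
  rewrite sieve_densityE -/ps -/P -nres_coprime_to // -/P (nres_crt cps) //.
    rewrite /K /prim_residues -/W' !natrM; field.
    by rewrite !pnatr_eq0 -!lt0n m0 P0 gt_eqF.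
  exact: periodic_coprime_to.
rewrite -/J kK in kE.
have primV v : prim_in W v -> V v.1 v.2.
  move=> /andP[cv Wv].
  have nb p : prime p -> not_both p v.1 v.2.
    move=> pp; apply/negP => /andP[p1 p2].
    have : (p%:Z %| gcdz v.1 v.2)%Z by rewrite dvdz_gcd p1 p2.
    by rewrite (eqP cv) dvdz1 /=; case: p pp {p1 p2} => [|[]].
  rewrite /V /W' Wv /=; apply/andP; split; apply/allP => p.
    by rewrite mem_primes => /and3P[pp _ _]; exact: nb.
  by move=> /(allP aps); exact: nb.
have [n nP] := cnt_sub (prim_in W) kP.
have {}nP : cnt (fun v => prim_in W v /\ sqform a b d v <= T) n.
  by apply: eq_cnt nP => v; split=> [[[_ ?] ?]|[/[dup] /primV ? ? ?]].
(* A prime p dividing both coordinates of a vector of value at most T satisfies p <= p^2 <= T / l,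
   with l the minimum of the form; this bounds the range of the divisors e. *)
have [q qP qle] := hC1 B (Num.truncn (T / l)) T B0 T0.
have nk : (n <= k)%N by apply: cnt_le nP kP => v [/primV].
have kn : (k <= n + q)%N.
  apply: cnt_leU nP qP kP => v [Vv vT].
  have [cv|ncv] := boolP (coprimez v.1 v.2).
    by left; split=> //; rewrite /prim_in cv; case/andP: Vv => /andP[].
  right; have [p pp /andP[p1 p2]] : exists2 p, prime p & ((p%:Z %| v.1) && (p%:Z %| v.2))%Z.
    have [g0|g0] := eqVneq (gcdz v.1 v.2) 0.
      by exists 2%N; rewrite // -dvdz_gcd g0 dvdz0.
    exists (pdiv `|gcdz v.1 v.2|%N); last by rewrite -dvdz_gcd dvdzE /= pdiv_dvd.
    apply: pdiv_prime; move: ncv g0; rewrite /coprimez /gcdz /=.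
    by case: (gcdn _ _) => [|[]].
  have pB : (B < p)%N.
    rewrite ltnNge; apply/negP => pB; move: Vv; rewrite /V /W' -andbA => /and3P[_].
    have [pm|npm] := boolP (p %| m)%N.
      have pin : p \in primes m by rewrite mem_primes pp m0.
      by move=> /allP /(_ p pin); rewrite /not_both p1 p2.
    have pin : p \in ps by rewrite mem_filter pp npm mem_iota prime_gt0 //= add1n ltnS.
    by move=> _ /allP /(_ p pin); rewrite /not_both p1 p2.
  (* As [1 < m], some prime divides m, and the condition at that prime excludes the origin. *)
  have v0 : v != (0, 0).
    apply/eqP => v0; move: Vv; rewrite /V /W' -andbA => /and3P[_ /allP h _].
    have pin : pdiv m \in primes m by rewrite mem_primes pdiv_prime // m0 pdiv_dvd.
    by have := h _ pin; rewrite /not_both v0 !dvdz0.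
  exists p; last by split.
  rewrite mem_iota pB /= addSn ltnS; apply: leq_trans (leq_addl _ _).
  have pR : 1 <= p%:R :> R by rewrite ler1n prime_gt0.
  have Tl0 : 0 <= T / l by rewrite divr_ge0 // ltW.
  rewrite truncn_ge_nat // ler_pdivlMr //; apply: le_trans vT.
  move: p1 p2 v0 {Vv ncv}; case: v => v1 v2 /= /dvdzP[x ->] /dvdzP[y ->] v0.
  rewrite ![_ * p%:Z]mulrC (@sqform_scale R a b d p%:Z (x, y)).
  have /lP h : (x, y) != (0, 0).
    by apply: contraNneq v0 => -[-> ->]; rewrite !mul0r.
  apply: ler_pM => //; first exact: ltW.
  by rewrite -[leLHS]expr1 ler_weXn2l.
exists n => //; move: kE; rewrite ler_norml => /andP[kE1 kE2].
have nkR : n%:R <= k%:R :> R by rewrite ler_nat.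
have knR : k%:R <= n%:R + q%:R :> R by rewrite -natrD ler_nat.
by apply/andP; split; lra.
Qed.

End Primitive.

(** * Passage to the limit *)

Section Limit.
Context {R : realType}.

Lemma sqrt_negligible (C e : R) : 0 <= C -> 0 < e -> exists2 T0, 0 < T0 &
  forall T, T0 <= T -> C * (Num.sqrt T + 1) <= e * T.
Proof.
move=> C0 e0; pose s0 := 1 + 2 * C / e.
have s1 : 1 <= s0 by rewrite /s0 lerDl divr_ge0 ?mulr_ge0 // ltW.
exists (s0 ^+ 2) => [|T hT]; first by rewrite exprn_gt0 //; lra.
have T0 : 0 <= T by apply: le_trans hT; exact: sqr_ge0.
have sT : s0 <= Num.sqrt T by rewrite -(ger0_norm (le_trans ler01 s1)) -sqrtr_sqr ler_wsqrtr.
have {2}<- := sqr_sqrtr T0; move: sT; set s := Num.sqrt T => sT.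
have Ce : 2 * C <= e * s.
  have : 2 * C / e <= s by move: sT; rewrite /s0; lra.
  by rewrite ler_pdivrMr // [e * s]mulrC.
have h : 1 <= s by lra.
by rewrite expr2 mulrA; nra.
Qed.

(** The order of the quantifiers is the point: rho is fixed by m before W and the form are given, so
    two forms with equal d and equally many admissible residues have the same asymptotics. *)
Theorem cnt_primitive (m : nat) : (1 < m)%N -> exists2 rho : R, 0 < rho &
  forall (W : int -> int -> bool) (a b d : R), periodic m W -> 0 < a -> 0 < d ->
  (forall T : R, exists n, cnt (fun v => prim_in W v /\ sqform a b d v <= T) n) /\
  forall e : R, 0 < e -> exists T0, forall T, T0 <= T -> forall n,
    cnt (fun v => prim_in W v /\ sqform a b d v <= T) n ->
    `|n%:R / T - rho * (prim_residues m W)%:R / d| < e.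
Proof.
move=> m1; have [F hF] := semicircle_primitive R.
set J := 4 * (F 1 - F 0); have J0 : 0 < J := @J_gt0 R F hF.
have [th [th2 thle thlim]] := nonincreasing_limit
  (@sieve_density_nonincreasing R m) (@sieve_density_ge R m).
have th0 : 0 < th by lra.
have mR : 0 < m%:R :> R by rewrite ltr0n ltnW.
exists (J / m%:R ^+ 2 * th); first by rewrite mulr_gt0 // divr_gt0 // exprn_gt0.
move=> W a b d pW a0 d0.
have [C1 C10 sand] := @cnt_primitive_sandwich R F hF m W a b d m1 pW a0 d0.
rewrite -/J in sand; set K := J / _ * _ / d in sand.
have K0 : 0 <= K.
  apply: divr_ge0; last exact: ltW.
  by apply: mulr_ge0 => //; apply: divr_ge0; rewrite ?exprn_ge0 ?(ltW J0).
split=> [T|e e0].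
  have [C C0 h] := sand 1%N isT.
  have [n nP _] := h (Num.max T 1) ltac:(by rewrite lt_max ltr01 orbT).
  have [n' n'P] := cnt_sub (fun v => sqform a b d v <= T) nP.
  exists n'; apply: eq_cnt n'P => v; split=> [[[]] //|[pv vT]].
  by split=> //; split=> //; rewrite le_max vT.
pose e4 := e / 4; have e40 : 0 < e4 by rewrite /e4; lra.
(* B is fixed before T. The denominator K + 1 covers the case K = 0. *)
have [n0 hn0] := thlim (e4 / (K + 1)) ltac:(by rewrite divr_gt0 //; lra).
have [B B0 [hB1 hB2]] : exists2 B : nat, (0 < B)%N &
    K * sieve_density m B <= K * th + e4 /\ C1 / B%:R <= e4.
  pose B := (maxn n0 (Num.truncn (C1 / e4))).+1; exists B => //.
  have BR : 0 < B%:R :> R by rewrite ltr0n.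
  split.
    have /hn0 h : (n0 <= B)%N by rewrite /B leqW // leq_maxl.
    have : K * (e4 / (K + 1)) <= e4.
      by rewrite mulrA ler_pdivrMr ?mulrDr ?mulr1; [rewrite mulrC lerDl ltW|lra].
    by have := ler_wpM2l K0 (ltW h); lra.
  rewrite ler_pdivrMr // mulrC -ler_pdivrMr //.
  have := @truncn_itv R (C1 / e4) (divr_ge0 C10 (ltW e40)) => /andP[_ h].
  by apply: le_trans (ltW h) _; rewrite ler_nat /B ltnS leq_maxr.
have [C C0 hC] := sand B B0.
have [T0 T00 hT0] := sqrt_negligible C0 e40.
exists T0 => T TT n nP; have Tp : 0 < T by apply: lt_le_trans TT.
have [n' /(cnt_inj nP) <- /andP[lo hi]] := hC T Tp.
have st := hT0 T TT.
have -> : J / m%:R ^+ 2 * th * (prim_residues m W)%:R / d = K * th.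
  by rewrite /K; ring.
have thB := ler_wpM2l K0 (thle B).
have h1 : n%:R <= (K * th + e4 + e4) * T.
  have := ler_wpM2r (ltW Tp) hB1; lra.
have h2 : (K * th - e4 - e4) * T <= n%:R.
  have := ler_wpM2r (ltW Tp) hB2; have := ler_wpM2r (ltW Tp) thB.
  by rewrite [_ / B%:R * T]mulrAC; lra.
rewrite -ler_pdivrMr // in h1; rewrite -ler_pdivlMr // in h2.
by rewrite ltr_norml; apply/andP; move: h1 h2; rewrite /e4; split; lra.
Qed.

End Limit.

(** * Normal forms of special matrices *)

Definition i0 : 'I_3 := ord0.
Definition i1 : 'I_3 := lift ord0 ord0.
Definition i2 : 'I_3 := lift ord0 (lift ord0 ord0).

Lemma forall_I3 (P : 'I_3 -> Prop) : P i0 -> P i1 -> P i2 -> forall i, P i.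
Proof.
move=> p0 p1 p2 [[|[|[|//]]] h].
- by rewrite (_ : Ordinal h = i0) //; apply: val_inj.
- by rewrite (_ : Ordinal h = i1) //; apply: val_inj.
- by rewrite (_ : Ordinal h = i2) //; apply: val_inj.
Qed.

Lemma sum_I3 (V : nmodType) (f : 'I_3 -> V) : \sum_(i < 3) f i = f i0 + f i1 + f i2.
Proof. by rewrite !big_ord_recl big_ord0 addr0 addrA. Qed.

Definition mx3 (R : Type) (a b c d e f g h i : R) : 'M[R]_3 :=
  \matrix_(k < 3, l < 3) nth a (nth [::] [:: [:: a; b; c]; [:: d; e; f]; [:: g; h; i]] k) l.

Lemma mx3P (R : Type) (A : 'M[R]_3) : A = mx3 (A i0 i0) (A i0 i1) (A i0 i2)
  (A i1 i0) (A i1 i1) (A i1 i2) (A i2 i0) (A i2 i1) (A i2 i2).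
Proof. by apply/matrixP; do 2![apply: forall_I3]; rewrite mxE. Qed.

Lemma det_mx3 (R : comNzRingType) (a b c d e f g h i : R) :
  \det (mx3 a b c d e f g h i) =
  a * (e * i - f * h) - b * (d * i - f * g) + c * (d * h - e * g).
Proof.
rewrite (expand_det_row _ i0) sum_I3 /cofactor.
do 3![rewrite (expand_det_row _ ord0) !big_ord_recl big_ord0 /cofactor !det_mx11].
rewrite !mxE /=.
repeat match goal with |- context [bump ?u ?v] =>
  let w := eval vm_compute in (bump u v) in change (bump u v) with w end.
rewrite /=; ring.
Qed.

Lemma mulmx3 (R : pzSemiRingType) (A B : 'M[R]_3) i j :
  (A *m B) i j = A i i0 * B i0 j + A i i1 * B i1 j + A i i2 * B i2 j.
Proof. by rewrite mxE sum_I3. Qed.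

Lemma congruence_entry (R : comNzRingType) (S A : 'M[R]_3) i j :
  (A^T *m S *m A) i j = \sum_k \sum_l A k i * S k l * A l j.
Proof.
rewrite mxE exchange_big; apply: eq_bigr => l _; rewrite mxE mulr_suml.
by apply: eq_bigr => k _; rewrite mxE.
Qed.

Lemma dvdn_gcd_entries d (M : 'M[int]_3) : reflect (forall i j, d%:Z %| M i j)%Z (d %| gcd_entries M)%N.
Proof.
rewrite /gcd_entries; apply: (iffP (dvdn_biggcdP _ _ _)) => [h i j|h i _].
  by have /dvdn_biggcdP/(_ j isT) := h i isT.
by apply/dvdn_biggcdP => j _; exact: h.
Qed.

Lemma dvdn_gcd_congruence (M A B : 'M[int]_3) : (gcd_entries M %| gcd_entries (A *m M *m B))%N.
Proof.
apply/dvdn_gcd_entries => i j; rewrite mxE; apply: rpred_sum => k _.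
apply: dvdz_mulr; rewrite mxE; apply: rpred_sum => l _; apply: dvdz_mull.
exact: (dvdn_gcd_entries _ _ (dvdnn _)).
Qed.

Lemma gcd_entries_unit (M A B : 'M[int]_3) : A \in unitmx -> B \in unitmx ->
  gcd_entries (A *m M *m B) = gcd_entries M.
Proof.
move=> uA uB; apply/eqP; rewrite eqn_dvd dvdn_gcd_congruence andbT.
have {2}-> : M = invmx A *m (A *m M *m B) *m invmx B.
  by rewrite !mulmxA mulVmx // mul1mx -mulmxA mulmxV // mulmx1.
exact: dvdn_gcd_congruence.
Qed.

(** Both sides, multiplied by B^T S B, give det S times the identity, and that matrix can be
    cancelled because its determinant is not 0. *)
Lemma adj_unit (S B : 'M[int]_3) : \det S != 0 -> B \in unitmx ->
  \adj (B^T *m S *m B) = invmx B *m \adj S *m invmx B^T.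
Proof.
move=> S0 uB; have uBt : B^T \in unitmx by rewrite unitmx_tr.
have dB : \det B * \det B = 1.
  by move: uB; rewrite unitmxE => /orP[] /eqP ->.
have dE : \det (B^T *m S *m B) = \det S.
  by rewrite !det_mulmx det_tr mulrAC dB mul1r.
have h : B^T *m S *m B *m (\adj (B^T *m S *m B) - invmx B *m \adj S *m invmx B^T) = 0.
  rewrite mulmxBr mul_mx_adj dE !mulmxA mulmxK // -[B^T *m S *m \adj S]mulmxA.
  by rewrite mul_mx_adj mul_mx_scalar -scalemxAl mulmxV // scalemx1 subrr.
apply/eqP; rewrite -subr_eq0; apply/eqP.
set X := _ - _ in h *; have := congr1 (mulmx (\adj (B^T *m S *m B))) h.
rewrite mulmxA mul_adj_mx dE mulmx0 mul_scalar_mx => /matrixP e.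
apply/matrixP => i j; have /eqP := e i j; rewrite !mxE mulf_eq0 (negbTE S0) /=.
by move=> /eqP.
Qed.

Lemma absOmega_unit (S B : 'M[int]_3) : \det S != 0 -> B \in unitmx ->
  absOmega (B^T *m S *m B) = absOmega S.
Proof.
move=> S0 uB; rewrite /absOmega /Sstar adj_unit // gcd_entries_unit ?unitmx_inv //.
by rewrite unitmx_tr.
Qed.

Lemma det_unit_congruence (S B : 'M[int]_3) : B \in unitmx ->
  \det (B^T *m S *m B) = \det S.
Proof.
rewrite unitmxE !det_mulmx det_tr mulrAC => /orP[] /eqP ->; rewrite ?mulrNN mul1r //.
Qed.

Lemma qform_col (S A : 'M[int]_3) (x : 'rV[int]_3) j :
  (forall i, A i j = x ord0 i) -> (A^T *m S *m A) j j = qform S x.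
Proof.
move=> Ax; rewrite congruence_entry /qform !mxE exchange_big.
apply: eq_bigr => l _; rewrite !mxE mulr_suml; apply: eq_bigr => k _.
by rewrite !Ax.
Qed.

(** The Smith form of the row x writes it as c times the first row of a unimodular U. Since c
    divides every entry of x, it is 1 or -1. *)
Lemma complete_basis (x : 'rV[int]_3) : primitive_vec x ->
  exists2 B : 'M[int]_3, B \in unitmx & forall i, B i i0 = x ord0 i.
Proof.
move=> px; have [L uL [U uU [d _ xE]]] := int_Smith_normal_form x.
pose c := L ord0 ord0 * d`_0.
have xc i : x ord0 i = c * U i0 i.
  rewrite xE mxE sum_I3 !mxE !big_ord1 !mxE /=.
  by rewrite !mulr0n mulr1n !mulr0 !mul0r !addr0.
have c1 : c * c = 1.
  have : (`|c| %| 1)%N.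
    by rewrite -px; apply/dvdn_biggcdP => i _; rewrite xc abszM dvdn_mulr.
  rewrite dvdn1; clear; nia.
exists (c *: U)^T; last by move=> i; rewrite !mxE xc.
by rewrite unitmx_tr unitmxZ //; apply/unitrPr; exists c.
Qed.

Lemma adj_mx3 (R : comNzRingType) (a b c d e f g h i : R) :
  \adj (mx3 a b c d e f g h i) =
  mx3 (e * i - f * h) (c * h - b * i) (b * f - c * e)
      (f * g - d * i) (a * i - c * g) (c * d - a * f)
      (d * h - e * g) (b * g - a * h) (a * e - b * d).
Proof.
apply/matrixP; do 2![apply: forall_I3]; rewrite mxE /cofactor.
all: rewrite (expand_det_row _ ord0) !big_ord_recl big_ord0 /cofactor !det_mx11 !mxE /=.
all: repeat match goal with |- context [bump ?u ?v] =>
  let w := eval vm_compute in (bump u v) in change (bump u v) with w end.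
all: rewrite /=; ring.
Qed.

Lemma dvdzN (d x : int) : (d %| - x)%Z = (d %| x)%Z.
Proof. by rewrite !dvdzE abszN. Qed.

(** The Gram matrix of a basis in which e_0 is isotropic and orthogonal to e_1. *)
Definition rform (m q r s : int) : 'M[int]_3 := mx3 0 0 m 0 (- q) r m r s.

Lemma det_rform m q r s : \det (rform m q r s) = m ^+ 2 * q.
Proof. by rewrite det_mx3; ring. Qed.

Lemma dvdn_absOmega_rform d m q r s : reflect
  [/\ d%:Z %| q * s + r ^+ 2, d%:Z %| r * m, d%:Z %| q * m & d%:Z %| m ^+ 2]%Z
  (d %| absOmega (rform m q r s))%N.
Proof.
rewrite /absOmega /Sstar adj_mx3; apply: (iffP (dvdn_gcd_entries _ _)) => [h|[h1 h2 h3 h4]].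
  split.
  - by have := h i0 i0; rewrite mxE /= -dvdzN; congr (_ %| _)%Z; ring.
  - by have := h i0 i1; rewrite mxE /=; congr (_ %| _)%Z; ring.
  - by have := h i0 i2; rewrite mxE /=; congr (_ %| _)%Z; ring.
  - by have := h i1 i1; rewrite mxE /= -dvdzN; congr (_ %| _)%Z; ring.
do 2![apply: forall_I3]; rewrite mxE /=.
- by rewrite [X in (_ %| X)%Z](_ : _ = - (q * s + r ^+ 2)) ?dvdzN ?dvdz0 //; ring.
- by rewrite [X in (_ %| X)%Z](_ : _ = r * m) ?dvdzN ?dvdz0 //; ring.
- by rewrite [X in (_ %| X)%Z](_ : _ = q * m) ?dvdzN ?dvdz0 //; ring.
- by rewrite [X in (_ %| X)%Z](_ : _ = r * m) ?dvdzN ?dvdz0 //; ring.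
- by rewrite [X in (_ %| X)%Z](_ : _ = - m ^+ 2) ?dvdzN ?dvdz0 //; ring.
- by rewrite [X in (_ %| X)%Z](_ : _ = 0) ?dvdzN ?dvdz0 //; ring.
- by rewrite [X in (_ %| X)%Z](_ : _ = q * m) ?dvdzN ?dvdz0 //; ring.
- by rewrite [X in (_ %| X)%Z](_ : _ = 0) ?dvdzN ?dvdz0 //; ring.
- by rewrite [X in (_ %| X)%Z](_ : _ = 0) ?dvdzN ?dvdz0 //; ring.
Qed.

Lemma congruence_sym (S B : 'M[int]_3) : S^T = S -> (B^T *m S *m B)^T = B^T *m S *m B.
Proof. by move=> Ss; rewrite !trmx_mul trmxK Ss mulmxA. Qed.

(** With e_0 = x the first row of the Gram matrix is (0, a, b); a Bezout change of the other two
    basis vectors makes it (0, 0, gcd(a, b)). The sign of q then follows from det S = m^2 q. *)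
Lemma rform_frame (S : 'M[int]_3) (x : 'rV[int]_3) :
  S^T = S -> 0 < \det S -> in_cone S x ->
  exists B m q r s, [/\ B \in unitmx, forall i, B i i0 = x ord0 i,
    B^T *m S *m B = rform m q r s, 0 < m & 0 < q].
Proof.
move=> Ss S0 [px qx]; have [B uB Bx] := complete_basis px.
have [S1 S1E] : exists S1, S1 = B^T *m S *m B by eexists.
have S1s : S1^T = S1 by rewrite S1E congruence_sym.
have S100 : S1 i0 i0 = 0 by rewrite S1E (qform_col _ Bx).
have sym i j : S1 i j = S1 j i by rewrite -{1}S1s mxE.
set a := S1 i0 i1; set b := S1 i0 i2.
have dS1 : \det S1 = \det S by rewrite S1E det_unit_congruence.
have [u [v uv]] := Bezoutz a b; set m := gcdz a b in uv.
have [a' aE] : exists a', a = a' * m by apply/dvdzP; exact: dvdz_gcdl.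
have [b' bE] : exists b', b = b' * m by apply/dvdzP; exact: dvdz_gcdr.
have m0 : m != 0.
  rewrite gcdz_eq0; apply/negP => /andP[/eqP a0 /eqP b0]; move: S0.
  rewrite -dS1 (_ : \det S1 = 0) ?ltxx //.
  by rewrite (mx3P S1) det_mx3 S100 -/a -/b a0 b0; ring.
have mp : 0 < m by rewrite lt_def m0.
have uv1 : u * a' + v * b' = 1.
  by apply: (mulIf m0); rewrite mul1r -[RHS]uv aE bE; ring.
pose U := mx3 1 0 0 0 b' u 0 (- a') v.
have uU : U \in unitmx.
  by rewrite unitmxE det_mx3 (_ : _ - _ + _ = 1) ?unitr1 // -[RHS]uv1; ring.
have [q [r [s E]]] : exists q r s, U^T *m S1 *m U = rform m q r s.
  exists (- (U^T *m S1 *m U) i1 i1), ((U^T *m S1 *m U) i1 i2), ((U^T *m S1 *m U) i2 i2).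
  have sy i j : (U^T *m S1 *m U) i j = (U^T *m S1 *m U) j i.
    by rewrite -{1}(congruence_sym U S1s) mxE.
  have e i j := congruence_entry S1 U i j.
  have e0 : (U^T *m S1 *m U) i0 i0 = 0.
    by rewrite e !sum_I3 !mxE /= S100; ring.
  have e1 : (U^T *m S1 *m U) i0 i1 = 0.
    by rewrite e !sum_I3 !mxE /= S100 -/a -/b aE bE; ring.
  have e2 : (U^T *m S1 *m U) i0 i2 = m.
    rewrite e !sum_I3 !mxE /= S100 -/a -/b aE bE.
    by rewrite -[RHS]mul1r -[in RHS]uv1; ring.
  by rewrite /rform opprK {1}(mx3P (U^T *m S1 *m U)) e0 e1 e2 (sy i1 i0) (sy i2 i0)
    (sy i2 i1) e1 e2.
exists (B *m U), m, q, r, s; split=> //.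
- by rewrite unitmx_mul uB.
- by move=> i; rewrite mulmx3 !mxE /= !mulr0 !addr0 mulr1 Bx.
- by rewrite trmx_mul -!mulmxA [S *m _]mulmxA [B^T *m _]mulmxA [B^T *m _]mulmxA -S1E mulmxA E.
have := det_unit_congruence S1 uU; rewrite E det_rform dS1 => h.
by move: S0; rewrite -h pmulr_rgt0 // exprn_gt0.
Qed.

(** The unipotent changes of basis that fix e_0: e_1 becomes e_1 + j e_0, and e_2 becomes e_2 + k
    e_1 + l e_0. *)
Lemma rform_move m q r s j k l :
  (mx3 1 j l 0 1 k 0 0 1)^T *m rform m q r s *m mx3 1 j l 0 1 k 0 0 1 =
  rform m q (r + m * j - q * k) (s + 2 * k * r + 2 * m * l - q * k ^+ 2).
Proof.
apply/matrixP; do 2![apply: forall_I3]; rewrite congruence_entry !sum_I3 !mxE /=; ring.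
Qed.

Lemma unit_move (j k l : int) : mx3 1 j l 0 1 k 0 0 1 \in unitmx.
Proof. by rewrite unitmxE det_mx3 (_ : _ - _ + _ = 1) ?unitr1 //; ring. Qed.

Lemma squarefree_logn n p : squarefree n -> prime p -> (logn p n <= 1)%N.
Proof.
move=> [n0 sf] pp; rewrite leqNgt; apply/negP => h.
have : (p * p %| n)%N by rewrite mulnn pfactor_dvdn.
by move=> /sf p1; rewrite p1 in pp.
Qed.

Lemma dvdn_prime_powers d n : (0 < d)%N -> (0 < n)%N ->
  (forall p, prime p -> (logn p d <= logn p n)%N) -> (d %| n)%N.
Proof.
move=> d0 n0 h; apply/dvdn_partP => // p; rewrite mem_primes => /and3P[pp _ _].
by rewrite p_part pfactor_dvdn // h.
Qed.

Lemma dvdz_prime_powers (d : nat) (z : int) : (0 < d)%N ->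
  (forall p, prime p -> ((p ^ logn p d)%N%:Z %| z)%Z) -> (d%:Z %| z)%Z.
Proof.
move=> d0 h; rewrite dvdzE /=; apply/dvdn_partP => // p.
by rewrite mem_primes => /and3P[pp _ _]; rewrite p_part; exact: h.
Qed.

(** Up to sign the entries of D S are 2 x 2 minors of the adjugate, so w^2 divides them all; as S is
    primitive, it divides D. *)
Lemma omega_sq_dvdn (m q r s : int) (w : nat) :
  gcd_entries (rform m q r s) = 1%N -> (w %| absOmega (rform m q r s))%N ->
  (w%:Z ^+ 2 %| m ^+ 2 * q)%Z.
Proof.
move=> g1 /dvdn_absOmega_rform[/dvdzP[a aE] /dvdzP[b bE] /dvdzP[c cE] /dvdzP[d dE]].
set D := m ^+ 2 * q.
have hm : (w%:Z ^+ 2 %| D * m)%Z.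
  by apply/dvdzP; exists (c * d); rewrite expr2 mulrACA -cE -dE /D; ring.
have hq : (w%:Z ^+ 2 %| D * q)%Z.
  by apply/dvdzP; exists (c * c); rewrite expr2 mulrACA -cE /D; ring.
have hr : (w%:Z ^+ 2 %| D * r)%Z.
  by apply/dvdzP; exists (b * c); rewrite expr2 mulrACA -bE -cE /D; ring.
have hs : (w%:Z ^+ 2 %| D * s)%Z.
  apply/dvdzP; exists (d * a - b * b).
  rewrite [RHS](_ : _ = (d * w%:Z) * (a * w%:Z) - (b * w%:Z) * (b * w%:Z)); last by ring.
  by rewrite -aE -bE -dE /D; ring.
have g x y : (w%:Z ^+ 2 %| D * x -> w%:Z ^+ 2 %| D * y -> w%:Z ^+ 2 %| D * gcdz x y)%Z.
  move=> hx hy; have [u [v <-]] := Bezoutz x y.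
  by rewrite mulrDr ![D * (_ * _)]mulrCA rpredD // dvdz_mull.
have := g _ _ hm (g _ _ hq (g _ _ hr hs)).
have -> : gcdz m (gcdz q (gcdz r s)) = 1.
  suff : (`|gcdz m (gcdz q (gcdz r s))| %| 1)%N.
    by rewrite dvdn1 => /eqP h; rewrite -[LHS]gez0_abs ?h.
  rewrite -g1; apply/dvdn_gcd_entries.
  have := dvdzz (gcdz m (gcdz q (gcdz r s))); rewrite {2}/gcdz.
  set e := gcdz _ _; rewrite !dvdz_gcd => /and4P[em eq er es].
  by do 2![apply: forall_I3]; rewrite mxE /= ?dvdz0 ?dvdzN.
by rewrite mulr1.
Qed.

(** The three square-freeness conditions at p, for a and b the exponents of p in Omega and Delta.
    Six pairs satisfy them, and 2 a + b, the exponent of p in D, takes the values 0 to 5 on them. *)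
Definition valuation_pair (a b : nat) : Prop :=
  [/\ (minn a b <= 1)%N, (a <= minn a b + 1)%N & (b <= minn a b + 1)%N].

Lemma special_valuations S x : special S -> in_cone S x ->
  [/\ (0 < absOmega S)%N, (0 < Delta S)%N,
      `|\det S|%N = (absOmega S ^ 2 * Delta S)%N &
      forall p, prime p -> valuation_pair (logn p (absOmega S)) (logn p (Delta S))].
Proof.
move=> [[Ss pS _ D0] [sN sO sD]] xC.
have O0 : (0 < absOmega S)%N by rewrite lt0n; apply/eqP => O0; case: sO; rewrite O0 div0n.
have E0 : (0 < Delta S)%N by rewrite lt0n; apply/eqP => E0; case: sD; rewrite E0 div0n.
have [B [m [q [r [s [uB Bx E m0 q0]]]]]] := rform_frame Ss D0 xC.
have D0' : \det S != 0 by rewrite gt_eqF.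
have OE : absOmega (rform m q r s) = absOmega S by rewrite -E absOmega_unit.
have gE : gcd_entries (rform m q r s) = 1%N.
  by rewrite -E gcd_entries_unit ?unitmx_tr.
have DE : \det S = m ^+ 2 * q by rewrite -(det_unit_congruence S uB) E det_rform.
split=> //.
  have := omega_sq_dvdn gE (dvdnn _); rewrite -DE OE dvdzE abszX /= => h.
  by rewrite /Delta /Ddet mulnC divnK.
move=> p pp.
have := squarefree_logn sN pp; have := squarefree_logn sO pp.
have := squarefree_logn sD pp.
have d1 : (Ngcd S %| absOmega S)%N := dvdn_gcdl _ _.
have d2 : (Ngcd S %| Delta S)%N := dvdn_gcdr _ _.
rewrite (logn_div p d1) (logn_div p d2) /Ngcd logn_gcd // /valuation_pair.
by clear => *; split; lia.
Qed.

(* The form 2 m x0 x2 - q x1^2 + s x2^2, of determinant m^2 q. *)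
Definition Std (m q s : nat) : 'M[int]_3 := rform m%:Z q%:Z 0 s%:Z.

(* The exponents of p in m, q, s that occur for special forms.  The exponent 2 i + j of p in D
   determines i and j. *)
Definition good (p i j t : nat) : Prop :=
  [\/ [/\ i = 0, j = 0 & (p = 2 -> 0 < t)],
      [/\ i = 1, j = 0 & 0 < t] |
      [\/ i = 0 /\ j = 1, [/\ i = 1, j = 1 & t = 0] |
          [/\ i = 2, j = 0 & t = 1] \/ [/\ i = 1, j = 3 & t = 0]]]%N.

(** A positive s allows [logn] and [gcdn] to be applied to it directly. *)
Definition frame (S : 'M[int]_3) (x : 'rV[int]_3) (B : 'M[int]_3) (m q s : nat) : Prop :=
  [/\ B \in unitmx, forall i, B i i0 = x ord0 i, B^T *m S *m B = Std m q s &
  [/\ (0 < m)%N, (0 < q)%N, (0 < s)%N, `|\det S|%N = (m ^ 2 * q)%N &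
      forall p, prime p -> good p (logn p m) (logn p q) (logn p s)]].

(** This makes it possible to remove r. The exponents in D = Omega^2 Delta show that a prime p
    dividing m and q divides their gcd only once and divides Omega; since Omega divides q s + r^2, p
    divides r. *)
Lemma rform_gcd_dvdn S (x : 'rV[int]_3) B (m q : nat) (r s : int) : special S -> in_cone S x ->
  B \in unitmx -> B^T *m S *m B = rform m%:Z q%:Z r s -> (0 < m)%N -> (0 < q)%N ->
  (gcdn m q %| `|r|)%N.
Proof.
move=> sS xC uB E m0 q0; have [O0 E0 DOD vp] := special_valuations sS xC.
have [[_ _ _ D0] _] := sS; have D0' : \det S != 0 by rewrite gt_eqF.
have OE : absOmega (rform m%:Z q%:Z r s) = absOmega S by rewrite -E absOmega_unit.
have DE : (absOmega S ^ 2 * Delta S = m ^ 2 * q)%N.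
  rewrite -DOD -(det_unit_congruence S uB) E det_rform.
  by rewrite abszM abszX.
apply/dvdn_partP; first by rewrite gcdn_gt0 m0.
move=> p; rewrite mem_primes => /and3P[pp _]; rewrite dvdn_gcd => /andP[pm pq].
have i1 : (0 < logn p m)%N by rewrite logn_gt0 mem_primes pp m0.
have j1 : (0 < logn p q)%N by rewrite logn_gt0 mem_primes pp q0.
have := congr1 (logn p) DE; rewrite !lognM ?muln_gt0 ?expn_gt0 ?O0 ?m0 // => v.
have [v1 v2 v3] := vp p pp.
have -> : ((gcdn m q)`_p = p)%N.
  by rewrite p_part logn_gcd // (_ : minn _ _ = 1%N) //; clear -v v1 v2 v3 i1 j1; lia.
have : (p %| absOmega S)%N.
  rewrite -(expn1 p) pfactor_dvdn //; clear -v v1 v2 v3 i1 j1; lia.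
rewrite -OE => /dvdn_absOmega_rform[+ _ _ _].
rewrite rpredDl; last by rewrite dvdz_mulr.
by rewrite dvdzE abszX Euclid_dvdX // => /andP[].
Qed.

(** A finite check. The formula for a is the exponent of p in the gcd of the adjugate entries of
    [Std], and the vanishing minimum expresses primitivity. *)
Lemma good_of_valuations (p i j t a b : nat) : valuation_pair a b ->
  (2 * i + j = 2 * a + b)%N -> a = minn (minn (j + t) (j + i)) (2 * i) ->
  minn (minn i j) t = 0%N -> (p = 2 -> i = 0 -> j = 0 -> 0 < t)%N -> good p i j t.
Proof.
move=> [h1 h2 h3] h4 h5 h6 h7; rewrite /good.
case: i h4 h5 h6 h7 => [|[|i]] h4 h5 h6 h7.
- case: j h4 h5 h6 h7 => [|j] h4 h5 h6 h7.
    by constructor 1; split=> // /h7; apply.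
  by constructor 3; constructor 1; lia.
- case: j h4 h5 h6 h7 => [|[|j]] h4 h5 h6 h7.
  + by constructor 2; (split; lia).
  + by constructor 3; constructor 2; (split; lia).
  by constructor 3; constructor 3; right; (split; lia).
by constructor 3; constructor 3; left; (split; lia).
Qed.

Lemma absOmega_Std m q s :
  absOmega (Std m q s) = gcdn (gcdn (q * s) (q * m)) (m ^ 2).
Proof.
have h d : (d %| absOmega (Std m q s))%N = (d %| gcdn (gcdn (q * s) (q * m)) (m ^ 2))%N.
  apply/dvdn_absOmega_rform/idP; rewrite !dvdn_gcd.
    by rewrite expr0n addr0 => -[h1 _ h2 h3]; rewrite -andbA; apply/and3P.
  by rewrite -andbA expr0n addr0 mul0r dvdz0 => /and3P[h1 h2 h3].
by apply/eqP; rewrite eqn_dvd h -h !dvdnn.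
Qed.

Lemma special_frame S (x : 'rV[int]_3) : special S -> in_cone S x ->
  exists B m q s, frame S x B m q s.
Proof.
move=> sS xC; have [O0 E0 DOD vp] := special_valuations sS xC.
have [[Ss pS _ D0] _] := sS.
have D0' : \det S != 0 by rewrite gt_eqF.
have [B [m' [q' [r [s [uB Bx E]]]]]] := rform_frame Ss D0 xC.
case: m' E => [m|//] E; case: q' E => [q|//] E; rewrite !ltz_nat => m0 q0.
have /dvdnP[r' rE] := rform_gcd_dvdn sS xC uB E m0 q0.
have [r1 r1E] : exists r1, r = r1 * (gcdn m q)%:Z.
  by apply/dvdzP; rewrite dvdzE /= rE dvdn_mull.
have [u [v uv]] := Bezoutz m%:Z q%:Z; rewrite /gcdz /= in uv.
have [j [k [l [rj sp so]]]] : exists j k l, [/\ r + m%:Z * j - q%:Z * k = 0,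
    0 < s + 2 * k * r + 2 * m%:Z * l - q%:Z * k ^+ 2 &
    odd m -> odd q -> (2 %| s + 2 * k * r + 2 * m%:Z * l - q%:Z * k ^+ 2)%Z].
  (* Bezout coefficients of gcd(m, q) kill r, and adding e q to j and e m to k preserves this. *)
  have base : r + m%:Z * (- r1 * u) - q%:Z * (r1 * v) = 0 by rewrite r1E -uv; ring.
  pose s0 e := s + 2 * (r1 * v + e * m%:Z) * r - q%:Z * (r1 * v + e * m%:Z) ^+ 2.
  (* For odd m and q, passing from e = 0 to e = 1 changes the parity of the corner entry, so one of
     the two makes it even. *)
  have [e se] : exists e, odd m -> odd q -> (2 %| s0 e)%Z.
    have [om|_] := boolP (odd m); last by exists 0.
    have [oq|_] := boolP (odd q); last by exists 0.
    have [h|h] := boolP (2 %| s0 0)%Z; [by exists 0|exists 1 => _ _].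
    have [m' mE] : exists m' : int, m%:Z = 2 * m' + 1.
      by exists (m./2)%:Z; move: om; clear; lia.
    have [q' qE] : exists q' : int, q%:Z = 2 * q' + 1.
      by exists (q./2)%:Z; move: oq; clear; lia.
    have : s0 1 = s0 0 - 1 + 2 * (m%:Z * r - q%:Z * r1 * v * m%:Z
        - q' * m%:Z ^+ 2 - 2 * m' ^+ 2 - 2 * m').
      by rewrite /s0 mE qE; ring.
    move: h; clear; move: (s0 0) (s0 1) => a b; set c := _ - 2 * m'; lia.
  (* This makes the new s positive without changing its parity. *)
  pose l := `|s0 e| + 1.
  exists (- r1 * u + e * q%:Z), (r1 * v + e * m%:Z), l.
  have -> : s + 2 * (r1 * v + e * m%:Z) * r + 2 * m%:Z * l -
     q%:Z * (r1 * v + e * m%:Z) ^+ 2 = s0 e + 2 * m%:Z * l by rewrite /s0; ring.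
  split; first by rewrite -[RHS]base; ring.
    by rewrite /l; move: (s0 e) m0; clear; nia.
  by move=> om oq; rewrite rpredD ?se // -mulrA dvdz_mulr.
have := rform_move m%:Z q%:Z r s j k l; rewrite rj.
set s' := s + _ + _ - _ in sp so *.
case: s' sp so => [s'|//]; rewrite ltz_nat => s0 so.
set U := mx3 1 j l 0 1 k 0 0 1 => UE; have uU : U \in unitmx := unit_move j k l.
have BU : (B *m U)^T *m S *m (B *m U) = Std m q s'.
  by rewrite trmx_mul -!mulmxA [S *m _]mulmxA [B^T *m _]mulmxA [B^T *m _]mulmxA mulmxA E.
have uBU : B *m U \in unitmx by rewrite unitmx_mul uB.
have DE : `|\det S|%N = (m ^ 2 * q)%N.
  by rewrite -(det_unit_congruence S uB) E det_rform abszM abszX.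
exists (B *m U), m, q, s'; split=> //.
  by move=> i; rewrite mulmx3 !mxE /= !mulr0 !addr0 mulr1 Bx.
split=> //.
move=> p pp; have OE : absOmega S = gcdn (gcdn (q * s') (q * m)) (m ^ 2).
  by rewrite -(absOmega_unit D0' uBU) BU absOmega_Std.
apply: (@good_of_valuations _ _ _ _ (logn p (absOmega S)) (logn p (Delta S))).
- exact: vp.
- by have := congr1 (logn p) DOD; rewrite DE !lognM ?muln_gt0 ?m0 ?O0 //; clear; lia.
- by rewrite OE !logn_gcd ?lognM ?gcdn_gt0 ?muln_gt0 ?m0 ?q0 ?s0 //; clear; lia.
- apply/eqP; rewrite -leqn0 leqNgt !leq_min; apply/negP => /andP[/andP[h1 h2] h3].
  have : (p %| gcd_entries (Std m q s'))%N.
    move: h1 h2 h3; rewrite !logn_gt0 !mem_primes.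
    move=> /and3P[_ _ pm] /and3P[_ _ pq] /and3P[_ _ ps].
    apply/dvdn_gcd_entries; do 2![apply: forall_I3]; rewrite mxE /= ?dvdz0 ?dvdzN //.
  rewrite -BU gcd_entries_unit ?unitmx_tr // pS.
  by rewrite dvdn1; case: p pp {h1 h2 h3} => [|[]].
- move=> p2 m1 q1; rewrite logn_gt0 mem_primes pp s0 p2.
  have oddE n : (0 < n)%N -> logn p n = 0%N -> odd n.
    move=> n0 /eqP; rewrite -leqn0 leqNgt logn_gt0 mem_primes pp n0 p2 dvdn2.
    by rewrite negbK.
  by have := so (oddE m m0 m1) (oddE q q0 q1).
Qed.

(** * Local equivalences *)

(** Reduces a consequence of a known equation to an identity that [ring] can check. *)
Lemma eq_from_sub (V : zmodType) (a b c d : V) : c = d -> a - b = c - d -> a = b.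
Proof. by move=> -> /eqP; rewrite subrr subr_eq0 => /eqP. Qed.

Lemma Euclid_dvdzM (p : nat) (x y : int) : prime p ->
  (p%:Z %| x * y)%Z = (p%:Z %| x)%Z || (p%:Z %| y)%Z.
Proof. by move=> pp; rewrite !dvdzE abszM Euclid_dvdM. Qed.

Lemma Euclid_dvdz_sq (p : nat) (x : int) : prime p ->
  (p%:Z %| x ^+ 2)%Z = (p%:Z %| x)%Z.
Proof. by move=> pp; rewrite expr2 Euclid_dvdzM // orbb. Qed.

(** The hypotheses on x, z and c are what remains of the entries (0,0), (0,2) and (2,2) of an
    equivalence after division by powers of p. Together they give (x c)^2 = 1 modulo p, which turns
    s c^2 = s' into s = s' x^2. *)
Lemma square_class_transfer (p : nat) (m x z c s s' : int) : prime p -> ~~ (p%:Z %| m)%Z ->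
  (p%:Z %| z * (2 * m * x + s * z))%Z -> (p%:Z %| (m * x + s * z) * c - m)%Z ->
  (p%:Z %| s * c ^+ 2 - s')%Z -> (p%:Z %| s - s' * x ^+ 2)%Z /\ ~~ (p%:Z %| x)%Z.
Proof.
move=> pp pm h1 h2 h3.
have h4 : (p%:Z %| m ^+ 2 * (1 - x ^+ 2 * c ^+ 2))%Z.
  have -> : m ^+ 2 * (1 - x ^+ 2 * c ^+ 2) =
      s * c ^+ 2 * (z * (2 * m * x + s * z))
      - ((m * x + s * z) * c - m) * ((m * x + s * z) * c + m) by ring.
  by rewrite rpredB // ?(dvdz_mull _ h1) ?(dvdz_mulr _ h2).
rewrite Euclid_dvdzM // Euclid_dvdz_sq // (negbTE pm) /= in h4.
split.
  have -> : s - s' * x ^+ 2 = s * (1 - x ^+ 2 * c ^+ 2) + x ^+ 2 * (s * c ^+ 2 - s') by ring.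
  by rewrite rpredD // dvdz_mull.
apply/negP => px; move: h4; rewrite rpredBr; last by rewrite dvdz_mulr ?Euclid_dvdz_sq.
by rewrite dvdz1 /=; case: p pp {pm h1 h2 h3 px} => [|[]].
Qed.

Section Scalar.
Variables (p : nat) (P0 : p%:Z != 0) (pp : prime p).
Let P := p%:Z.
Variables (x0 x1 x2 c0 c1 c2 E00 E02 E22 : int).

(** The exponents (1, 1, 0) and (1, 3, 0) of p in m, q, s. The unit s forces p to divide x2; the
    factor p still missing is then found in x1 in the first case and in q in the second. *)
Lemma local_CF (m q s s' : int) : ~~ (P %| m)%Z -> ~~ (P %| s)%Z ->
  ~~ (P %| q)%Z \/ (P ^+ 2 %| q)%Z ->
  2 * (P * m) * (x0 * x2) - P * q * x1 ^+ 2 + s * x2 ^+ 2 = P ^+ 6 * E00 ->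
  P * m * (x0 * c2 + x2 * c0) - P * q * (x1 * c1) + s * (x2 * c2) = P * m + P ^+ 6 * E02 ->
  2 * (P * m) * (c0 * c2) - P * q * c1 ^+ 2 + s * c2 ^+ 2 = s' + P ^+ 6 * E22 ->
  (P %| s - s' * x0 ^+ 2)%Z /\ ~~ (P %| x0)%Z.
Proof.
move=> pm ps pq e00 e02 e22.
have [z zE] : exists z, x2 = z * P.
  apply/dvdzP; have : (P %| s * x2 ^+ 2)%Z.
    apply/dvdzP; exists (P ^+ 5 * E00 - 2 * m * (x0 * x2) + q * x1 ^+ 2).
    by apply: (eq_from_sub e00); ring.
  by rewrite Euclid_dvdzM // (negbTE ps) Euclid_dvdz_sq.
rewrite zE in e00 e02.
have e1 : q * x1 ^+ 2 = (2 * m * x0 * z + s * z ^+ 2 - P ^+ 4 * E00) * P.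
  by apply: (mulfI P0); apply: (eq_from_sub (esym e00)); rewrite -/P; ring.
have [[g gE] [h hE]] : (exists g, q * x1 = g * P) /\ (exists h, q * x1 ^+ 2 = h * P ^+ 2).
  case: pq => [pq|/dvdzP[q' ->]]; last first.
    by split; [exists (q' * x1 * P)|exists (q' * x1 ^+ 2)]; ring.
  have : (P %| q * x1 ^+ 2)%Z by apply/dvdzP; eexists; exact: e1.
  rewrite Euclid_dvdzM // (negbTE pq) Euclid_dvdz_sq //= => /dvdzP[y ->].
  by split; [exists (q * y)|exists (q * y ^+ 2)]; ring.
apply: (@square_class_transfer p m x0 z c2 s s') => //; apply/dvdzP.
- exists (P ^+ 3 * E00 + h); apply: (mulfI P0); rewrite -/P.
  by apply: (eq_from_sub (etrans (esym e1) hE)); ring.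
- exists (P ^+ 4 * E02 - m * z * c0 + g * c1); apply: (mulfI P0); rewrite -/P.
  have e02' : P * m * (x0 * c2 + z * P * c0) - P * (g * P) * c1 + s * (z * P * c2) =
     P * m + P ^+ 6 * E02 by rewrite -gE -[RHS]e02; ring.
  by apply: (eq_from_sub e02'); ring.
- exists (P ^+ 5 * E22 - 2 * m * (c0 * c2) + q * c1 ^+ 2).
  by apply: (eq_from_sub e22); ring.
Qed.

(** The exponents (2, 0, 1). The isotropy equation is divided by p three times, each division
    revealing a new factor p of x1 or x2. *)
Lemma local_E (m q s s' : int) : ~~ (P %| m)%Z -> ~~ (P %| s)%Z -> ~~ (P %| q)%Z ->
  2 * (P ^+ 2 * m) * (x0 * x2) - q * x1 ^+ 2 + P * s * x2 ^+ 2 = P ^+ 6 * E00 ->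
  P ^+ 2 * m * (x0 * c2 + x2 * c0) - q * (x1 * c1) + P * s * (x2 * c2) =
    P ^+ 2 * m + P ^+ 6 * E02 ->
  2 * (P ^+ 2 * m) * (c0 * c2) - q * c1 ^+ 2 + P * s * c2 ^+ 2 = P * s' + P ^+ 6 * E22 ->
  (P %| s - s' * x0 ^+ 2)%Z /\ ~~ (P %| x0)%Z.
Proof.
move=> pm ps pq e00 e02 e22.
have [w wE] : exists w, x1 = w * P.
  apply/dvdzP; have : (P %| q * x1 ^+ 2)%Z.
    apply/dvdzP; exists (2 * P * m * (x0 * x2) + s * x2 ^+ 2 - P ^+ 5 * E00).
    by apply: (eq_from_sub (esym e00)); ring.
  by rewrite Euclid_dvdzM // (negbTE pq) Euclid_dvdz_sq.
rewrite wE in e00 e02.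
have [z zE] : exists z, x2 = z * P.
  apply/dvdzP; have : (P %| s * x2 ^+ 2)%Z.
    apply/dvdzP; exists (P ^+ 4 * E00 - 2 * m * (x0 * x2) + q * w ^+ 2).
    by apply: (mulfI P0); apply: (eq_from_sub e00); rewrite -/P; ring.
  by rewrite Euclid_dvdzM // (negbTE ps) Euclid_dvdz_sq.
rewrite zE in e00 e02.
have [v vE] : exists v, w = v * P.
  apply/dvdzP; have : (P %| q * w ^+ 2)%Z.
    apply/dvdzP; exists (2 * m * (x0 * z) + s * z ^+ 2 - P ^+ 3 * E00).
    apply: (mulfI (expf_neq0 2 P0)).
    by apply: (eq_from_sub (esym e00)); rewrite -/P; ring.
  by rewrite Euclid_dvdzM // (negbTE pq) Euclid_dvdz_sq.
rewrite vE in e00 e02.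
have [d dE] : exists d, c1 = d * P.
  apply/dvdzP; have : (P %| q * c1 ^+ 2)%Z.
    apply/dvdzP; exists (2 * P * m * (c0 * c2) + s * c2 ^+ 2 - s' - P ^+ 5 * E22).
    by apply: (eq_from_sub (esym e22)); ring.
  by rewrite Euclid_dvdzM // (negbTE pq) Euclid_dvdz_sq.
rewrite dE in e02 e22.
apply: (@square_class_transfer p m x0 z c2 s s') => //; apply/dvdzP.
- exists (P ^+ 2 * E00 + q * v ^+ 2); apply: (mulfI (expf_neq0 3 P0)); rewrite -/P.
  by apply: (eq_from_sub e00); ring.
- exists (P ^+ 3 * E02 - m * z * c0 + q * v * d); apply: (mulfI (expf_neq0 2 P0)).
  by rewrite -/P; apply: (eq_from_sub e02); ring.
- exists (P ^+ 4 * E22 - 2 * m * (c0 * c2) + q * d ^+ 2); apply: (mulfI P0).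
  by rewrite -/P; apply: (eq_from_sub e22); ring.
Qed.

End Scalar.

Lemma Posz_exp (n k : nat) : (n ^ k)%N%:Z = n%:Z ^+ k.
Proof. by elim: k => // k IH; rewrite expnS PoszM IH exprS. Qed.

Lemma Std_congruence (m q s : nat) (A : 'M[int]_3) i j :
  (A^T *m Std m q s *m A) i j = m%:Z * (A i0 i * A i2 j + A i2 i * A i0 j)
    - q%:Z * (A i1 i * A i1 j) + s%:Z * (A i2 i * A i2 j).
Proof. by rewrite congruence_entry !sum_I3 !mxE /=; ring. Qed.

Lemma pfactorE p n : prime p -> (0 < n)%N ->
  exists2 n', n = (p ^ logn p n * n')%N & ~~ (p%:Z %| n'%:Z)%Z.
Proof.
move=> pp n0; have [n' cn nE] := pfactor_coprime pp n0.
exists n'; first by rewrite mulnC.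
by rewrite dvdzE /= -prime_coprime.
Qed.

(** A witness E in place of entrywise congruences yields equations that [ring] can combine. *)
Definition congruent_mod (n : nat) (A S S' : 'M[int]_3) :=
  exists E : 'M[int]_3, A^T *m S *m A = S' + n%:Z *: E.

Lemma congruent_eqs (n m q s s' : nat) (A : 'M[int]_3) :
  congruent_mod n A (Std m q s) (Std m q s') ->
  let x := fun k => A k i0 in let e := fun k => A k i1 in let c := fun k => A k i2 in
  exists E00 E11 E22 E02 E12 : int, [/\
    2 * m%:Z * (x i0 * x i2) - q%:Z * x i1 ^+ 2 + s%:Z * x i2 ^+ 2 = n%:Z * E00,
    2 * m%:Z * (e i0 * e i2) - q%:Z * e i1 ^+ 2 + s%:Z * e i2 ^+ 2 = - q%:Z + n%:Z * E11,
    2 * m%:Z * (c i0 * c i2) - q%:Z * c i1 ^+ 2 + s%:Z * c i2 ^+ 2 = s'%:Z + n%:Z * E22,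
    m%:Z * (x i0 * c i2 + x i2 * c i0) - q%:Z * (x i1 * c i1) + s%:Z * (x i2 * c i2)
      = m%:Z + n%:Z * E02 &
    m%:Z * (e i0 * c i2 + e i2 * c i0) - q%:Z * (e i1 * c i1) + s%:Z * (e i2 * c i2)
      = n%:Z * E12].
Proof.
move=> [E h] x e c; exists (E i0 i0), (E i1 i1), (E i2 i2), (E i0 i2), (E i1 i2).
have g i j : m%:Z * (A i0 i * A i2 j + A i2 i * A i0 j)
    - q%:Z * (A i1 i * A i1 j) + s%:Z * (A i2 i * A i2 j) = Std m q s' i j + n%:Z * E i j.
  by rewrite -Std_congruence h !mxE.
split.
- by have := g i0 i0; rewrite mxE /= add0r => <-; rewrite /x; ring.
- by have := g i1 i1; rewrite mxE /= => <-; rewrite /e; ring.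
- by have := g i2 i2; rewrite mxE /= => <-; rewrite /c; ring.
- by have := g i0 i2; rewrite mxE /= => <-.
- by have := g i1 i2; rewrite mxE /= add0r => <-.
Qed.

(** If p^3 does not divide D, either the modulus is 1 or p divides both s and s'. The other three
    patterns of exponents lose only a few powers of p by division, for which p^6 is enough. *)
Lemma local_transfer (p m q s s' : nat) (A : 'M[int]_3) : prime p ->
  (0 < m)%N -> (0 < q)%N -> (0 < s)%N -> (0 < s')%N ->
  good p (logn p m) (logn p q) (logn p s) -> good p (logn p m) (logn p q) (logn p s') ->
  congruent_mod (p ^ 6) A (Std m q s) (Std m q s') ->
  ((p ^ logn p m)%N%:Z %| s%:Z - s'%:Z * A i0 i0 ^+ 2)%Z /\
  ((2 < 2 * logn p m + logn p q)%N -> ~~ (p%:Z %| A i0 i0)%Z).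
Proof.
move=> pp m0 q0 s0 s'0 gs gs' cA.
have [m' mE pm'] := pfactorE pp m0; have [q' qE pq'] := pfactorE pp q0.
have [t tE pt] := pfactorE pp s0; have [t' t'E pt'] := pfactorE pp s'0.
have P0 : p%:Z != 0 by rewrite eqz_nat -lt0n prime_gt0.
have [E00 [E11 [E22 [E02 [E12 [e00 _ e22 e02 _]]]]]] := congruent_eqs cA.
rewrite Posz_exp in e00 e22 e02.
case: gs => [[iE jE _]|[iE jE sE]|[[iE jE]|[iE jE sE]|[[iE jE sE]|[iE jE sE]]]].
- by rewrite iE jE expn0 dvd1z.
- rewrite iE jE expn1; split=> //.
  have s'E : (0 < logn p s')%N by move: gs'; rewrite iE jE => -[[]|[]|[[]|[]|[[]|[]]]].
  have d n : (0 < n)%N -> (0 < logn p n)%N -> (p%:Z %| n%:Z)%Z.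
    by move=> n0; rewrite logn_gt0 mem_primes => /and3P[].
  by rewrite rpredB ?dvdz_mulr // d.
- by rewrite iE jE expn0 dvd1z.
- have mE' : m%:Z = p%:Z * m'%:Z by rewrite {1}mE iE expn1 PoszM.
  have qE' : q%:Z = p%:Z * q'%:Z by rewrite {1}qE jE expn1 PoszM.
  have ps : ~~ (p%:Z %| s%:Z)%Z by rewrite tE sE expn0 mul1n.
  rewrite mE' qE' in e00 e22 e02.
  have [h1 h2] := local_CF P0 pp pm' ps (or_introl pq') e00 e02 e22.
  by rewrite iE expn1.
- have mE' : m%:Z = p%:Z ^+ 2 * m'%:Z by rewrite {1}mE iE PoszM.
  have sE' : s%:Z = p%:Z * t%:Z by rewrite {1}tE sE expn1 PoszM.
  have s'E : logn p s' = 1%N by move: gs'; rewrite iE jE => -[[]|[]|[[]|[]|[[]|[]]]].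
  have s'E' : s'%:Z = p%:Z * t'%:Z by rewrite {1}t'E s'E expn1 PoszM.
  have pq : ~~ (p%:Z %| q%:Z)%Z by rewrite qE jE expn0 mul1n.
  rewrite mE' sE' s'E' in e00 e22 e02.
  have [h1 h2] := local_E P0 pp pm' pt pq e00 e02 e22.
  rewrite iE; split=> //; rewrite sE' s'E' -mulrA -mulrBr Posz_exp expr2.
  by rewrite dvdz_mul2l.
- have mE' : m%:Z = p%:Z * m'%:Z by rewrite {1}mE iE expn1 PoszM.
  have qE' : q%:Z = p%:Z * (p%:Z ^+ 2 * q'%:Z).
    by rewrite {1}qE jE PoszM Posz_exp; ring.
  have ps : ~~ (p%:Z %| s%:Z)%Z by rewrite tE sE expn0 mul1n.
  rewrite mE' qE' in e00 e22 e02.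
  have pq2 : (p%:Z ^+ 2 %| p%:Z ^+ 2 * q'%:Z)%Z by rewrite dvdz_mulr.
  have [h1 h2] := local_CF P0 pp pm' ps (or_intror pq2) e00 e02 e22.
  by rewrite iE expn1.
Qed.

Lemma parity_cases (x : int) : exists k, x = 2 * k \/ x = 2 * k + 1.
Proof.
exists (x %/ 2)%Z; have := divz_eq x 2; have := modz_ge0 x (isT : 2 != 0 :> int).
have := ltz_pmod x (isT : 0 < 2 :> int).
by move: (x %/ 2)%Z (x %% 2)%Z => a b *; lia.
Qed.

Lemma odd_intP (x : int) : ~~ (2 %| x)%Z -> exists k, x = 2 * k + 1.
Proof.
by have [k [->|->]] := parity_cases x; [rewrite dvdz_mulr|exists k].
Qed.

Lemma even_intP (x : int) : (2 %| x)%Z -> exists k, x = 2 * k.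
Proof. by move=> /dvdzP[k ->]; exists k; rewrite mulrC. Qed.

(** * Equivalences at the prime 2 *)

Section Two.
Variables (x0 x1 x2 e0 e1 e2 c0 c1 c2 E00 E11 E22 E12 : int).
Let det := x0 * (e1 * c2 - c1 * e2) - e0 * (x1 * c2 - c1 * x2) + c0 * (x1 * e2 - e1 * x2).
Let M x y : (2 %| x * y)%Z = (2 %| x)%Z || (2 %| y)%Z := @Euclid_dvdzM 2 x y isT.
Let Q x : (2 %| x ^+ 2)%Z = (2 %| x)%Z := @Euclid_dvdz_sq 2 x isT.

(** If c2 is odd, then s = s c2^2 = s' modulo 2. If c2 is even, then s' is even, and an odd s would
    make x2 even and, as x1 and c1 are even too, also the determinant. *)
Lemma local2_A (m q s s' : int) : ~~ (2 %| q)%Z -> ~~ (2 %| det)%Z ->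
  2 * (2 * m) * (x0 * x2) - q * x1 ^+ 2 + 2 * s * x2 ^+ 2 = 2 ^+ 6 * E00 ->
  2 * (2 * m) * (c0 * c2) - q * c1 ^+ 2 + 2 * s * c2 ^+ 2 = 2 * s' + 2 ^+ 6 * E22 ->
  (2 %| s - s')%Z.
Proof.
move=> oq odet h00 h22.
have [d dE] : exists d, c1 = 2 * d.
  apply: even_intP; suff : (2 %| q * c1 ^+ 2)%Z by rewrite M (negbTE oq) Q.
  apply/dvdzP; exists (2 * m * (c0 * c2) + s * c2 ^+ 2 - s' - 2 ^+ 5 * E22).
  by apply: (eq_from_sub (esym h22)); ring.
have [w wE] : exists w, x1 = 2 * w.
  apply: even_intP; suff : (2 %| q * x1 ^+ 2)%Z by rewrite M (negbTE oq) Q.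
  apply/dvdzP; exists (2 * m * (x0 * x2) + s * x2 ^+ 2 - 2 ^+ 5 * E00).
  by apply: (eq_from_sub (esym h00)); ring.
have n2 : 2 != 0 :> int by [].
have k22 : s * c2 ^+ 2 - s' = 2 * (2 ^+ 4 * E22 - m * (c0 * c2) + q * d ^+ 2).
  by apply: (mulfI n2); apply: (eq_from_sub h22); rewrite dE; ring.
have k00 : s * x2 ^+ 2 = 2 * (2 ^+ 4 * E00 - m * (x0 * x2) + q * w ^+ 2).
  by apply: (mulfI n2); apply: (eq_from_sub h00); rewrite wE; ring.
have [c2e|/odd_intP[k kE]] := boolP (2 %| c2)%Z.
  have es' : (2 %| s')%Z.
    have -> : s' = s * c2 ^+ 2 - (s * c2 ^+ 2 - s') by ring.
    by apply: rpredB; [rewrite dvdz_mull ?Q|rewrite k22 dvdz_mulr].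
  rewrite rpredB //; have : (2 %| s * x2 ^+ 2)%Z by rewrite k00 dvdz_mulr.
  rewrite M Q => /orP[//|/even_intP[z zE]].
  have [f fE] := even_intP c2e; case/negP: odet.
  by apply/dvdzP; eexists; rewrite /det dE wE zE fE; symmetry; instantiate (1 := (
    x0 * (e1 * f - d * e2) - e0 * (2 * w * f - 2 * d * z) + c0 * (w * e2 - e1 * z))); ring.
have -> : s - s' = (s * c2 ^+ 2 - s') - 2 * (2 * s * (k ^+ 2 + k)) by rewrite kE; ring.
by apply: rpredB; [rewrite k22 dvdz_mulr|rewrite dvdz_mulr].
Qed.

(** For odd s the entries x2 and e2 are even, so that an odd determinant forces c2 to be odd. *)
Lemma local2_B (m q s s' : int) : ~~ (2 %| det)%Z ->
  2 * m * (x0 * x2) - 2 * q * x1 ^+ 2 + s * x2 ^+ 2 = 2 ^+ 6 * E00 ->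
  2 * m * (e0 * e2) - 2 * q * e1 ^+ 2 + s * e2 ^+ 2 = - (2 * q) + 2 ^+ 6 * E11 ->
  2 * m * (c0 * c2) - 2 * q * c1 ^+ 2 + s * c2 ^+ 2 = s' + 2 ^+ 6 * E22 ->
  (2 %| s - s')%Z.
Proof.
move=> odet h00 h11 h22.
have k22 : s * c2 ^+ 2 - s' = 2 * (2 ^+ 5 * E22 - m * (c0 * c2) + q * c1 ^+ 2).
  by apply: (eq_from_sub h22); ring.
have [es|os] := boolP (2 %| s)%Z.
  rewrite rpredB //; have -> : s' = s * c2 ^+ 2 - (s * c2 ^+ 2 - s') by ring.
  by apply: rpredB; [rewrite dvdz_mulr|rewrite k22 dvdz_mulr].
have [z zE] : exists z, x2 = 2 * z.
  apply: even_intP; suff : (2 %| s * x2 ^+ 2)%Z by rewrite M (negbTE os) Q.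
  apply/dvdzP; exists (2 ^+ 5 * E00 - m * (x0 * x2) + q * x1 ^+ 2).
  by apply: (eq_from_sub h00); ring.
have [f fE] : exists f, e2 = 2 * f.
  apply: even_intP; suff : (2 %| s * e2 ^+ 2)%Z by rewrite M (negbTE os) Q.
  apply/dvdzP; exists (2 ^+ 5 * E11 - m * (e0 * e2) + q * e1 ^+ 2 - q).
  by apply: (eq_from_sub h11); ring.
have [/even_intP[g gE]|/odd_intP[k kE]] := boolP (2 %| c2)%Z.
  case/negP: odet; apply/dvdzP.
  exists (x0 * (e1 * g - c1 * f) - e0 * (x1 * g - c1 * z) + c0 * (x1 * f - e1 * z)).
  by rewrite /det zE fE gE; ring.
have -> : s - s' = (s * c2 ^+ 2 - s') - 2 * (2 * s * (k ^+ 2 + k)) by rewrite kE; ring.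
by apply: rpredB; [rewrite k22 dvdz_mulr|rewrite dvdz_mulr].
Qed.

(** Orthogonality of the last two columns gives a second factor 2 in c1, and this lifts s c2^2 = s'
    from modulo 2 to modulo 4. *)
Lemma local2_E (m q s s' : int) : ~~ (2 %| q)%Z -> ~~ (2 %| s)%Z -> ~~ (2 %| s')%Z ->
  2 * (2 ^+ 2 * m) * (e0 * e2) - q * e1 ^+ 2 + 2 * s * e2 ^+ 2 = - q + 2 ^+ 6 * E11 ->
  2 * (2 ^+ 2 * m) * (c0 * c2) - q * c1 ^+ 2 + 2 * s * c2 ^+ 2 = 2 * s' + 2 ^+ 6 * E22 ->
  2 ^+ 2 * m * (e0 * c2 + e2 * c0) - q * (e1 * c1) + 2 * s * (e2 * c2) = 2 ^+ 6 * E12 ->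
  (2 ^+ 2 %| s - s')%Z.
Proof.
move=> oq os os' h11 h22 h12; have n2 : 2 != 0 :> int by [].
have [d dE] : exists d, c1 = 2 * d.
  apply: even_intP; suff : (2 %| q * c1 ^+ 2)%Z by rewrite M (negbTE oq) Q.
  apply/dvdzP; exists (4 * m * (c0 * c2) + s * c2 ^+ 2 - s' - 2 ^+ 5 * E22).
  by apply: (eq_from_sub (esym h22)); ring.
rewrite dE in h22 h12.
have k22 : s * c2 ^+ 2 - s' = 2 * (2 ^+ 4 * E22 - 2 * m * (c0 * c2) + q * d ^+ 2).
  by apply: (mulfI n2); apply: (eq_from_sub h22); ring.
have /odd_intP[k kE] : ~~ (2 %| c2)%Z.
  apply: contra os' => c2e; have -> : s' = s * c2 ^+ 2 - (s * c2 ^+ 2 - s') by ring.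
  by apply: rpredB; [rewrite dvdz_mull ?Q|rewrite k22 dvdz_mulr].
have /odd_intP[l lE] : ~~ (2 %| e1)%Z.
  apply: contra oq => /even_intP[y yE]; apply/dvdzP.
  exists (2 * q * y ^+ 2 - 4 * m * (e0 * e2) - s * e2 ^+ 2 + 2 ^+ 5 * E11).
  by apply: (eq_from_sub h11); rewrite yE; ring.
have [l' l'E] : exists l', l * (l + 1) = 2 * l'.
  have [y [->|->]] := parity_cases l; first by exists (y * (2 * y + 1)); ring.
  by exists ((2 * y + 1) * (y + 1)); ring.
have [f fE] : exists f, e2 = 2 * f.
  apply: even_intP; suff : (2 %| s * e2 ^+ 2)%Z by rewrite M (negbTE os) Q.
  apply/dvdzP; exists (2 ^+ 4 * E11 - 2 * m * (e0 * e2) + 2 * q * l').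
  apply: (mulfI n2); apply: (eq_from_sub h11); rewrite lE.
  have -> : q * (2 * l + 1) ^+ 2 = 4 * q * (l * (l + 1)) + q by ring.
  by rewrite l'E; ring.
have [g gE] : exists g, d = 2 * g.
  apply: even_intP; suff : (2 %| q * (2 * l + 1) * d)%Z.
    rewrite !M (negbTE oq) /= rpredDl ?dvdz_mulr //.
  apply/dvdzP; exists (m * (e0 * c2 + e2 * c0) + s * f * c2 - 2 ^+ 4 * E12).
  apply: (mulfI n2); apply: (eq_from_sub (esym h12)).
  by rewrite lE fE; ring.
have -> : s - s' = (s * c2 ^+ 2 - s') - 2 ^+ 2 * (s * (k ^+ 2 + k)) by rewrite kE; ring.
apply: rpredB; last by rewrite dvdz_mulr.
rewrite k22 gE; apply/dvdzP.
by exists (2 ^+ 3 * E22 - m * (c0 * c2) + 2 * q * g ^+ 2); ring.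
Qed.

Lemma local2_F (m q s s' : int) : ~~ (2 %| s')%Z ->
  2 * (2 * m) * (c0 * c2) - 2 ^+ 3 * q * c1 ^+ 2 + s * c2 ^+ 2 = s' + 2 ^+ 6 * E22 ->
  (2 ^+ 2 %| s - s')%Z.
Proof.
move=> os' h22.
have k22 : s * c2 ^+ 2 - s' = 2 ^+ 2 * (2 ^+ 4 * E22 - m * (c0 * c2) + 2 * q * c1 ^+ 2).
  by apply: (eq_from_sub h22); ring.
have /odd_intP[k kE] : ~~ (2 %| c2)%Z.
  apply: contra os' => c2e; have -> : s' = s * c2 ^+ 2 - (s * c2 ^+ 2 - s') by ring.
  rewrite rpredB //; first by rewrite dvdz_mull // Q.
  by rewrite k22 expr2 -mulrA dvdz_mulr.
have -> : s - s' = (s * c2 ^+ 2 - s') - 2 ^+ 2 * (s * (k ^+ 2 + k)) by rewrite kE; ring.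
by apply: rpredB; [rewrite k22 dvdz_mulr|rewrite dvdz_mulr].
Qed.

End Two.

(* At p = 2 one more power of 2 is needed than at odd primes, because e_2 can only be moved so
   as to change s by multiples of 2m; the second alternative is the exception. *)
Lemma local_transfer2 (m q s s' : nat) (A : 'M[int]_3) :
  (0 < m)%N -> (0 < q)%N -> (0 < s)%N -> (0 < s')%N -> ~~ (2 %| \det A)%Z ->
  good 2 (logn 2 m) (logn 2 q) (logn 2 s) -> good 2 (logn 2 m) (logn 2 q) (logn 2 s') ->
  congruent_mod (2 ^ 6) A (Std m q s) (Std m q s') ->
  (((2 ^ (logn 2 m).+1)%N%:Z %| s%:Z - s'%:Z)%Z) \/
  [/\ logn 2 m = 1%N, logn 2 q = 1%N & (2 %| s%:Z - s'%:Z)%Z].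
Proof.
move=> m0 q0 s0 s'0 dA gs gs' cA.
have pp : prime 2 by [].
have [m' mE pm'] := pfactorE pp m0; have [q' qE pq'] := pfactorE pp q0.
have [t tE pt] := pfactorE pp s0; have [t' t'E pt'] := pfactorE pp s'0.
have [E00 [E11 [E22 [E02 [E12 [e00 e11 e22 e02 e12]]]]]] := congruent_eqs cA.
rewrite Posz_exp in e00 e11 e22 e02 e12.
have dE : \det A = A i0 i0 * (A i1 i1 * A i2 i2 - A i1 i2 * A i2 i1)
  - A i0 i1 * (A i1 i0 * A i2 i2 - A i1 i2 * A i2 i0)
  + A i0 i2 * (A i1 i0 * A i2 i1 - A i1 i1 * A i2 i0) by rewrite {1}(mx3P A) det_mx3.
rewrite dE {dE cA} in dA.
move: (A i0 i0) (A i0 i1) (A i0 i2) (A i1 i0) (A i1 i1) (A i1 i2) (A i2 i0) (A i2 i1)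
  (A i2 i2) dA e00 e11 e22 e02 e12 => x0 e0 c0 x1 e1 c1 x2 e2 c2 dA e00 e11 e22 e02 e12.
case: gs => [[iE jE sE]|[iE jE sE]|[[iE jE]|[iE jE sE]|[[iE jE sE]|[iE jE sE]]]].
- left; rewrite iE expn1; have d n : (0 < n)%N -> (0 < logn 2 n)%N -> (2 %| n%:Z)%Z.
    by move=> n0; rewrite logn_gt0 mem_primes => /and3P[].
  have s'E : (0 < logn 2 s')%N.
    by move: gs'; rewrite iE jE => -[[_ _ ->]|[]|[[]|[]|[[]|[]]]].
  by rewrite rpredB // d // sE.
- have mE' : m%:Z = 2 * m'%:Z by rewrite {1}mE iE expn1 PoszM.
  have s'E : (0 < logn 2 s')%N by move: gs'; rewrite iE jE => -[[]|[]|[[]|[]|[[]|[]]]].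
  have ev n : (0 < n)%N -> (0 < logn 2 n)%N -> exists n', n%:Z = 2 * n'.
    by move=> n0; rewrite logn_gt0 mem_primes => /and3P[_ _ h]; apply: even_intP.
  have [u uE] := ev s s0 sE; have [u' u'E] := ev s' s'0 s'E.
  have oq : ~~ (2 %| q%:Z)%Z by rewrite qE jE expn0 mul1n.
  rewrite mE' uE u'E in e00 e22.
  left; rewrite iE uE u'E -mulrBr.
  rewrite (_ : (2 ^ 2)%N%:Z = 2 * 2) // dvdz_mul2l //.
  exact: local2_A oq dA e00 e22.
- have qE' : q%:Z = 2 * q'%:Z by rewrite {1}qE jE expn1 PoszM.
  rewrite qE' in e00 e11 e22; left; rewrite iE expn1.
  exact: local2_B dA e00 e11 e22.
- right; split=> //.
  have s'E : logn 2 s' = 0%N by move: gs'; rewrite iE jE => -[[]|[]|[[]|[]|[[]|[]]]].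
  have [k ->] : exists k, s%:Z = 2 * k + 1 by apply: odd_intP; rewrite tE sE expn0 mul1n.
  have [k' ->] : exists k, s'%:Z = 2 * k + 1 by apply: odd_intP; rewrite t'E s'E expn0 mul1n.
  by rewrite opprD addrACA subrr addr0 -mulrBr dvdz_mulr.
- have mE' : m%:Z = 2 ^+ 2 * m'%:Z by rewrite {1}mE iE PoszM.
  have sE' : s%:Z = 2 * t%:Z by rewrite {1}tE sE expn1 PoszM.
  have s'E : logn 2 s' = 1%N by move: gs'; rewrite iE jE => -[[]|[]|[[]|[]|[[]|[]]]].
  have s'E' : s'%:Z = 2 * t'%:Z by rewrite {1}t'E s'E expn1 PoszM.
  have oq : ~~ (2 %| q%:Z)%Z by rewrite qE jE expn0 mul1n.
  rewrite mE' sE' s'E' in e11 e22 e12; left; rewrite iE sE' s'E' -mulrBr.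
  rewrite (_ : (2 ^ 3)%N%:Z = 2 * 2 ^+ 2) // dvdz_mul2l //.
  exact: local2_E oq pt pt' e11 e22 e12.
- have mE' : m%:Z = 2 * m'%:Z by rewrite {1}mE iE expn1 PoszM.
  have qE' : q%:Z = 2 ^+ 3 * q'%:Z by rewrite {1}qE jE PoszM.
  have s'E : logn 2 s' = 0%N by move: gs'; rewrite iE jE => -[[]|[]|[[]|[]|[[]|[]]]].
  have os' : ~~ (2 %| s'%:Z)%Z by rewrite t'E s'E expn0 mul1n.
  rewrite mE' qE' in e22; left; rewrite iE (_ : (2 ^ 2)%N%:Z = 2 ^+ 2) //.
  exact: local2_F os' e22.
Qed.

(** * Orbits of the orthogonal group *)

Lemma good_unique p i j t i' j' t' : good p i j t -> good p i' j' t' ->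
  (2 * i + j = 2 * i' + j')%N -> i = i' /\ j = j'.
Proof.
move=> g g' h.
have {g} : [\/ i = 0 /\ j = 0, i = 1 /\ j = 0 | [\/ i = 0 /\ j = 1, i = 1 /\ j = 1 |
    (i = 2 /\ j = 0) \/ (i = 1 /\ j = 3)]]%N.
  by case: g => [[-> -> _]|[-> -> _]|[[-> ->]|[-> -> _]|[[-> -> _]|[-> -> _]]]];
    [constructor 1|constructor 2|constructor 3; constructor 1|
     constructor 3; constructor 2|constructor 3; constructor 3; left|
     constructor 3; constructor 3; right].
have {g'} : [\/ i' = 0 /\ j' = 0, i' = 1 /\ j' = 0 | [\/ i' = 0 /\ j' = 1, i' = 1 /\ j' = 1 |
    (i' = 2 /\ j' = 0) \/ (i' = 1 /\ j' = 3)]]%N.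
  by case: g' => [[-> -> _]|[-> -> _]|[[-> ->]|[-> -> _]|[[-> -> _]|[-> -> _]]]];
    [constructor 1|constructor 2|constructor 3; constructor 1|
     constructor 3; constructor 2|constructor 3; constructor 3; left|
     constructor 3; constructor 3; right].
move: h => h [[a b]|[a b]|[[a b]|[a b]|[[a b]|[a b]]]] [[c d]|[c d]|[[c d]|[c d]|[[c d]|[c d]]]].
all: by move: h; rewrite a b c d.
Qed.

Lemma good_mq_unique (m q s m' q' s' : nat) : (0 < m)%N -> (0 < q)%N ->
  (0 < m')%N -> (0 < q')%N -> (m ^ 2 * q = m' ^ 2 * q')%N ->
  (forall p, prime p -> good p (logn p m) (logn p q) (logn p s)) ->
  (forall p, prime p -> good p (logn p m') (logn p q') (logn p s')) ->
  m = m' /\ q = q'.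
Proof.
move=> m0 q0 m'0 q'0 D g g'.
have h p : logn p m = logn p m' /\ logn p q = logn p q'.
  have [pp|npp] := boolP (prime p); last first.
    have z n : logn p n = 0%N by rewrite lognE (negbTE npp).
    by rewrite !z.
  apply: (good_unique (g p pp) (g' p pp)).
  have := congr1 (logn p) D; rewrite !lognM ?muln_gt0 ?m0 ?m'0 //; clear; lia.
by split; apply: eqn_from_log => // p; case: (h p).
Qed.

(** Where p^3 divides D, the exponent of s is one less than that of m; a congruence s = s u^2 modulo
    the p-part of m is therefore a condition on u^2 modulo p exactly. *)
Lemma good_mod p m q s : prime p -> (0 < s)%N ->
  good p (logn p m) (logn p q) (logn p s) ->
  (2 < 2 * logn p m + logn p q)%N -> logn p s = (logn p m).-1 /\ (0 < logn p m)%N.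
Proof.
move=> pp s0; rewrite /good.
by case=> [[-> -> _]|[-> -> _]|[[-> ->]|[-> -> ->]|[[-> -> ->]|[-> -> ->]]]].
Qed.

(** Moving e_2 by l e_0 changes s by 2 m l. In the second case j = q / g and k = m / g, with g =
    gcd(m, q), keep r = 0 and change s by m times the odd number (q / g)(m / g). *)
Lemma Std_adjust (m q s s' : nat) : (0 < m)%N -> (0 < q)%N ->
  ((2 * m)%N%:Z %| s%:Z - s'%:Z)%Z \/
    (m%:Z %| s%:Z - s'%:Z)%Z /\ odd ((q %/ gcdn m q) * (m %/ gcdn m q)) ->
  exists U : 'M[int]_3, [/\ U \in unitmx, forall i, U i i0 = (i == i0)%:Z &
    U^T *m Std m q s' *m U = Std m q s].
Proof.
move=> m0 q0 h.
suff [j [k [l [jk sE]]]] : exists j k l, m%:Z * j = q%:Z * k /\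
    s%:Z = s'%:Z + 2 * m%:Z * l - q%:Z * k ^+ 2.
  exists (mx3 1 j l 0 1 k 0 0 1); split; first exact: unit_move.
    by apply: forall_I3; rewrite mxE.
  by rewrite /Std rform_move jk add0r subrr !mulr0 addr0 -sE.
have even : ((2 * m)%N%:Z %| s%:Z - s'%:Z)%Z -> exists j k l, m%:Z * j = q%:Z * k /\
    s%:Z = s'%:Z + 2 * m%:Z * l - q%:Z * k ^+ 2.
  move=> /dvdzP[l lE]; exists 0, 0, l; split; first by rewrite !mulr0.
  have -> : s%:Z = s'%:Z + (s%:Z - s'%:Z) by ring.
  by rewrite lE PoszM; ring.
case: h => [/even //|[/dvdzP[k kE] o]].
have [k' [kE'|kE']] := parity_cases k.
  by apply: even; rewrite kE kE' PoszM mulrAC dvdz_mulr.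
set g := gcdn m q in o.
have g0 : (0 < g)%N by rewrite gcdn_gt0 m0.
have mE : m%:Z = (m %/ g)%N%:Z * g%:Z by rewrite -PoszM divnK // dvdn_gcdl.
have qE : q%:Z = (q %/ g)%N%:Z * g%:Z by rewrite -PoszM divnK // dvdn_gcdr.
have [y yE] : exists y : int, ((q %/ g) * (m %/ g))%N%:Z = 2 * y + 1.
  by apply: odd_intP; rewrite dvdzE /= dvdn2 o.
exists (q %/ g)%N%:Z, (m %/ g)%N%:Z, (k' + y + 1); split.
  by rewrite mE qE; ring.
have -> : q%:Z * (m %/ g)%N%:Z ^+ 2 = m%:Z * (2 * y + 1).
  by rewrite -yE PoszM mE qE; ring.
have -> : s%:Z = s'%:Z + (s%:Z - s'%:Z) by ring.
by rewrite kE kE'; ring.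
Qed.

(** The condition on the corner entry removes its square from the congruences at odd primes; the
    exceptional pattern at 2 becomes the second alternative, which [Std_adjust] can treat. *)
Lemma transfer_mod (m q s s' : nat) (A : 'M[int]_3) :
  (0 < m)%N -> (0 < q)%N -> (0 < s)%N -> (0 < s')%N ->
  (forall p, prime p -> good p (logn p m) (logn p q) (logn p s)) ->
  (forall p, prime p -> good p (logn p m) (logn p q) (logn p s')) ->
  A \in unitmx -> A^T *m Std m q s *m A = Std m q s' ->
  (forall p, prime p -> p != 2%N -> (2 < 2 * logn p m + logn p q)%N ->
     (p%:Z %| A i0 i0 ^+ 2 - 1)%Z) ->
  ((2 * m)%N%:Z %| s%:Z - s'%:Z)%Z \/
    (m%:Z %| s%:Z - s'%:Z)%Z /\ odd ((q %/ gcdn m q) * (m %/ gcdn m q)).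
Proof.
move=> m0 q0 s0 s'0 g g' uA AE hp.
have cA n : congruent_mod n A (Std m q s) (Std m q s').
  by exists 0; rewrite scaler0 addr0.
have odd_p p : prime p -> p != 2%N -> ((p ^ logn p m)%N%:Z %| s%:Z - s'%:Z)%Z.
  move=> pp p2; have [h1 h2] := local_transfer pp m0 q0 s0 s'0 (g p pp) (g' p pp) (cA _).
  have -> : s%:Z - s'%:Z = (s%:Z - s'%:Z * A i0 i0 ^+ 2) + s'%:Z * (A i0 i0 ^+ 2 - 1) by ring.
  apply: rpredD => //.
  have [big|small] := ltnP 2 (2 * logn p m + logn p q).
    have [s'E i1] := good_mod pp s'0 (g' p pp) big.
    rewrite -(prednK i1) expnSr PoszM dvdz_mul ?hp // dvdzE /= pfactor_dvdn // s'E.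
    by rewrite leqnn.
  rewrite dvdz_mulr // dvdzE /= pfactor_dvdn //.
  by case: (g' p pp) small => [[-> -> _]|[-> -> ?]|[[-> ->]|[-> -> _]|[[-> -> _]|[-> -> _]]]].
have dA : ~~ (2 %| \det A)%Z by move: uA; rewrite unitmxE => /orP[] /eqP ->.
have p2 : prime 2 by [].
case: (local_transfer2 m0 q0 s0 s'0 dA (g 2 p2) (g' 2 p2) (cA _)) => [h|[i1 j1 h]].
  left; apply: dvdz_prime_powers => [|p pp]; first by rewrite muln_gt0 m0.
  rewrite lognM // (logn_prime _ p2); have [->|np2] := eqVneq p 2%N; first by rewrite add1n.
  by rewrite add0n odd_p.
right; split.
  apply: dvdz_prime_powers => // p pp; have [->|np2] := eqVneq p 2%N; last exact: odd_p.
  by rewrite i1.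
have oddE n : (0 < n)%N -> logn 2 n = 0%N -> odd n.
  move=> n0 /eqP; rewrite -leqn0 leqNgt logn_gt0 mem_primes n0 dvdn2 /=.
  by rewrite negbK.
have g0 : (0 < gcdn m q)%N by rewrite gcdn_gt0 m0.
have dm := dvdn_gcdl m q; have dq := dvdn_gcdr m q.
rewrite oddM; apply/andP; split; apply: oddE.
- by rewrite divn_gt0 // dvdn_leq.
- by rewrite logn_div // logn_gcd // i1 j1.
- by rewrite divn_gt0 // dvdn_leq.
- by rewrite logn_div // logn_gcd // i1 j1.
Qed.

Lemma frame_mq (S : 'M[int]_3) x x' B B' m q s m' q' s' :
  frame S x B m q s -> frame S x' B' m' q' s' -> m = m' /\ q = q'.
Proof.
move=> [_ _ _ [m0 q0 _ D g]] [_ _ _ [m'0 q'0 _ D' g']].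
by apply: (good_mq_unique m0 q0 m'0 q'0 _ g g'); rewrite -D.
Qed.

Definition orbit_prime (m q p : nat) := [&& prime p, p != 2%N & 2 < 2 * logn p m + logn p q]%N.

Lemma congruence_mulmx (R : comNzRingType) (S A B : 'M[R]_3) :
  (A *m B)^T *m S *m (A *m B) = B^T *m (A^T *m S *m A) *m B.
Proof. by rewrite trmx_mul !mulmxA. Qed.

Lemma first_col (R : pzSemiRingType) (A : 'M[R]_3) (v : 'rV[R]_3) :
  (forall i, A i i0 = v ord0 i) <-> A *m delta_mx i0 ord0 = v^T :> 'cV_3.
Proof.
have E i j : (A *m delta_mx i0 ord0 : 'cV_3) i j = A i i0.
  by rewrite mxE sum_I3 !mxE /= ord1 !mulr0 !addr0 mulr1.
split=> [h|h i]; first by apply/matrixP => i j; rewrite E h mxE (ord1 j).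
by rewrite -(E i ord0) h mxE.
Qed.

Lemma primitive_unit (x : 'rV[int]_3) (A : 'M[int]_3) : A \in unitmx ->
  primitive_vec x -> primitive_vec (x *m A).
Proof.
move=> uA px; rewrite /primitive_vec; set d := \big[_/_]_(i < 3) _.
apply/eqP; rewrite -dvdn1 -px; apply/dvdn_biggcdP => i _.
rewrite -[x](mulmxK uA) -[(d %| _)%N]/(d%:Z %| _)%Z mxE.
apply: rpred_sum => k _; apply: dvdz_mulr; rewrite dvdzE /=.
have := dvdnn d; rewrite {2}/d => /dvdn_biggcdP; exact.
Qed.

Lemma in_cone_orbit S x x' : in_cone S x -> in_Sorbit S x x' -> in_cone S x'.
Proof.
move=> [px qx] [A [[uA AS] ->]]; split.
  by apply: primitive_unit => //; rewrite unitmx_tr unitmxE.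
by rewrite -qx /qform trmx_mul trmxK -{2}AS !mulmxA.
Qed.

(** In the frame, u is the first column both of an automorphism taking x to x' and of the change to
    any frame at x'. The latter carries [Std m q s] to some [Std m q s'] with the same m and q, and
    under the congruences an adjustment fixing e_0 makes s' equal to s. *)
Lemma orbitP (S : 'M[int]_3) x B m q s (u : 'rV[int]_3) : special S -> in_cone S x ->
  frame S x B m q s ->
  in_Sorbit S x (u *m B^T) <->
  in_cone S (u *m B^T) /\
    forall p, orbit_prime m q p -> (p%:Z %| u ord0 i0 ^+ 2 - 1)%Z.
Proof.
move=> sS xC fB; have [uB /first_col Bx BS [m0 q0 s0 D g]] := fB.
have eS : (invmx B)^T *m Std m q s *m invmx B = S.
  by rewrite -BS -congruence_mulmx mulmxV // trmx1 mul1mx mulmx1.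
split=> [[A [[uA AS] x'E]]|[x'C hp]].
  rewrite -unitmxE in uA.
  pose G := invmx B *m (A *m B).
  have uG : G \in unitmx by rewrite !unitmx_mul unitmx_inv uB uA.
  have GS : G^T *m Std m q s *m G = Std m q s.
    by rewrite congruence_mulmx eS congruence_mulmx AS BS.
  have Gu : G *m delta_mx i0 ord0 = u^T.
    by rewrite -!mulmxA Bx -[A *m x^T]trmxK trmx_mul trmxK -x'E trmx_mul trmxK mulKmx.
  split; first by apply: (in_cone_orbit xC); exists A.
  have {}Gu := (first_col _ _).2 Gu.
  move=> p /and3P[pp p2 big].
  have cG : congruent_mod (p ^ 6) G (Std m q s) (Std m q s).
    by exists 0; rewrite scaler0 addr0.
  have [h _] := local_transfer pp m0 q0 s0 s0 (g p pp) (g p pp) cG.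
  have [sE i1] := good_mod pp s0 (g p pp) big.
  (* With i the exponent of p in m, p^i divides s (1 - u_0^2), while s contributes only p^(i -
     1). *)
  rewrite -Gu; apply: contraTT h => h.
  rewrite -{1}[s%:Z]mulr1 -mulrBr Gauss_dvdzl; last first.
    rewrite coprimezE /= coprimeXl // prime_coprime //.
    by move: h; rewrite -opprB dvdzN dvdzE.
  by rewrite dvdzE /= pfactor_dvdn // sE -ltnNge prednK.
have [B' [m' [q' [s' fB']]]] := special_frame sS x'C.
have [mE qE] := frame_mq fB fB'; subst m' q'.
have [uB' /first_col B'x B'S [_ _ s'0 _ g']] := fB'.
pose G := invmx B *m B'.
have uG : G \in unitmx by rewrite unitmx_mul unitmx_inv uB uB'.
have GS : G^T *m Std m q s *m G = Std m q s' by rewrite congruence_mulmx eS B'S.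
have Gu : forall i, G i i0 = u ord0 i.
  by apply/first_col; rewrite -mulmxA B'x trmx_mul trmxK mulKmx.
have [|U [uU Ue US]] := @Std_adjust m q s s' m0 q0.
  apply: (transfer_mod m0 q0 s0 s'0 g g' uG GS) => p pp p2 big.
  by rewrite Gu; apply: hp; rewrite /orbit_prime pp p2.
(* From the frame at x to the frame at x', with U inserted to turn s' into s. *)
exists (B' *m (U *m invmx B)); split.
  split; first by rewrite -unitmxE !unitmx_mul unitmx_inv uB' uU uB.
  by rewrite congruence_mulmx B'S congruence_mulmx US eS.
have Ud : U *m delta_mx i0 ord0 = delta_mx i0 ord0 :> 'cV_3.
  rewrite ((first_col U (delta_mx ord0 i0)).1 _) ?trmx_delta // => i.
  by rewrite Ue !mxE eqxx; case: (i == i0).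
apply: trmx_inj; rewrite -B'x [RHS]trmx_mul trmxK -!mulmxA -Bx.
by rewrite mulKmx // Ud.
Qed.

(** * Parametrisation of the cone *)

Definition sqroot_part (n : nat) : nat := (\max_(c < n.+1 | c ^ 2 %| n) c)%N.
Definition sqfree_part (n : nat) : nat := (n %/ sqroot_part n ^ 2)%N.

Lemma sqroot_part_dvd n : (sqroot_part n ^ 2 %| n)%N.
Proof.
have card0 : (0 < #|[pred c : 'I_n.+1 | c ^ 2 %| n]|)%N.
  apply/card_gt0P; case: n => [|n]; first by exists ord0; rewrite inE dvdn0.
  by exists (inord 1); rewrite inE inordK // exp1n dvd1n.
rewrite /sqroot_part.
have [c + cE] := @eq_bigmax_cond _ _ (fun c : 'I_n.+1 => val c) card0.
by rewrite inE => cn; move: cE; rewrite (eq_bigl (fun c : 'I_n.+1 => c ^ 2 %| n)%N) // => ->.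
Qed.

Lemma sqfree_partE n : n = (sqfree_part n * sqroot_part n ^ 2)%N.
Proof. by rewrite divnK // sqroot_part_dvd. Qed.

Lemma logn_sqfree_part n p : (0 < n)%N -> prime p -> (logn p (sqfree_part n) <= 1)%N.
Proof.
move=> n0 pp; rewrite leqNgt; apply/negP => h.
have : (p ^ 2 %| sqfree_part n)%N.
  by apply: dvdn_trans (pfactor_dvdnn p _); rewrite dvdn_exp2l.
move=> /dvdnP[k kE]; have nE := sqfree_partE n; rewrite kE -mulnA -expnMn in nE.
have c0 : (0 < sqroot_part n)%N by rewrite lt0n; apply: contraTneq n0 => c0; rewrite nE c0 !muln0.
have le : (p * sqroot_part n < n.+1)%N.
  by rewrite ltnS; apply: dvdn_leq => //; rewrite [X in (_ %| X)%N]nE -mulnn mulnA dvdn_mull.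
have : (p * sqroot_part n <= sqroot_part n)%N.
  have := @leq_bigmax_cond _ (fun c : 'I_n.+1 => c ^ 2 %| n)%N (fun c => val c) (Ordinal le).
  rewrite /sqroot_part /=; apply.
  by rewrite /= [X in (_ %| X)%N]nE dvdn_mull.
by rewrite leqNgt ltn_Pmull // prime_gt1.
Qed.

Section ConicData.
Variables (m q s : nat).

Definition frame_gcd := gcdn (2 * m) s.
(** Since s beta = 2 m tau, setting u_2 = beta z gives 2 m u_0 + s u_2 = 2 m X with X = u_0 + tau z,
    and isotropy reads q u_1^2 = 2 m beta z X. *)
Definition beta := (2 * m %/ frame_gcd)%N.
Definition tau := (s %/ frame_gcd)%N.
Definition conic_disc := (2 * m * beta * q)%N.
Definition conic_sqfree := sqfree_part conic_disc.
(** Chosen so that u_1 = alpha w turns q u_1^2 = 2 m beta z X into z X = K w^2; it is an integer by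
    [q_dvd]. *)
Definition alpha := (conic_sqfree * sqroot_part conic_disc %/ q)%N.

Hypotheses (m0 : (0 < m)%N) (q0 : (0 < q)%N) (s0 : (0 < s)%N).
Hypothesis g : forall p, prime p -> good p (logn p m) (logn p q) (logn p s).

Lemma m2_gt0 : (0 < 2 * m)%N. Proof. by rewrite muln_gt0. Qed.

Lemma h_gt0 : (0 < frame_gcd)%N. Proof. by rewrite gcdn_gt0 m2_gt0. Qed.

Lemma beta_h : (beta * frame_gcd = 2 * m)%N. Proof. by rewrite divnK // dvdn_gcdl. Qed.

Lemma tau_h : (tau * frame_gcd = s)%N. Proof. by rewrite divnK // dvdn_gcdr. Qed.

Lemma beta_gt0 : (0 < beta)%N.
Proof. by have := m2_gt0; rewrite -beta_h muln_gt0 => /andP[]. Qed.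

Lemma tau_gt0 : (0 < tau)%N.
Proof. by have := s0; rewrite -{1}tau_h muln_gt0 => /andP[]. Qed.

Lemma sbeta : (s * beta = 2 * m * tau)%N.
Proof. by rewrite -{1}tau_h -beta_h; ring. Qed.

Lemma n_gt0 : (0 < conic_disc)%N. Proof. by rewrite !muln_gt0 m0 q0 beta_gt0. Qed.

Lemma kappa_gt0 : (0 < conic_sqfree)%N.
Proof. by have := n_gt0; rewrite {1}(sqfree_partE conic_disc) muln_gt0 => /andP[]. Qed.

Lemma sqroot_gt0 : (0 < sqroot_part conic_disc)%N.
Proof. by have := n_gt0; rewrite {1}(sqfree_partE conic_disc) muln_gt0 expn_gt0 orbF => /andP[]. Qed.

Lemma logn_h p : logn p frame_gcd = minn (logn p (2 * m)) (logn p s).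
Proof. by rewrite logn_gcd // m2_gt0. Qed.

Lemma logn_beta p : logn p beta = (logn p (2 * m) - logn p s)%N.
Proof.
have := congr1 (logn p) beta_h; rewrite lognM ?beta_gt0 ?h_gt0 // logn_h; clear; lia.
Qed.

Lemma logn_tau p : logn p tau = (logn p s - logn p (2 * m))%N.
Proof.
have := congr1 (logn p) tau_h; rewrite lognM ?tau_gt0 ?h_gt0 // logn_h; clear; lia.
Qed.

(** At a prime dividing beta the exponents of q and s have different parities; this rules out the
    isotropic vectors that would escape the parametrisation. *)
Lemma valuation_parity p : prime p ->
  (logn p (2 * m) <= logn p s)%N \/ odd (logn p q + logn p s).
Proof.
move=> pp; rewrite lognM // (logn_prime _ (isT : prime 2)); have := g pp.
have [->|p2] := eqVneq p 2%N.
  case=> [[-> -> h]|[-> -> t]|[[-> ->]|[-> -> ->]|[[-> -> ->]|[-> -> ->]]]] /=; auto.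
  - by case: (logn 2 s) t => [|[|t]] //; [right|left].
  - by case: (logn 2 s) => [|t]; [right|left].
by case=> [[-> -> h]|[-> -> t]|[[-> ->]|[-> -> ->]|[[-> -> ->]|[-> -> ->]]]] /=; auto.
Qed.

(** Needed for alpha to be an integer and for z and X to be coprime. *)
Lemma valuation_bound p : prime p ->
  (logn p q <= 1 + logn p (2 * m) + logn p beta)%N.
Proof.
move=> pp; rewrite logn_beta lognM // (logn_prime _ (isT : prime 2)); have := g pp.
by case=> [[-> -> h]|[-> -> t]|[[-> ->]|[-> -> ->]|[[-> -> ->]|[-> -> ->]]]];
  rewrite ?leq_addr //; case: (p == 2%N).
Qed.

Lemma q_dvd : (q %| conic_sqfree * sqroot_part conic_disc)%N.
Proof.
apply: dvdn_prime_powers; rewrite ?q0 // ?muln_gt0 ?kappa_gt0 ?sqroot_gt0 // => p pp.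
have := logn_sqfree_part n_gt0 pp; have := valuation_bound pp.
have := congr1 (logn p) (sqfree_partE conic_disc).
rewrite {1}/conic_disc !lognM ?muln_gt0 ?expn_gt0 ?m0 ?q0 ?beta_gt0 ?kappa_gt0 ?sqroot_gt0 //.
rewrite -/conic_sqfree; clear; lia.
Qed.

Lemma qalpha2 : (q * alpha ^ 2 = 2 * m * beta * conic_sqfree)%N.
Proof.
have qa : (q * alpha = conic_sqfree * sqroot_part conic_disc)%N by rewrite mulnC divnK // q_dvd.
have E : (q * (q * alpha ^ 2) = q * (2 * m * beta * conic_sqfree))%N.
  transitivity ((q * alpha) ^ 2)%N; first by ring.
  rewrite qa expnMn -[X in (X * _)%N]mulnn -mulnA -sqfree_partE /conic_disc; ring.
by apply/eqP; rewrite -(eqn_pmul2l q0) E.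
Qed.

End ConicData.

Lemma primitive_vecP (u : 'rV[int]_3) : primitive_vec u <->
  forall p, prime p -> ~~ [&& p%:Z %| u ord0 i0, p%:Z %| u ord0 i1 & p%:Z %| u ord0 i2]%Z.
Proof.
rewrite /primitive_vec; set d := \big[_/_]_(i < 3) _.
have dP p : (p %| d)%N =
    [&& p%:Z %| u ord0 i0, p%:Z %| u ord0 i1 & p%:Z %| u ord0 i2]%Z.
  apply/dvdn_biggcdP/and3P => [h|[h0 h1 h2]]; first by split; apply: h.
  by apply: forall_I3.
split=> [d1 p pp|h]; first by rewrite -dP d1 dvdn1; case: p pp => [|[]].
apply/eqP; have [d0|d0] := posnP d; first by have := h 2%N isT; rewrite -dP d0 dvdn0.
rewrite eqn_leq d0 andbT leqNgt; apply/negP => d1.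
by have := h _ (pdiv_prime d1); rewrite -dP pdiv_dvd.
Qed.

Lemma logn_absz_eq (p v : nat) (z : int) : prime p ->
  ((p ^ v)%N%:Z %| z)%Z -> ~~ ((p ^ v.+1)%N%:Z %| z)%Z -> z != 0 /\ logn p `|z| = v.
Proof.
move=> pp h1 h2; have z0 : z != 0 by apply: contraNneq h2 => ->; rewrite dvdz0.
have z0' : (0 < `|z|)%N by rewrite absz_gt0.
move: h1 h2; rewrite !dvdzE /= !pfactor_dvdn // => h1 h2.
by split=> //; apply/eqP; rewrite eqn_leq h1 andbT leqNgt.
Qed.

Lemma dvdz_logn (p v : nat) (z : int) : prime p -> z != 0 ->
  ((p ^ v)%N%:Z %| z)%Z = (v <= logn p `|z|)%N.
Proof. by move=> pp z0; rewrite dvdzE /= pfactor_dvdn // absz_gt0. Qed.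

Lemma coprimez_primeP (x y : int) : coprimez x y <->
  forall p, prime p -> ~~ ((p%:Z %| x)%Z && (p%:Z %| y)%Z).
Proof.
split=> [c p pp|h].
  apply/negP; rewrite -dvdz_gcd (eqP c) dvdz1 /=.
  by case: p pp => [|[]].
rewrite /coprimez; have [g0|g0] := eqVneq (gcdz x y) 0.
  by have := h 2%N isT; rewrite -dvdz_gcd g0 dvdz0.
have [//|g1] := eqVneq (gcdz x y) 1.
have pp : prime (pdiv `|gcdz x y|%N).
  by apply: pdiv_prime; move: g0 g1; rewrite /gcdz /=; case: (gcdn _ _) => [|[]].
by have := h _ pp; rewrite -dvdz_gcd dvdzE pdiv_dvd.
Qed.

Section Cone.
Variables (m q s : nat).
Hypotheses (m0 : (0 < m)%N) (q0 : (0 < q)%N) (s0 : (0 < s)%N).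
Hypothesis g : forall p, prime p -> good p (logn p m) (logn p q) (logn p s).
Let be := beta m s.
Let ta := tau m s.
Let K := conic_sqfree m q s.
Let al := alpha m q s.

Let be0 : (0 < be)%N := beta_gt0 s m0.
Let K0 : (0 < K)%N := kappa_gt0 s m0 q0.

Lemma sbetaZ : s%:Z * be%:Z = 2 * m%:Z * ta%:Z.
Proof. by rewrite -!PoszM sbeta. Qed.

Lemma qalpha2Z : q%:Z * al%:Z ^+ 2 = 2 * m%:Z * be%:Z * K%:Z.
Proof. by rewrite -Posz_exp -!PoszM qalpha2. Qed.

Lemma alpha_gt0 : (0 < al)%N.
Proof.
have : (0 < q * al ^ 2)%N by rewrite qalpha2 // !muln_gt0 m0 be0 K0.
by rewrite muln_gt0 expn_gt0 orbF => /andP[].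
Qed.

(** If p occurred in s u_2 to a lower power than in 2 m, then 2 m u_0 + s u_2 would have the
    exponent of s u_2, and q u_1^2 = u_2 (2 m u_0 + s u_2) would make the exponents of q and s
    congruent modulo 2. *)
Lemma beta_dvd (u0 u1 u2 : int) :
  2 * m%:Z * (u0 * u2) - q%:Z * u1 ^+ 2 + s%:Z * u2 ^+ 2 = 0 -> (be%:Z %| u2)%Z.
Proof.
move=> iso; have [->|u20] := eqVneq u2 0; first exact: dvdz0.
have h0 := h_gt0 s m0.
suff : ((2 * m)%N%:Z %| s%:Z * u2)%Z.
  rewrite -(beta_h m s) -{1}(tau_h m s) [(beta m s * _)%N]mulnC !PoszM -[_ * _ * u2]mulrAC.
  rewrite mulrC dvdz_mul2l ?gt_eqF // ?ltz_nat // Gauss_dvdzr //.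
  apply/coprimez_primeP => p pp; apply/negP => /andP[].
  rewrite !dvdzE /= -(expn1 p) !pfactor_dvdn ?beta_gt0 ?tau_gt0 //.
  by rewrite logn_beta // logn_tau //; clear; lia.
apply: dvdz_prime_powers => [|p pp]; first by rewrite muln_gt0 m0.
have su0 : s%:Z * u2 != 0 by rewrite mulf_neq0 // gt_eqF // ltz_nat.
have u20' : (0 < `|u2|)%N by rewrite absz_gt0.
rewrite dvdz_logn // abszM (lognM p s0 u20').
rewrite leqNgt; apply/negP => lt.
set v := (logn p s + logn p `|u2|)%N in lt.
pose Y := 2 * m%:Z * u0 + s%:Z * u2.
have YE : q%:Z * u1 ^+ 2 = u2 * Y by rewrite /Y; apply: (eq_from_sub (esym iso)); ring.
have m2 : ((p ^ v.+1)%N%:Z %| 2 * m%:Z * u0)%Z.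
  have h : (p ^ v.+1 %| 2 * m)%N by rewrite pfactor_dvdn // muln_gt0 m0.
  by rewrite (_ : 2 * m%:Z = (2 * m)%N%:Z) ?PoszM // -?PoszM dvdz_mulr.
have sv : logn p (absz (s%:Z * u2)%R) = v by rewrite abszM (lognM p s0 u20').
have [||Y0 YL] := @logn_absz_eq p v Y pp.
- apply: rpredD; last by rewrite dvdz_logn // sv.
  by apply: dvdz_trans m2; rewrite dvdzE /= dvdn_exp2l.
- by rewrite (rpredDl _ m2) dvdz_logn // sv ltnn.
have u10 : u1 != 0.
  by apply: contraNneq Y0 => u10; move/eqP: YE; rewrite u10 expr0n mulr0 eq_sym mulf_eq0 (negbTE u20).
have u10' : (0 < `|u1|)%N by rewrite absz_gt0.
have Y0' : (0 < `|Y|)%N by rewrite absz_gt0.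
have : (q * (`|u1| * `|u1|) = `|u2| * `|Y|)%N.
  by have := congr1 absz YE; rewrite expr2 !abszM.
move=> /(congr1 (logn p)).
rewrite (lognM p q0) ?muln_gt0 ?u10' // (lognM p u10' u10') (lognM p u20' Y0') YL /v.
have := valuation_parity m0 g pp; move: lt; rewrite /v; clear.
move: (logn p (2 * m)) (logn p q) (logn p s) (logn p `|u2|) (logn p `|u1|).
by move=> a b c d e; lia.
Qed.

(** A prime dividing z and X divides u_0 and u_2, hence not u_1, and q u_1^2 = 2 m beta z X then
    contradicts [valuation_bound]. That alpha divides u_1 follows from K u_1^2 = alpha^2 z X because
    K is square-free. *)
Lemma cone_factor (u0 u1 u2 : int) :
  2 * m%:Z * (u0 * u2) - q%:Z * u1 ^+ 2 + s%:Z * u2 ^+ 2 = 0 ->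
  (forall p, prime p -> ~~ [&& p%:Z %| u0, p%:Z %| u1 & p%:Z %| u2]%Z) ->
  exists X z w : int, [/\ u0 = X - ta%:Z * z, u1 = al%:Z * w, u2 = be%:Z * z,
    z * X = K%:Z * w ^+ 2 & coprimez z X].
Proof.
move=> iso hp; have /dvdzP[z zE] := beta_dvd iso.
have sb := sbetaZ; have qa := qalpha2Z.
pose X := u0 + ta%:Z * z.
have eq1 : q%:Z * u1 ^+ 2 = 2 * m%:Z * be%:Z * (z * X).
  apply: (eq_from_sub (esym iso)); rewrite zE /X.
  have -> : s%:Z * (z * be%:Z) ^+ 2 = (s%:Z * be%:Z) * z ^+ 2 * be%:Z by ring.
  by rewrite sb; ring.
have mb0 : 2 * m%:Z * be%:Z != 0.
  by rewrite !mulf_neq0 // gt_eqF // ltz_nat.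
have cop : coprimez z X.
  apply/coprimez_primeP => p pp; apply/negP => /andP[pz pX].
  have pu0 : (p%:Z %| u0)%Z.
    have -> : u0 = X - ta%:Z * z by rewrite /X; ring.
    by rewrite rpredB // dvdz_mull.
  have pu2 : (p%:Z %| u2)%Z by rewrite zE dvdz_mulr.
  have pu1 : ~~ (p%:Z %| u1)%Z by have := hp p pp; rewrite pu0 pu2 andbT.
  have bd := valuation_bound m0 s0 g pp.
  pose v := (logn p (2 * m) + logn p be)%N.
  have h : (p ^ v.+2 %| q)%N.
    have cz : coprimez (p ^ v.+2)%N%:Z (u1 ^+ 2).
      rewrite coprimezXr // coprimezE /= coprimeXl // prime_coprime //.
    have : ((p ^ v.+2)%N%:Z %| q%:Z * u1 ^+ 2)%Z.
      have -> : (p ^ v.+2 = p ^ v * (p * p))%N by rewrite mulnn -expnD addn2.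
      rewrite eq1 !PoszM; apply: dvdz_mul; last exact: dvdz_mul.
      rewrite (_ : 2 * m%:Z * be%:Z = (2 * m * be)%N%:Z) ?PoszM // -?PoszM.
      by rewrite dvdzE /= pfactor_dvdn ?muln_gt0 ?m0 ?be0 // (lognM p _ be0) ?muln_gt0 ?m0.
    by rewrite Gauss_dvdzl.
  move: h; rewrite pfactor_dvdn // => h.
  by move: h bd; rewrite /v -/be; clear; lia.
have K0' : K%:Z != 0 by rewrite gt_eqF // ltz_nat.
have al0' : al%:Z != 0 by rewrite gt_eqF // ltz_nat alpha_gt0.
have eq2 : K%:Z * u1 ^+ 2 = al%:Z ^+ 2 * (z * X).
  apply: (mulfI mb0); rewrite [LHS]mulrA -qa.
  have -> : q%:Z * al%:Z ^+ 2 * u1 ^+ 2 = al%:Z ^+ 2 * (q%:Z * u1 ^+ 2) by ring.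
  by rewrite eq1; ring.
have /dvdzP[w wE] : (al%:Z %| u1)%Z.
  have [->|u10] := eqVneq u1 0; first exact: dvdz0.
  have zX0 : z * X != 0.
    apply: contraNneq u10 => zX0; move/eqP: eq2; rewrite zX0 mulr0 mulf_eq0 (negbTE K0') /=.
    by rewrite sqrf_eq0.
  apply: dvdz_prime_powers => [|p pp]; first exact: alpha_gt0.
  rewrite dvdz_logn //.
  have a0 := alpha_gt0.
  have u10' : (0 < `|u1|)%N by rewrite absz_gt0.
  have zX0' : (0 < absz (z * X)%R)%N by rewrite absz_gt0.
  have : (K * (`|u1| * `|u1|) = al * al * absz (z * X)%R)%N.
    by have := congr1 absz eq2; rewrite !expr2 !(abszM (_ * _)) !abszM /=.
  move=> /(congr1 (logn p)).
  rewrite (lognM p K0) ?muln_gt0 ?u10' // (lognM p u10' u10').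
  rewrite (lognM p _ zX0') ?muln_gt0 ?a0 // (lognM p a0 a0).
  have := logn_sqfree_part (n_gt0 s m0 q0) pp; rewrite -/(conic_sqfree m q s) -/K; clear.
  lia.
exists X, z, w; split=> //; first by rewrite /X; ring.
- by rewrite wE mulrC.
- by rewrite zE mulrC.
apply: (mulfI (expf_neq0 2 al0')); rewrite -eq2 wE; ring.
Qed.

(** A prime dividing all three coordinates would divide beta but none of tau, z, X, K, w. So it
    would divide alpha, and the exponents in q alpha^2 = 2 m beta K contradict
    [valuation_parity]. *)
Lemma cone_of_factor (X z w : int) : z * X = K%:Z * w ^+ 2 -> coprimez z X ->
  2 * m%:Z * ((X - ta%:Z * z) * (be%:Z * z)) - q%:Z * (al%:Z * w) ^+ 2
    + s%:Z * (be%:Z * z) ^+ 2 = 0 /\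
  forall p, prime p ->
    ~~ [&& p%:Z %| X - ta%:Z * z, p%:Z %| al%:Z * w & p%:Z %| be%:Z * z]%Z.
Proof.
move=> zX cop; have sb := sbetaZ; have qa := qalpha2Z; split.
  have -> : q%:Z * (al%:Z * w) ^+ 2 = (q%:Z * al%:Z ^+ 2) * w ^+ 2 by ring.
  have -> : s%:Z * (be%:Z * z) ^+ 2 = (s%:Z * be%:Z) * be%:Z * z ^+ 2 by ring.
  rewrite qa sb -[2 * m%:Z * be%:Z * K%:Z * w ^+ 2]mulrA -zX; ring.
move=> p pp; apply/negP => /and3P[p0 p1 p2].
have /coprimez_primeP cp := cop.
have pz : ~~ (p%:Z %| z)%Z.
  apply/negP => pz; have := cp p pp; rewrite pz /=.
  by rewrite (rpredBr _ (dvdz_mull ta%:Z pz)) in p0; rewrite p0.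
rewrite Euclid_dvdzM // (negbTE pz) orbF in p2.
have pbe : (0 < logn p be)%N by rewrite logn_gt0 mem_primes pp be0.
have lb := logn_beta m0 s0 p; have lt := logn_tau m0 s0 p.
have pta : ~~ (p%:Z %| ta%:Z)%Z.
  rewrite dvdzE /= -(expn1 p) pfactor_dvdn ?tau_gt0 // /ta lt; move: pbe; rewrite /be lb.
  by clear; lia.
have pX : ~~ (p%:Z %| X)%Z.
  apply/negP => pX; rewrite (rpredBl _ pX) in p0; move: p0.
  by rewrite Euclid_dvdzM // (negbTE pta) (negbTE pz).
have : ~~ (p%:Z %| K%:Z * w ^+ 2)%Z by rewrite -zX Euclid_dvdzM // negb_or pz pX.
rewrite Euclid_dvdzM // Euclid_dvdz_sq // negb_or => /andP[pK pw].
rewrite Euclid_dvdzM // (negbTE pw) orbF in p1.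
have lK : logn p K = 0%N.
  by apply/eqP; rewrite -leqn0 leqNgt logn_gt0 mem_primes pp K0.
have a0 := alpha_gt0.
have : (q * (al * al) = 2 * m * be * K)%N by rewrite -qalpha2 // mulnn.
move=> /(congr1 (logn p)).
rewrite (lognM p q0) ?muln_gt0 ?a0 // (lognM p a0 a0) (lognM p _ K0) ?muln_gt0 ?m0 //.
rewrite (lognM p _ be0) ?muln_gt0 ?m0 // lK.
have := valuation_parity m0 g pp; move: pbe; rewrite /be lb; clear.
move: (logn p (2 * m)) (logn p q) (logn p s) (logn p al) => a b c d; lia.
Qed.
End Cone.

(** * Coprime factorisations of K w^2 *)

Lemma coprime_mul_sqr (m n w : nat) : coprime m n -> (m * n = w ^ 2)%N -> m = (gcdn m w ^ 2)%N.
Proof.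
move=> cmn mn.
(* Squaring commutes with gcd, and gcd(m^2, w^2) = gcd(m^2, m n) = m. *)
have -> : (gcdn m w ^ 2 = gcdn (m ^ 2) (w ^ 2))%N.
  have [w0|w0] := posnP w.
    by rewrite w0 exp0n // !gcdn0.
  have g0 : (0 < gcdn m w)%N by rewrite gcdn_gt0 w0 orbT.
  have [mE wE] : (m = m %/ gcdn m w * gcdn m w)%N /\ (w = w %/ gcdn m w * gcdn m w)%N.
    by rewrite !divnK ?dvdn_gcdl ?dvdn_gcdr.
  set x := (m %/ _)%N in mE; set y := (w %/ _)%N in wE; set g := gcdn m w in mE wE g0 *.
  have cxy : coprime x y.
    by apply/eqP; apply/eqP; rewrite -(eqn_pmul2r g0) muln_gcdl -mE -wE mul1n.
  rewrite [X in gcdn (X ^ _)]mE [X in gcdn _ (X ^ _)]wE !expnMn -muln_gcdl.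
  by rewrite (eqP (_ : coprime (x ^ 2) (y ^ 2))) ?mul1n // coprimeXl // coprimeXr.
by rewrite -mn -mulnn -muln_gcdr (eqP cmn) muln1.
Qed.

Lemma sqr_eq_sign (x y : int) : x ^+ 2 = y ^+ 2 -> x = y \/ x = - y.
Proof. by move=> /eqP; rewrite eqf_sqr => /orP[] /eqP; [left|right]. Qed.

Section Factor.
Variable K : nat.
Hypotheses (K0 : (0 < K)%N) (Ksf : forall p, prime p -> (logn p K <= 1)%N).

Lemma sqfree_coprime d : (d %| K)%N -> coprime d (K %/ d).
Proof.
move=> dK; have d0 := dvdn_gt0 K0 dK.
have kd0 : (0 < K %/ d)%N by rewrite divn_gt0 // dvdn_leq.
rewrite (coprime_has_primes d0 kd0).
apply/hasPn => p; rewrite !mem_primes => /and3P[pp _ p2]; apply/negP => /and3P[_ _ p1].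
have : (p ^ 2 %| K)%N by rewrite -(divnK dK) mulnC -mulnn dvdn_mul.
by rewrite pfactor_dvdn // leqNgt ltnS Ksf.
Qed.

(** Take d = gcd(|z|, K). Then |z| / d and |X| / (K / d) are coprime with product w^2, hence both
    are squares. The common sign of z and X is e, and the sign of w is absorbed by a. *)
Lemma factor_square (z X w : int) : z * X = K%:Z * w ^+ 2 -> coprimez z X ->
  exists (d : nat) (e a b : int), [/\ (d %| K)%N, e * e = 1,
    [/\ z = e * d%:Z * a ^+ 2, X = e * (K %/ d)%N%:Z * b ^+ 2 & w = e * (a * b)],
    coprimez a b & coprime `|a| (K %/ d) && coprime `|b| d].
Proof.
move=> zX cop.
pose d := gcdn `|z| K; have dK : (d %| K)%N := dvdn_gcdr _ _.
have d0 : (0 < d)%N by rewrite gcdn_gt0 K0 orbT.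
have /dvdnP[z1 z1E] : (d %| `|z|)%N := dvdn_gcdl _ _.
pose K1 := (K %/ d)%N; have KE : K = (K1 * d)%N by rewrite divnK.
have K10 : (0 < K1)%N by move: K0; rewrite {1}KE muln_gt0 => /andP[].
have nzX : (`|z| * `|X| = K * `|w| ^ 2)%N.
  by have := congr1 absz zX; rewrite expr2 !abszM -mulnn.
have cz1 : coprime z1 K1.
  by apply/eqP; apply/eqP; rewrite -(eqn_pmul2r d0) muln_gcdl -z1E -KE mul1n.
have /dvdnP[X1 X1E] : (K1 %| `|X|)%N.
  rewrite -(Gauss_dvdr _ (_ : coprime K1 z1)); last by rewrite coprime_sym.
  have : (d * (z1 * `|X|) = d * (K1 * `|w| ^ 2))%N.
    by move: nzX; rewrite z1E {1}KE; lia.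
  by move=> /eqP; rewrite eqn_pmul2l // => /eqP ->; rewrite dvdn_mulr.
have z1X1 : (z1 * X1 = `|w| ^ 2)%N.
  apply/eqP; rewrite -(eqn_pmul2l K0) -nzX z1E X1E {1}KE; apply/eqP; ring.
have czX : coprime `|z| `|X| by [].
have c1 : coprime z1 X1.
  by move: czX; rewrite z1E X1E coprimeMl !coprimeMr => /andP[/andP[]].
have z1s := coprime_mul_sqr c1 z1X1.
have X1s : X1 = (gcdn X1 `|w| ^ 2)%N.
  by apply: (@coprime_mul_sqr _ z1); rewrite 1?coprime_sym 1?mulnC.
move: z1s X1s; set a := gcdn z1 _; set b := gcdn X1 _ => z1s X1s.
have wab : (`|w| = a * b)%N.
  by apply/eqP; rewrite -eqn_sqr -z1X1 {1}z1s {1}X1s expnMn.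
have zA : `|z|%:Z = d%:Z * a%:Z ^+ 2 by rewrite z1E {1}z1s PoszM -mulnn PoszM expr2 mulrC.
have XA : `|X|%:Z = K1%:Z * b%:Z ^+ 2 by rewrite X1E {1}X1s PoszM -mulnn PoszM expr2 mulrC.
have wA : `|w|%:Z = a%:Z * b%:Z by rewrite wab PoszM.
have [e [ee zE XE]] : exists e, [/\ e * e = 1 :> int, z = e * `|z|%:Z & X = e * `|X|%:Z].
  have P : 0 <= z * X by rewrite zX mulr_ge0 // sqr_ge0.
  have [zp|zn|z00] := ltrgtP 0 z.
  - exists 1; rewrite !mul1r !gez0_abs ?(ltW zp) //.
    by rewrite -(pmulr_rge0 _ zp).
  - exists (-1); rewrite !mulN1r !lez0_abs ?(ltW zn) ?opprK //.
    by rewrite -(nmulr_rge0 _ zn).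
  (* For z = 0 the sign has to be read off X. *)
  have [Xp|Xn] := leP 0 X.
    by exists 1; rewrite -z00 !mul1r !gez0_abs.
  exists (-1); rewrite -z00 !mulN1r absz0 oppr0 opprK; split=> //.
  by rewrite ltz0_abs // opprK.
have [f [ff wE]] : exists f, f * f = 1 :> int /\ w = e * (f * `|w|%:Z).
  have [wp|wn] := leP 0 w.
    by exists e; split=> //; rewrite gez0_abs // mulrA ee mul1r.
  by exists (- e); split; rewrite ?mulrNN // ltz0_abs // mulNr !mulrN opprK mulrA ee mul1r.
have f1 : `|f|%N = 1%N by move: ff; clear; nia.
exists d, e, (f * a%:Z), b%:Z; split=> //.
- split.
  + by rewrite zE zA exprMn [f ^+ 2]expr2 ff; ring.
  + by rewrite XE XA mulrA.
  + by rewrite wE wA; ring.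
- rewrite coprimezE abszM f1 mul1n /=.
  move: c1; rewrite z1s X1s coprime_pexpl // coprime_pexpr //.
- rewrite abszM f1 mul1n /= -/K1; apply/andP; split.
    by move: cz1; rewrite z1s coprime_pexpl.
  move: czX; rewrite z1E X1E coprimeMl => /andP[_].
  by rewrite coprimeMr => /andP[+ _]; rewrite X1s coprime_sym coprime_pexpl.
Qed.

Lemma factor_coprime (d : nat) (e a b : int) : (d %| K)%N -> e * e = 1 ->
  coprimez a b -> coprime `|a| (K %/ d) && coprime `|b| d ->
  coprimez (e * d%:Z * a ^+ 2) (e * (K %/ d)%N%:Z * b ^+ 2).
Proof.
move=> dK ee cab /andP[ca cb]; have cd := sqfree_coprime dK.
have e1 : `|e|%N = 1%N by move: ee; clear; nia.
have cdb : coprime d `|b| by rewrite coprime_sym.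
have cab' : coprime `|a| `|b| by [].
by rewrite coprimezE !expr2 !abszM e1 !mul1n /= !coprimeMl !coprimeMr cd ca cdb cab'.
Qed.

(** d is recovered as gcd(|z|, K) and e as the sign of z or X. The squares fix a and b up to signs,
    and w ties the two signs together. *)
Lemma factor_unique (d d' : nat) (e e' a a' b b' : int) :
  (d %| K)%N -> (d' %| K)%N -> e * e = 1 -> e' * e' = 1 ->
  coprimez a b -> coprimez a' b' ->
  coprime `|a| (K %/ d) -> coprime `|a'| (K %/ d') ->
  e * d%:Z * a ^+ 2 = e' * d'%:Z * a' ^+ 2 ->
  e * (K %/ d)%N%:Z * b ^+ 2 = e' * (K %/ d')%N%:Z * b' ^+ 2 ->
  e * (a * b) = e' * (a' * b') ->
  [/\ d = d', e = e' & (a = a' /\ b = b') \/ (a = - a' /\ b = - b')].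
Proof.
move=> dK d'K ee ee' cab cab' ca ca' zE XE wE.
have gd x (f y : int) : (x %| K)%N -> f * f = 1 -> coprime `|y| (K %/ x) ->
    gcdn `|(f * x%:Z * y ^+ 2)%R| K = x.
  move=> xK ff cy; have f1 : `|f|%N = 1%N by move: ff; clear; nia.
  rewrite expr2 !abszM f1 mul1n mulnn /= -{1}(divnK xK) mulnC -muln_gcdl.
  by rewrite (eqP (_ : coprime (`|y| ^ 2) (K %/ x))) ?mul1n // coprimeXl.
have dd : d = d' by rewrite -(gd d e a) // zE gd.
subst d'; have d0 : d%:Z != 0 by rewrite gt_eqF // ltz_nat (dvdn_gt0 K0 dK).
have k0 : (K %/ d)%N%:Z != 0.
  have dp : (0 < d)%N := dvdn_gt0 K0 dK.
  by rewrite gt_eqF // ltz_nat divn_gt0 // dvdn_leq.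
have za : e * a ^+ 2 = e' * a' ^+ 2.
  by apply: (mulfI d0); rewrite mulrCA mulrA zE; ring.
have Xb : e * b ^+ 2 = e' * b' ^+ 2.
  by apply: (mulfI k0); rewrite mulrCA mulrA XE; ring.
have sgn x : x * x = 1 :> int -> x = 1 \/ x = -1.
  by move=> xx; apply: sqr_eq_sign; rewrite expr1n expr2.
have nz : a != 0 \/ b != 0.
  have [a0|] := eqVneq a 0; last by left.
  by right; apply: contraTneq cab => ->; rewrite a0.
have eq_e : e = e'.
  have pos x y : x != 0 -> x ^+ 2 = - y ^+ 2 :> int -> False.
    move=> x0; have y2 := sqr_ge0 y.
    have x2 : 0 < x ^+ 2 by rewrite lt_def sqrf_eq0 x0 sqr_ge0.
    by move=> h; move: x2; rewrite h oppr_gt0 ltNge y2.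
  have opp f f' : f * f = 1 -> f' * f' = 1 -> f != f' -> f' = - f :> int.
    by move=> /sgn[->|->] /sgn[->|->]; rewrite ?eqxx ?opprK.
  apply/eqP; apply: contraT => ne; have e'E := opp _ _ ee ee' ne.
  have c x y : e * x ^+ 2 = e' * y ^+ 2 -> x ^+ 2 = - y ^+ 2.
    by rewrite e'E => h; rewrite -[LHS]mul1r -ee -mulrA h mulNr mulrN mulrA ee mul1r.
  by case: nz => [a0|b0]; [case: (pos _ _ a0 (c _ _ za))|case: (pos _ _ b0 (c _ _ Xb))].
subst e'; have e0 : e != 0 by apply: contra_eq_neq ee => ->; rewrite mulr0.
have ab := mulfI e0 wE.
have [ha|ha] := sqr_eq_sign (mulfI e0 za); have [hb|hb] := sqr_eq_sign (mulfI e0 Xb).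
- by split=> //; left.
- split=> //; move: ab; rewrite ha hb mulrN => ab.
  have : a' * b' = 0 by move: ab; move: (a' * b') => t; clear; lia.
  move=> /eqP; rewrite mulf_eq0 => /orP[] /eqP h0; rewrite h0 ?oppr0; [right|left]; by [].
- split=> //; move: ab; rewrite ha hb mulNr => ab.
  have : a' * b' = 0 by move: ab; move: (a' * b') => t; clear; lia.
  move=> /eqP; rewrite mulf_eq0 => /orP[] /eqP h0; rewrite h0 ?oppr0; [left|right]; by [].
- by split=> //; right.
Qed.

End Factor.

(** * Counting one orbit *)

Definition orbit_primes (m q : nat) := [seq p <- primes (m * q) | orbit_prime m q p].

(* The condition on (a, b), d fixed, for [point d e (a, b)] to be primitive and to lie in the
   orbit of e_0. *)
Definition Wset (m q k t d : nat) (a b : int) : bool :=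
  [&& coprime `|a| (k %/ d), coprime `|b| d &
   all (fun p : nat => p%:Z %| ((k %/ d)%N%:Z * b ^+ 2 - t%:Z * d%:Z * a ^+ 2) ^+ 2 - 1)%Z
     (orbit_primes m q)].

Definition row3 (R : Type) (a b c : R) : 'rV[R]_3 :=
  \row_(i < 3) nth a [:: a; b; c] i.

Lemma row3P (R : Type) (u : 'rV[R]_3) : u = row3 (u ord0 i0) (u ord0 i1) (u ord0 i2).
Proof. by apply/rowP; apply: forall_I3; rewrite mxE. Qed.

Lemma orbit_primesP m q (P : nat -> bool) : (0 < m)%N -> (0 < q)%N ->
  (forall p, orbit_prime m q p -> P p) <-> all P (orbit_primes m q).
Proof.
move=> m0 q0; split=> [h|/allP h p hp].
  by apply/allP => p; rewrite mem_filter => /andP[/h].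
apply: h; rewrite mem_filter hp mem_primes muln_gt0 m0 q0.
have /and3P[-> _ big] := hp; rewrite /= -[(p %| _)%N]/((p ^ 1 %| _)%N).
have /andP[pp _] := hp; rewrite pfactor_dvdn ?muln_gt0 ?m0 // lognM //.
by move: big; clear; lia.
Qed.

Lemma qform_Std m q s (u : 'rV[int]_3) : qform (Std m q s) u =
  2 * m%:Z * (u ord0 i0 * u ord0 i2) - q%:Z * u ord0 i1 ^+ 2 + s%:Z * u ord0 i2 ^+ 2.
Proof.
rewrite /qform mxE sum_I3 !mxE !sum_I3 !mxE /=; ring.
Qed.

Section Param.
Variables (m q s : nat).
Hypotheses (m0 : (0 < m)%N) (q0 : (0 < q)%N) (s0 : (0 < s)%N).
Hypothesis g : forall p, prime p -> good p (logn p m) (logn p q) (logn p s).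
Let be := beta m s.
Let ta := tau m s.
Let K := conic_sqfree m q s.
Let al := alpha m q s.
Let K0 : (0 < K)%N := kappa_gt0 s m0 q0.
Let Ksf p : prime p -> (logn p K <= 1)%N := @logn_sqfree_part _ p (n_gt0 s m0 q0).

Definition point (d : nat) (e : int) (v : int * int) : 'rV[int]_3 :=
  row3 (e * ((K %/ d)%N%:Z * v.2 ^+ 2 - ta%:Z * d%:Z * v.1 ^+ 2))
       (al%:Z * (e * (v.1 * v.2))) (be%:Z * (e * d%:Z * v.1 ^+ 2)).

(** The orbit in frame coordinates, as characterised by [orbitP]. *)
Definition std_orbit (u : 'rV[int]_3) : Prop :=
  [/\ primitive_vec u, qform (Std m q s) u = 0 &
    forall p, orbit_prime m q p -> (p%:Z %| u ord0 i0 ^+ 2 - 1)%Z].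

Lemma orbit_cond_point d e v : e * e = 1 ->
  (forall p : nat, orbit_prime m q p -> (p%:Z %| (point d e v) ord0 i0 ^+ 2 - 1)%Z) <->
  all (fun p : nat => p%:Z %|
    ((K %/ d)%N%:Z * v.2 ^+ 2 - ta%:Z * d%:Z * v.1 ^+ 2) ^+ 2 - 1)%Z (orbit_primes m q).
Proof.
move=> ee; rewrite -orbit_primesP //.
have E : (point d e v) ord0 i0 ^+ 2 =
    ((K %/ d)%N%:Z * v.2 ^+ 2 - ta%:Z * d%:Z * v.1 ^+ 2) ^+ 2.
  by rewrite mxE /= exprMn [e ^+ 2]expr2 ee mul1r.
by split=> h p hp; move: (h p hp); rewrite E.
Qed.

Lemma std_orbitP (u : 'rV[int]_3) : std_orbit u <->
  exists d e v, [/\ (d %| K)%N, e * e = 1, prim_in (Wset m q K ta d) v & u = point d e v].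
Proof.
split=> [[/primitive_vecP pu qu oc]|[d [e [[a b] [dK ee pW ->]]]]].
  rewrite qform_Std in qu.
  have [X [z [w [E0 E1 E2 zX cop]]]] := cone_factor m0 q0 s0 g qu pu.
  have [d [e [a [b [dK ee [zE XE wE] cab cc]]]]] := factor_square K0 zX cop.
  exists d, e, (a, b).
  have uE : u = point d e (a, b).
    by rewrite (row3P u) /point /= E0 E1 E2 zE XE wE; congr row3; ring.
  split=> //; rewrite /prim_in /= cab /Wset.
  move/andP: cc => [-> ->] /=; apply/(orbit_cond_point d (a, b) ee).
  by move=> p hp; rewrite -uE; apply: oc.
move: pW; rewrite /prim_in /= => /andP[cab /and3P[ca cb oc]].
have cc : coprime `|a| (K %/ d) && coprime `|b| d by rewrite ca cb.
have cop := factor_coprime K0 Ksf dK ee cab cc.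
have kd : (K %/ d)%N%:Z * d%:Z = K%:Z by rewrite -PoszM divnK.
have zX : (e * d%:Z * a ^+ 2) * (e * (K %/ d)%N%:Z * b ^+ 2) = K%:Z * (e * (a * b)) ^+ 2.
  by rewrite -kd; ring.
have [iso pr] := cone_of_factor m0 q0 s0 g zX cop.
have uE : point d e (a, b) =
    row3 (e * (K %/ d)%N%:Z * b ^+ 2 - ta%:Z * (e * d%:Z * a ^+ 2))
      (al%:Z * (e * (a * b))) (be%:Z * (e * d%:Z * a ^+ 2)).
  by rewrite /point /=; congr row3; ring.
split.
- by apply/primitive_vecP => p pp; rewrite uE !mxE; exact: pr.
- by rewrite qform_Std uE !mxE; exact: iso.
- by apply/(orbit_cond_point d (a, b) ee).
Qed.

Lemma point_inj d d' e e' v v' : (d %| K)%N -> (d' %| K)%N -> e * e = 1 -> e' * e' = 1 ->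
  prim_in (Wset m q K ta d) v -> prim_in (Wset m q K ta d') v' ->
  point d e v = point d' e' v' ->
  [/\ d = d', e = e' & v = v' \/ v = (- v'.1, - v'.2)].
Proof.
case: v v' => [a b] [a' b'] dK d'K ee ee'.
rewrite /prim_in /= => /andP[cab /and3P[ca cb _]] /andP[cab' /and3P[ca' cb' _]] pE.
have E i := congr1 (fun u : 'rV[int]_3 => u ord0 i) pE.
have E0 := E i0; have E1 := E i1; have E2 := E i2; rewrite !mxE /= in E0 E1 E2.
have be0 : be%:Z != 0 by rewrite gt_eqF // ltz_nat beta_gt0.
have al0 : al%:Z != 0 by rewrite gt_eqF // ltz_nat alpha_gt0.
have zE := mulfI be0 E2; have wE := mulfI al0 E1.
have XE : e * (K %/ d)%N%:Z * b ^+ 2 = e' * (K %/ d')%N%:Z * b' ^+ 2.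
  have -> : e * (K %/ d)%N%:Z * b ^+ 2 = e * ((K %/ d)%N%:Z * b ^+ 2 - ta%:Z * d%:Z * a ^+ 2)
    + ta%:Z * (e * d%:Z * a ^+ 2) by ring.
  by rewrite E0 zE; ring.
have [dd ee0 h] := factor_unique K0 dK d'K ee ee' cab cab' ca ca' zE XE wE.
by split=> //; case: h => [[-> ->]|[-> ->]]; [left|right].
Qed.

Lemma point_opp d e v : point d e (- v.1, - v.2) = point d e v.
Proof. by rewrite /point /= !sqrrN mulrNN. Qed.

Lemma prim_in_opp d v : prim_in (Wset m q K ta d) (- v.1, - v.2) =
  prim_in (Wset m q K ta d) v.
Proof. by rewrite /prim_in /Wset /= coprimeNz coprimezN !abszN !sqrrN. Qed.

End Param.

Lemma coprime_add_mul (n m : nat) (x k : int) : (n %| m)%N ->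
  coprime `|(x + m%:Z * k)%R| n = coprime `|x| n.
Proof.
move=> /dvdnP[c ->]; rewrite -[n]/(`|n%:Z|%N) -!coprimezE ![coprimez _ n%:Z]coprimez_sym.
by rewrite /coprimez addrC PoszM mulrAC gcdzMDl.
Qed.

(** A common multiple of K and of the primes in [orbit_primes]; the factor 2 makes it larger than
    1. *)
Definition modulus (m q k : nat) := (2 * m * q * k)%N.

Lemma modulus_gt1 m q k : (0 < m)%N -> (0 < q)%N -> (0 < k)%N -> (1 < modulus m q k)%N.
Proof.
move=> m0 q0 k0; rewrite /modulus -!mulnA -[X in (X < _)%N]/(1 * 1)%N.
have : (0 < m * (q * k))%N by rewrite !muln_gt0 m0 q0 k0.
by clear; lia.
Qed.

Lemma periodic_Wset m q k t d : (d %| k)%N ->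
  periodic (modulus m q k) (Wset m q k t d).
Proof.
move=> dk x y i j; rewrite /Wset.
have kM : (k %| modulus m q k)%N by rewrite dvdn_mull.
rewrite !coprime_add_mul; last 2 first.
- exact: dvdn_trans dk kM.
- by apply: dvdn_trans kM; apply/dvdnP; exists d; rewrite mulnC divnK.
congr [&& _, _ & _]; apply: eq_in_all => p; rewrite mem_filter mem_primes.
move=> /and4P[_ _ _ pmq].
have pM : (p%:Z %| (modulus m q k)%:Z)%Z.
  by rewrite dvdzE /= /modulus -(mulnA 2) mulnAC dvdn_mull.
set M := (modulus m q k)%:Z in pM *; set c := (k %/ d)%N%:Z; set t' := t%:Z * d%:Z.
have -> : (c * (y + M * j) ^+ 2 - t' * (x + M * i) ^+ 2) ^+ 2 - 1 =
  ((c * y ^+ 2 - t' * x ^+ 2) ^+ 2 - 1) + M * ((c * (2 * y * j + M * j ^+ 2)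
    - t' * (2 * x * i + M * i ^+ 2)) * (2 * (c * y ^+ 2 - t' * x ^+ 2)
    + M * (c * (2 * y * j + M * j ^+ 2) - t' * (2 * x * i + M * i ^+ 2)))) by ring.
by rewrite (rpredDr _ (dvdz_mulr _ pM)).
Qed.

Definition upper_half (v : int * int) : bool := (0 < v.1) || (v.1 == 0) && (0 < v.2).

(** v and -v give the same [point], so one of the two has to be selected. *)
Lemma cnt_half (P : int * int -> Prop) n : (forall v, P (- v.1, - v.2) <-> P v) ->
  ~ P (0, 0) -> cnt P n ->
  exists2 k, cnt (fun v => P v /\ upper_half v) k & n = (k + k)%N.
Proof.
move=> sym P0 cP; have [k ck] := cnt_sub upper_half cP; exists k => //.
have [k' ck'] := cnt_sub (fun v => ~~ upper_half v) cP.
have oppK (v : int * int) : (- - v.1, - - v.2) = v by rewrite !opprK -surjective_pairing.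
have flip v : P v -> upper_half (- v.1, - v.2) = ~~ upper_half v.
  case: v => a b Pv; rewrite /upper_half /= !oppr_gt0 oppr_eq0.
  have : (a, b) <> (0, 0) by move=> ab; apply: P0; rewrite -ab.
  case: (ltrgtP a 0) => [a0|a0|->] //=.
  by case: (ltrgtP b 0) => [b0|b0|->].
have : cnt (fun v => P v /\ ~~ upper_half v) k.
  have inj (v w : int * int) : (- v.1, - v.2) = (- w.1, - w.2) -> v = w.
    by move=> [/oppr_inj h1 /oppr_inj h2]; rewrite (surjective_pairing v) h1 h2 -surjective_pairing.
  apply: eq_cnt (cnt_map (f := fun v : int * int => (- v.1, - v.2)) (fun v w _ _ => inj v w) ck).
  move=> v; split=> [[w [Pw uw] ->]|[Pv uv]].
    by split; [exact/sym|rewrite flip // uw].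
  by exists (- v.1, - v.2); rewrite ?oppK //=; split; [exact/sym|rewrite flip // uv].
move=> /(cnt_inj ck') kk; subst k'.
apply: (cnt_inj cP); have := @cnt_sum bool _ [:: true; false]
  (fun b v => P v /\ (upper_half v == b)) (fun _ => k) isT.
rewrite !big_cons big_nil addn0 => h; apply: eq_cnt (h _ _) => [v|[] _|].
- split=> [[b _ []] //|Pv]; exists (upper_half v) => //.
  by case: (upper_half v).
- by apply: eq_cnt ck => v; rewrite eqb_id.
- by apply: eq_cnt ck' => v; rewrite eqbF_neg.
- by move=> i j v _ _ [_ /eqP <-] [_ /eqP <-].
Qed.

(** * Asymptotics in a frame *)

Section StdCount.
Context {R : realType}.

(** One ellipse for each d; the division by 2 identifies v with -v. *)
Definition leading_constant (rho : nat -> R) (m q k t : nat) (delta : R) : R :=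
  \sum_(d <- divisors k)
    rho (modulus m q k) * (prim_residues (modulus m q k) (Wset m q k t d))%:R / delta / 2.

Definition is_density (m : nat) (r : R) := 0 < r /\
  forall (W : int -> int -> bool) (a b d : R), periodic m W -> 0 < a -> 0 < d ->
  (forall T : R, exists n, cnt (fun v => prim_in W v /\ sqform a b d v <= T) n) /\
  forall e : R, 0 < e -> exists T0, forall T, T0 <= T -> forall n,
    cnt (fun v => prim_in W v /\ sqform a b d v <= T) n ->
    `|n%:R / T - r * (prim_residues m W)%:R / d| < e.

(** A single rho serves all moduli, so that the forms of a genus are compared with the same
    density. *)
Definition is_rho (rho : nat -> R) := forall m : nat, (1 < m)%N -> is_density m (rho m).

Lemma big_max_bound (I : eqType) (r : seq I) (P : I -> R -> Prop) :
  (forall i, i \in r -> exists T0, forall T, T0 <= T -> P i T) ->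
  exists T0, forall T, T0 <= T -> forall i, i \in r -> P i T.
Proof.
elim: r => [|i r IH] h; first by exists 0.
have [|T1 h1] := IH; first by move=> j jr; apply: h; rewrite inE jr orbT.
have [T2 h2] := h i (mem_head _ _).
exists (Num.max T1 T2) => T; rewrite ge_max => /andP[T1T T2T] j; rewrite inE.
by case/predU1P => [->|jr]; [exact: h2|exact: h1].
Qed.

Variables (m q s : nat).
Hypotheses (m0 : (0 < m)%N) (q0 : (0 < q)%N) (s0 : (0 < s)%N).
Hypothesis g : forall p, prime p -> good p (logn p m) (logn p q) (logn p s).
Let be := beta m s.
Let ta := tau m s.
Let K := conic_sqfree m q s.
Let al := alpha m q s.
Variables (rho : nat -> R) (hrho : is_rho rho).
Let delta : R := Num.sqrt q%:R * al%:R.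

Lemma delta_gt0 : 0 < delta.
Proof. by rewrite mulr_gt0 ?sqrtr_gt0 ?ltr0n // alpha_gt0. Qed.

Variables (Y0 Y1 Y2 : R).
(** The condition S^*(y) = 4 D in frame coordinates. *)
Hypothesis hY : 2 * q%:R * m%:R * Y0 * Y2 - q%:R * s%:R * Y0 ^+ 2 - m%:R ^+ 2 * Y1 ^+ 2
  = 4 * (m%:R ^+ 2 * q%:R).

Definition pairing (u : 'rV[int]_3) : R :=
  (u ord0 i0)%:~R * Y0 + (u ord0 i1)%:~R * Y1 + (u ord0 i2)%:~R * Y2.

(** The left side is 4 A C - B^2 for the binary form A a^2 + B a b + C b^2 defined by y; the factors
    d of A and K / d of C multiply to K. *)
Lemma disc_eq : 4 * K%:R * Y0 * (be%:R * Y2 - ta%:R * Y0) - al%:R ^+ 2 * Y1 ^+ 2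
  = 4 * delta ^+ 2.
Proof.
have mR : m%:R != 0 :> R by rewrite pnatr_eq0 -lt0n.
have sb : s%:R * be%:R = 2 * m%:R * ta%:R :> R by rewrite -!natrM sbeta.
have qa : q%:R * al%:R ^+ 2 = 2 * m%:R * be%:R * K%:R :> R.
  by rewrite -natrX -!natrM qalpha2.
apply: (mulfI (expf_neq0 2 mR)).
have -> : delta ^+ 2 = q%:R * al%:R ^+ 2 by rewrite exprMn sqr_sqrtr // ler0n.
have -> : m%:R ^+ 2 * (4 * (q%:R * al%:R ^+ 2)) = al%:R ^+ 2 * (4 * (m%:R ^+ 2 * q%:R)) :> R.
  by ring.
rewrite -hY.
have -> : m%:R ^+ 2 * (4 * K%:R * Y0 * (be%:R * Y2 - ta%:R * Y0) - al%:R ^+ 2 * Y1 ^+ 2) =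
   (2 * m%:R * be%:R * K%:R) * (2 * m%:R * Y0 * Y2)
   - 2 * m%:R * K%:R * (2 * m%:R * ta%:R) * Y0 ^+ 2
   - m%:R ^+ 2 * al%:R ^+ 2 * Y1 ^+ 2 :> R by ring.
rewrite -sb.
have -> : 2 * m%:R * K%:R * (s%:R * be%:R) * Y0 ^+ 2 =
   (2 * m%:R * be%:R * K%:R) * s%:R * Y0 ^+ 2 :> R by ring.
by rewrite -qa; ring.
Qed.

(** Were Y0 zero, [disc_eq] would equate a nonpositive number with a positive one. *)
Lemma sign_exists : exists e : int, e * e = 1 /\ 0 < e%:~R * Y0.
Proof.
have [Y0p|Y0n|Y00] := ltrgtP 0 Y0.
- by exists 1; split; [|rewrite mulr1z mul1r].
- by exists (-1); split; [|rewrite mulrN1z mulN1r oppr_gt0].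
have := disc_eq; rewrite -Y00 mulr0 mul0r add0r => h.
have := exprn_gt0 2 delta_gt0; have := sqr_ge0 (al%:R * Y1); rewrite exprMn; lra.
Qed.

(** C > 0 by the choice of e, and then A > 0 because 4 A C = B^2 + 4 delta^2. The sign of the
    pairing is thus e' e, and a positive pairing means e' = e. *)
Lemma form_param (e : int) : e * e = 1 -> 0 < e%:~R * Y0 ->
  forall d, (d %| K)%N -> exists ab : R * R, 0 < ab.1 /\
    forall e' v, pairing (point m q s d e' v) = (e' * e)%:~R * sqform ab.1 ab.2 delta v.
Proof.
move=> ee eY d dK; have K0 : (0 < K)%N := kappa_gt0 s m0 q0.
have d0 : 0 < d%:R :> R by rewrite ltr0n (dvdn_gt0 K0 dK).
have kd0 : 0 < (K %/ d)%N%:R :> R.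
  have dp : (0 < d)%N := dvdn_gt0 K0 dK.
  by rewrite ltr0n divn_gt0 // dvdn_leq.
have kd : (K %/ d)%N%:R * d%:R = K%:R :> R by rewrite -natrM divnK.
have eeR : e%:~R * e%:~R = 1 :> R by rewrite -intrM ee.
pose E : R := e%:~R.
pose A := E * d%:R * (be%:R * Y2 - ta%:R * Y0).
pose C := E * (K %/ d)%N%:R * Y0.
pose B := E * al%:R * Y1.
have disc : 4 * A * C - B ^+ 2 = 4 * delta ^+ 2.
  rewrite -disc_eq /A /B /C -kd.
  have -> : 4 * (E * d%:R * (be%:R * Y2 - ta%:R * Y0)) * (E * (K %/ d)%N%:R * Y0) =
     (E * E) * (4 * ((K %/ d)%N%:R * d%:R) * Y0 * (be%:R * Y2 - ta%:R * Y0)) :> R by ring.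
  have -> : (E * al%:R * Y1) ^+ 2 = (E * E) * (al%:R ^+ 2 * Y1 ^+ 2) :> R by ring.
  by rewrite /E eeR !mul1r.
have C0 : 0 < C by rewrite /C mulrAC mulr_gt0.
have del0 := delta_gt0.
have A0 : 0 < A.
  have : 0 < A * C.
    have := exprn_gt0 2 del0; have := sqr_ge0 B; lra.
  by rewrite pmulr_lgt0.
have sA : 0 < Num.sqrt A by rewrite sqrtr_gt0.
exists (Num.sqrt A, B / (2 * Num.sqrt A)); split=> //= e' [a b].
have -> : sqform (Num.sqrt A) (B / (2 * Num.sqrt A)) delta (a, b) =
    A * a%:~R ^+ 2 + B * a%:~R * b%:~R + C * b%:~R ^+ 2.
  have CE : C = (B ^+ 2 / 4 + delta ^+ 2) / A.
    apply: (mulIf (lt0r_neq0 A0)); rewrite mulfVK ?lt0r_neq0 //; lra.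
  rewrite CE; move: (sqr_sqrtr (ltW A0)) sA; set r := Num.sqrt A => <- r0.
  by rewrite /sqform /=; field; rewrite gt_eqF.
have -> : (e' * e)%:~R * (A * a%:~R ^+ 2 + B * a%:~R * b%:~R + C * b%:~R ^+ 2) =
    e'%:~R * (E * E) * (d%:R * (be%:R * Y2 - ta%:R * Y0) * a%:~R ^+ 2
      + al%:R * Y1 * a%:~R * b%:~R + (K %/ d)%N%:R * Y0 * b%:~R ^+ 2) :> R.
  by rewrite intrM -/E /A /B /C; ring.
rewrite /E eeR mulr1 /pairing /point !mxE /= -/be -/ta -/K -/al.
rewrite !(intrM, intrD, intrN, rmorphXn) /= -!pmulrn; ring.
Qed.

Theorem std_count :
  let P T u := std_orbit m q s u /\ 0 < pairing u /\ pairing u <= T in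
  (forall T : R, exists n, cnt (P T) n) /\
  forall e : R, 0 < e -> exists T0, forall T, T0 <= T -> forall n, cnt (P T) n ->
    `|n%:R / T - leading_constant rho m q K ta delta| < e.
Proof.
move=> P; have K0 : (0 < K)%N := kappa_gt0 s m0 q0.
have M1 := modulus_gt1 m0 q0 K0.
have [e [ee eY]] := sign_exists.
have inr d : d \in divisors K -> (d %| K)%N by rewrite dvdn_divisors.
have [|ab abP] := @choice_in _ _ (divisors K) (fun d (ab : R * R) => 0 < ab.1 /\
    forall e' v, pairing (point m q s d e' v) = (e' * e)%:~R * sqform ab.1 ab.2 delta v) (0, 0).
  by move=> d /inr; apply: form_param.
pose S d T v := prim_in (Wset m q K ta d) v /\ sqform (ab d).1 (ab d).2 delta v <= T.
have [rho0 hr] := hrho M1.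
have Sprop d : d \in divisors K -> _ := fun dr =>
  hr (Wset m q K ta d) (ab d).1 (ab d).2 delta
    (@periodic_Wset m q K ta d (inr d dr)) (abP d dr).1 delta_gt0.
have prim0 d : ~~ prim_in (Wset m q K ta d) (0, 0) by [].
have pos d v : d \in divisors K -> prim_in (Wset m q K ta d) v ->
    0 < sqform (ab d).1 (ab d).2 delta v.
  move=> dr pv; have [l l0 lP] := @sqform_min R _ (ab d).2 _ (abP d dr).1 delta_gt0.
  apply: lt_le_trans l0 (lP _ _); apply: contraTneq pv => ->; exact: prim0.
have half T d n : d \in divisors K -> cnt (S d T) n ->
    exists2 k, cnt (fun v => S d T v /\ upper_half v) k & n = (k + k)%N.
  move=> dr; apply: cnt_half => [v|[]]; last by rewrite (negbTE (prim0 d)).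
  have sqN : sqform (ab d).1 (ab d).2 delta (- v.1, - v.2) =
      sqform (ab d).1 (ab d).2 delta v by rewrite /sqform /= !intrN; ring.
  by rewrite /S prim_in_opp sqN.
have total T k : (forall d, d \in divisors K ->
      cnt (fun v => S d T v /\ upper_half v) (k d)) ->
    cnt (P T) (\sum_(d <- divisors K) k d)%N.
  move=> hk.
  apply: eq_cnt (@cnt_sum _ _ _ (fun d u =>
    exists2 v, (S d T v /\ upper_half v) & u = point m q s d e v) k (divisors_uniq K) _ _).
  - move=> u; split=> [[d dr [v [[pv vT] _] ->]]|[uO [u0 uT]]].
      have [_ pE] := abP d dr.
      have E : pairing (point m q s d e v) = sqform (ab d).1 (ab d).2 delta v.
        by rewrite pE ee mul1r.
      rewrite /P E; split; last by split=> //; exact: pos.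
      by apply/(std_orbitP m0 q0 s0 g); exists d, e, v; split=> //; exact: inr.
    have [d [e' [v [dK ee' pv uE]]]] := (std_orbitP m0 q0 s0 g u).1 uO.
    have dr : d \in divisors K by rewrite -dvdn_divisors.
    have [_ pE] := abP d dr; rewrite uE pE in u0 uT.
    have pv0 := pos d v dr pv.
    have e'e : e' = e.
      move: u0; rewrite pmulr_lgt0 // ltr0z.
      have sg (x : int) : x * x = 1 -> x = 1 \/ x = -1.
        by move=> xx; apply: sqr_eq_sign; rewrite expr1n expr2.
      by case: (sg _ ee) => ->; case: (sg _ ee') => ->.
    rewrite e'e ee mul1r in uT; subst e'.
    exists d => //; have [hv|hv] := boolP (upper_half v); first by exists v.
    exists (- v.1, - v.2); last by rewrite point_opp.
    split; first split.
    + by rewrite prim_in_opp.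
    + rewrite (_ : sqform _ _ _ _ = sqform (ab d).1 (ab d).2 delta v) //.
      by rewrite /sqform /= !intrN; ring.
    + have : v <> (0, 0) by move=> v0; move: (prim0 d); rewrite -v0 pv.
      move: hv; rewrite /upper_half; case: v {uE pv pv0 uT u0} => x y /=.
      rewrite !oppr_gt0 oppr_eq0; case: (ltrgtP x 0) => [x0|x0|->] //=.
      by case: (ltrgtP y 0) => [y0|y0|->].
  - move=> d dr; apply: cnt_map (hk d dr) => v w [[pv _] hv] [[pw _] hw] pE.
    have [_ _ [//|vw]] := point_inj m0 q0 s0 g (inr d dr) (inr d dr) ee ee pv pw pE.
    move: hv hw; rewrite vw /upper_half /= !oppr_gt0 oppr_eq0.
    case: (ltrgtP w.1 0) => //= w1; case: (ltrgtP w.2 0) => // w2 _ _.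
  move=> d d' u dr d'r [v [[pv _] _] uE] [v' [[pv' _] _] uE'].
  rewrite uE in uE'.
  by have [] := point_inj m0 q0 s0 g (inr d dr) (inr d' d'r) ee ee pv pv' uE'.
have count T : exists n k : nat -> nat, [/\ forall d, d \in divisors K -> cnt (S d T) (n d),
    forall d, n d = (k d + k d)%N & cnt (P T) (\sum_(d <- divisors K) k d)%N].
  have [|k kP] := @choice_in _ nat (divisors K)
    (fun d k => cnt (S d T) (k + k)%N /\ cnt (fun v => S d T v /\ upper_half v) k) 0%N.
    move=> d dr; have [n cn] := (Sprop d dr).1 T.
    by have [k ck nk] := half T d n dr cn; exists k; rewrite -nk.
  exists (fun d => (k d + k d)%N), k; split=> // [d /kP[]//|].
  by apply: total => d /kP[].
split=> [T|eps eps0]; first by have [n [k [_ _ cP]]] := count T; eexists; exact: cP.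
pose N : R := (size (divisors K))%:R; have N0 : 0 <= N by rewrite ler0n.
have eps1 : 0 < eps / (N + 1) by rewrite divr_gt0 //; lra.
have [|T0 hT0] := @big_max_bound _ (divisors K) (fun d T => forall n, cnt (S d T) n ->
    `|n%:R / T - rho (modulus m q K) * (prim_residues (modulus m q K) (Wset m q K ta d))%:R
      / delta| < eps / (N + 1)).
  by move=> d dr; apply: (Sprop d dr).2.
exists T0 => T TT n cn; have [n' [k [cS nk cP]]] := count T.
rewrite (cnt_inj cn cP) natr_sum mulr_suml /leading_constant -sumrB.
apply: le_lt_trans (ler_norm_sum _ _ _) _.
apply: (@le_lt_trans _ _ (\sum_(d <- divisors K) (eps / (N + 1)))).
  rewrite big_seq [leRHS]big_seq; apply: ler_sum => d dr.
  have := hT0 T TT d dr _ (cS d dr); rewrite nk natrD.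
  set L := rho _ * _ / _ => h.
  have -> : (k d)%:R / T - L / 2 = ((k d)%:R + (k d)%:R) / T / 2 - L / 2.
    by rewrite [in RHS]mulrDl; lra.
  have h2 : 0 <= 2^-1 :> R by rewrite invr_ge0.
  rewrite -mulrBl normrM (ger0_norm h2).
  by have := normr_ge0 (((k d)%:R + (k d)%:R) / T - L); lra.
rewrite big_const_seq count_predT iter_addr_0 -mulr_natl -/N mulrA.
rewrite ltr_pdivrMr; last by lra.
by rewrite mulrC ltr_pM2l //; lra.
Qed.

End StdCount.

(** * From frames back to special forms *)

Section Transfer.
Context {R : realType}.

Lemma rho_exists : exists rho : nat -> R, is_rho rho.
Proof.
have [m|rho h] := @choice nat R (fun m r => (1 < m)%N -> is_density m r); last by exists rho.
have [m1|m1] := ltnP 1 m; last by exists 0.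
by have [r r0 h] := @cnt_primitive R m m1; exists r.
Qed.

Definition frame_constant (rho : nat -> R) (m q s : nat) : R :=
  leading_constant rho m q (conic_sqfree m q s) (tau m s) (Num.sqrt q%:R * (alpha m q s)%:R).

(** The term d = K is positive, because the residue class of (0, 1) meets all its conditions. *)
Lemma frame_constant_gt0 rho m q s : is_rho rho -> (0 < m)%N -> (0 < q)%N -> (0 < s)%N ->
  (forall p, prime p -> good p (logn p m) (logn p q) (logn p s)) ->
  0 < frame_constant rho m q s.
Proof.
move=> hrho m0 q0 s0 g; rewrite /frame_constant /leading_constant.
have K0 := kappa_gt0 s m0 q0; set K := conic_sqfree m q s in K0 *.
have M1 := modulus_gt1 m0 q0 K0; have [r0 _] := hrho _ M1.
have del0 : 0 < Num.sqrt q%:R * (alpha m q s)%:R :> R.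
  by rewrite mulr_gt0 ?sqrtr_gt0 ?ltr0n // alpha_gt0.
have Kd : K \in divisors K by rewrite -dvdn_divisors.
rewrite (big_rem K) //=; apply: ltr_wpDr.
  apply: sumr_ge0 => d _; apply: divr_ge0 => //; apply: divr_ge0; last exact: ltW.
  by apply: mulr_ge0 => //; exact: ltW.
apply: divr_gt0 => //; apply: divr_gt0 => //; apply: mulr_gt0 => //.
rewrite ltr0n /prim_residues /nres /residues size_filter -has_count.
apply/hasP; exists (0, 1) => /=.
  apply/allpairsP; exists (0, 1)%N; rewrite !mem_iota /= add0n M1 (ltnW M1) //.
rewrite /Wset divnn K0 /= coprime1n /=.
apply/andP; split; first by apply/allP => p _; rewrite expr0n mulr0 subr0 !expr1n subrr dvdz0.
apply/allP => p; rewrite mem_primes => /andP[pp _].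
by rewrite /not_both dvdz0 /= dvdz1 /=; case: p pp => [|[]].
Qed.

Section OneForm.
Variables (S : 'M[int]_3) (x : 'rV[int]_3) (B : 'M[int]_3) (m q s : nat).
Hypotheses (sS : special S) (xC : in_cone S x) (fB : frame S x B m q s).
Variable y : 'rV[R]_3.
Hypothesis hy : qformR (Sstar S) y = 4 * (Ddet S)%:~R.

Let intR : int -> R := fun z => z%:~R.
Let Y := y *m map_mx intR B.

Lemma pairR_frame u : pairR (u *m B^T) y =
  pairing (Y ord0 i0) (Y ord0 i1) (Y ord0 i2) u.
Proof.
rewrite /pairR /pairing sum_I3 !mxE !sum_I3 !mxE /intR !(intrD, intrM) /=; ring.
Qed.

Lemma frame_disc : 2 * q%:R * m%:R * Y ord0 i0 * Y ord0 i2
    - q%:R * s%:R * Y ord0 i0 ^+ 2 - m%:R ^+ 2 * Y ord0 i1 ^+ 2 = 4 * (m%:R ^+ 2 * q%:R).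
Proof.
have [uB _ BS [m0 q0 s0 D _]] := fB.
have [[Ss _ _ D0] _] := sS.
have DE : \det S = (m ^ 2 * q)%N%:Z by rewrite -D gez0_abs // ltW.
have aS : Sstar S = B *m \adj (Std m q s) *m B^T.
  rewrite -BS adj_unit ?gt_eqF // !mulmxA mulmxV // mul1mx -mulmxA mulVmx ?mulmx1 //.
  by rewrite unitmx_tr.
move: hy; rewrite /Ddet DE /qformR aS !map_mxM -map_trmx.
rewrite !mulmxA -[y *m map_mx _ B]/Y -[_ *m y^T]mulmxA -trmx_mul -/Y.
rewrite /Std /rform adj_mx3 => h.
have -> : 4 * (m%:R ^+ 2 * q%:R) = 4 * ((m ^ 2 * q)%N%:Z)%:~R :> R.
  by rewrite -natrX -natrM.
rewrite -h; move: (Y) => Z {h}.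
rewrite !mxE !sum_I3 !mxE !sum_I3 !mxE /= /intR !(intrD, intrM, intrN) /=; ring.
Qed.

Lemma orbit_count (rho : nat -> R) : is_rho rho ->
  let P (T : R) (x' : 'rV[int]_3) :=
    in_Sorbit S x x' /\ 0 < pairR x' y /\ pairR x' y <= T in
  (forall T : R, exists n : nat, has_card (P T) n) /\
  (forall eps : R, 0 < eps -> exists T0 : R, forall T : R, T0 <= T ->
    forall n : nat, has_card (P T) n -> `| n%:R / T - frame_constant rho m q s | < eps).
Proof.
move=> hrho P; have [uB _ BS [m0 q0 s0 D g]] := fB.
have uBt : B^T \in unitmx by rewrite unitmx_tr.
have [fin lim] := std_count m0 q0 s0 g hrho frame_disc.
pose Q T u := std_orbit m q s u /\ 0 < pairing (Y ord0 i0) (Y ord0 i1) (Y ord0 i2) u /\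
  pairing (Y ord0 i0) (Y ord0 i1) (Y ord0 i2) u <= T.
have QP T u : Q T u <-> P T (u *m B^T).
  rewrite /Q /P pairR_frame.
  suff : std_orbit m q s u <-> in_Sorbit S x (u *m B^T) by move=> ->.
  rewrite (orbitP u sS xC fB) /std_orbit /in_cone.
  have -> : qform S (u *m B^T) = qform (Std m q s) u.
    by rewrite -BS /qform trmx_mul trmxK !mulmxA.
  have pE : primitive_vec u <-> primitive_vec (u *m B^T).
    split; first exact: primitive_unit.
    move=> /(@primitive_unit _ (invmx B^T)); rewrite mulmxK // unitmx_inv.
    exact.
  by split=> [[/pE h1 h2 h3]|[[/pE h1 h2] h3]]; split.
have QPc T n : cnt (Q T) n -> cnt (P T) n.
  move=> /(cnt_map (f := fun u => u *m B^T)) h.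
  apply: eq_cnt (h _) => [x'|u v _ _ e]; last by rewrite -(mulmxK uBt u) e mulmxK.
  split=> [[u uQ ->]|x'P]; first exact/QP.
  by exists (x' *m invmx B^T); [apply/QP|]; rewrite mulmxKV.
split=> [T|eps e0].
  by have [n cn] := fin T; exists n; exact: QPc.
have [T0 hT0] := lim eps e0; exists T0 => T TT n cn.
have [n' cn'] := fin T.
have <- : n' = n by apply: cnt_inj (QPc _ _ cn') cn.
exact: hT0.
Qed.

End OneForm.
End Transfer.

(** * Invariance in the genus *)

Lemma dvdz_det_congr (n : int) (X Y : 'M[int]_3) :
  (forall i j, n %| X i j - Y i j)%Z -> (n %| \det X - \det Y)%Z.
Proof.
move=> h; rewrite (mx3P X) (mx3P Y) !det_mx3.
have cM a b c d : (n %| a - b -> n %| c - d -> n %| a * c - b * d)%Z.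
  move=> h1 h2; have -> : a * c - b * d = (a - b) * c + b * (c - d) by ring.
  by rewrite rpredD // ?(dvdz_mulr _ h1) ?(dvdz_mull _ h2).
have cB a b c d : (n %| a - b -> n %| c - d -> n %| (a - c) - (b - d))%Z.
  move=> h1 h2; have -> : (a - c) - (b - d) = (a - b) - (c - d) by ring.
  by rewrite rpredB.
have cD a b c d : (n %| a - b -> n %| c - d -> n %| (a + c) - (b + d))%Z.
  move=> h1 h2; have -> : (a + c) - (b + d) = (a - b) + (c - d) by ring.
  by rewrite rpredD.
by apply: (cD); first apply: (cB); apply: (cM) => //; apply: (cB); apply: (cM).
Qed.

(** Coherence makes all reductions agree modulo p with the first one, so their determinants are
    prime to p as well. *)
Lemma padic_congruent p S S' k : prime p -> (0 < k)%N -> padic_equiv p S S' ->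
  exists2 A, ~~ (p%:Z %| \det A)%Z & congruent_mod (p ^ k) A S S'.
Proof.
move=> pp k0 [A [cohA dA eA]]; exists (A k).
  have step l : (0 < l)%N -> forall i j, (p%:Z %| A l i j - A 1%N i j)%Z.
    case: l => // l _; elim: l => [|l IH] i j; first by rewrite subrr dvdz0.
    have -> : A l.+2 i j - A 1%N i j = (A l.+2 i j - A l.+1 i j) + (A l.+1 i j - A 1%N i j).
      by ring.
    apply: rpredD; last exact: IH.
    have := cohA l.+1 i j; rewrite eqz_mod_dvd; apply: dvdz_trans.
    by rewrite dvdzE /= dvdn_exp.
  apply: contra dA => dk; have := dvdz_det_congr (step k k0) => h.
  by rewrite -(rpredBl _ dk).
pose E : 'M[int]_3 := \matrix_(i, j) (((A k)^T *m S *m A k - S') i j %/ (p ^ k)%N%:Z)%Z.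
exists E; apply/matrixP => i j.
have := eA k i j; rewrite eqz_mod_dvd => /dvdzP[c cE].
have pk : (p ^ k)%N%:Z != 0 by rewrite gt_eqF // ltz_nat expn_gt0 prime_gt0.
rewrite [RHS]mxE [((p ^ k)%N%:Z *: E) i j]mxE [E i j]mxE.
have -> : ((A k)^T *m S *m A k - S') i j = c * (p ^ k)%N%:Z by rewrite -cE !mxE.
by rewrite mulzK // mulrC -cE addrC subrK.
Qed.

Lemma congruent_det_dvd n A S S' : congruent_mod n A S S' ->
  (n%:Z %| \det A ^+ 2 * \det S - \det S')%Z.
Proof.
move=> [E AE].
have -> : \det A ^+ 2 * \det S = \det (A^T *m S *m A).
  by rewrite !det_mulmx det_tr; ring.
apply: dvdz_det_congr => i j; by rewrite AE !mxE addrAC subrr add0r dvdz_mulr.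
Qed.

(** Modulo p^v the two determinants differ by the square of a unit, so p^v divides both or neither,
    for every v. *)
Lemma genus_det (R : realType) S S' : 0 < \det S -> 0 < \det S' ->
  same_genus R S S' -> `|\det S|%N = `|\det S'|%N.
Proof.
move=> D0 D0' [loc _].
have a0 : (0 < `|\det S|)%N by rewrite absz_gt0 gt_eqF.
have a0' : (0 < `|\det S'|)%N by rewrite absz_gt0 gt_eqF.
apply: eqn_from_log => // p; have [pp|npp] := boolP (prime p); last first.
  have z n : logn p n = 0%N by rewrite lognE (negbTE npp).
  by rewrite !z.
have eqv v : (v <= logn p `|\det S|)%N = (v <= logn p `|\det S'|)%N.
  case: v => // v; rewrite -!dvdz_logn ?gt_eqF //.
  have [A dA /congruent_det_dvd cA] := @padic_congruent p S S' v.+1 pp isT (loc p pp).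
  have cop : coprimez (p ^ v.+1)%N%:Z (\det A ^+ 2).
    by rewrite coprimezXr // coprimezE /= coprimeXl // prime_coprime.
  apply/idP/idP => h.
    by rewrite -(rpredBl _ (dvdz_mull (\det A ^+ 2) h)).
  by rewrite (rpredBr _ h) Gauss_dvdzr in cA.
by apply/eqP; rewrite eqn_leq -eqv leqnn eqv leqnn.
Qed.

Lemma frame_congruent n S S' x x' B B' m q s m' q' s' A :
  frame S x B m q s -> frame S' x' B' m' q' s' -> congruent_mod n A S S' ->
  congruent_mod n (invmx B *m (A *m B')) (Std m q s) (Std m' q' s').
Proof.
move=> [uB _ BS _] [uB' _ BS' _] [E AE].
have eS : (invmx B)^T *m Std m q s *m invmx B = S.
  by rewrite -BS -congruence_mulmx mulmxV // trmx1 mul1mx mulmx1.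
exists (B'^T *m E *m B').
by rewrite congruence_mulmx eS congruence_mulmx AE mulmxDr mulmxDl BS' -scalemxAr -scalemxAl.
Qed.

Lemma frame_congruent_det p (B B' A : 'M[int]_3) : prime p ->
  B \in unitmx -> B' \in unitmx -> ~~ (p%:Z %| \det A)%Z ->
  ~~ (p%:Z %| \det (invmx B *m (A *m B')))%Z.
Proof.
move=> pp uB uB' dA; rewrite !det_mulmx !Euclid_dvdzM // !negb_or.
have u C : C \in unitmx -> ~~ (p%:Z %| \det C)%Z.
  rewrite unitmxE => /orP[] /eqP -> /=; rewrite ?dvdzN dvdzE /=;
    by rewrite dvdn1 gtn_eqF ?prime_gt1.
by rewrite u ?unitmx_inv // dA u.
Qed.

Lemma crt_primes (ps : seq nat) (f : nat -> int) : uniq ps -> all prime ps ->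
  exists u : int, forall p : nat, p \in ps -> (p%:Z %| u - f p)%Z.
Proof.
elim: ps => [|p ps IH] /=; first by exists 0.
move=> /andP[nps ups] /andP[pp aps]; have [u uP] := IH ups aps.
have [a [b ab]] := Bezoutz p%:Z (\prod_(r <- ps) r)%N%:Z.
have := coprime_prod_primes pp aps nps.
rewrite -[coprime _ _]/(coprimez p%:Z (\prod_(r <- ps) r)%N%:Z) => /eqP c1.
rewrite c1 in ab; set P := (\prod_(r <- ps) r)%N%:Z in ab.
exists (f p * (b * P) + u * (a * p%:Z)) => r; rewrite inE => /predU1P[->|rps].
  have -> : f p * (b * P) + u * (a * p%:Z) - f p =
    (u - f p) * a * p%:Z + f p * (a * p%:Z + b * P - 1) by ring.
  by rewrite ab subrr mulr0 addr0 dvdz_mull.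
have rP : (r%:Z %| P)%Z by rewrite dvdzE /= (big_rem r) //= dvdn_mulr.
have -> : f p * (b * P) + u * (a * p%:Z) - f r =
  (u - f r) + (f p - u) * b * P + u * (a * p%:Z + b * P - 1) by ring.
by rewrite ab subrr mulr0 addr0 rpredD ?uP // dvdz_mull.
Qed.

(** Hence the exponent of p in gcd(m, s) depends only on m and q. *)
Lemma good_min p i j t : good p i j t ->
  minn i t = (if 2 < 2 * i + j then i.-1 else i)%N.
Proof.
by case=> [[-> -> _]|[-> -> h]|[[-> ->]|[-> -> ->]|[[-> -> ->]|[-> -> ->]]]] //=;
  rewrite ?min0n //; apply/minn_idPl.
Qed.

Lemma minn_logn_congr p k (s s' : nat) : prime p -> (0 < s)%N -> (0 < s')%N ->
  ((p ^ k)%N%:Z %| s%:Z - s'%:Z)%Z -> minn k (logn p s) = minn k (logn p s').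
Proof.
have half (t t' : nat) : prime p -> (0 < t)%N -> (0 < t')%N ->
    ((p ^ k)%N%:Z %| t%:Z - t'%:Z)%Z -> (minn k (logn p t) <= minn k (logn p t'))%N.
  move=> pp t0 t'0 h; rewrite leq_min geq_minl /= -pfactor_dvdn //.
  set e := minn _ _.
  have e1 : ((p ^ e)%N%:Z %| t%:Z)%Z by rewrite dvdzE /= pfactor_dvdn // geq_minr.
  have e2 : ((p ^ e)%N%:Z %| t%:Z - t'%:Z)%Z.
    by apply: dvdz_trans h; rewrite dvdzE /= dvdn_exp2l // geq_minl.
  by have := e2; rewrite (rpredBl _ e1).
move=> pp s0 s'0 h; apply/eqP; rewrite eqn_leq !half //.
by rewrite -opprB dvdzN.
Qed.

(** Multiplication of the first coordinate by a unit is injective on residues; exchanging u with its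
    inverse will give the reverse inequality. *)
Lemma nres_scale_le (M : nat) (V V' : int -> int -> bool) (u u' : int) : (0 < M)%N ->
  periodic M V' -> (M%:Z %| u * u' - 1)%Z -> (forall a b, V a b -> V' (u * a) b) ->
  (nres M V <= nres M V')%N.
Proof.
move=> M0 pV' uu' VV'; have M0z : M%:Z != 0 by rewrite eqz_nat -lt0n.
pose f (v : int * int) := ((u * v.1 %% M%:Z)%Z, v.2).
have resP (W : int -> int -> bool) v : reflect (exists i j : nat, [/\ (i < M)%N, (j < M)%N, v = (i%:Z, j%:Z) & W i%:Z j%:Z])
    (v \in residues M W).
  apply: (iffP idP).
    rewrite mem_filter => /andP[Wv /allpairsP[[i j]]] /=.
    rewrite !mem_iota => -[/= i1 j1 E]; exists i, j; rewrite E in Wv *.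
    by split.
  move=> [i [j [iM jM -> Wij]]]; rewrite mem_filter Wij /=.
  by apply/allpairsP; exists (i, j); rewrite !mem_iota.
have uniqres (W : int -> int -> bool) : uniq (residues M W).
  rewrite filter_uniq // allpairs_uniq ?iota_uniq //.
  by move=> [i j] [i' j'] _ _ /= [-> ->].
rewrite /nres -(size_map f); apply: uniq_leq_size.
  rewrite map_inj_in_uniq // => v w /resP[i [j [iM jM -> _]]] /resP[i' [j' [iM' jM' -> _]]].
  move=> [/= /eqP E ->]; congr pair.
  have {}E : (M%:Z %| i%:Z - i'%:Z)%Z.
    rewrite eqz_mod_dvd in E.
    have -> : i%:Z - i'%:Z = (u * i%:Z - u * i'%:Z) * u' - (u * u' - 1) * (i%:Z - i'%:Z).
      by ring.
    by rewrite rpredB // dvdz_mulr.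
  by move: E; rewrite -eqz_mod_dvd !modz_nat eqz_nat !modn_small // => /eqP->.
move=> _ /mapP[v /resP[i [j [iM jM -> Wij]]] ->]; apply/resP.
have r0 := modz_ge0 (u * i%:Z) M0z; have r1 : (u * i%:Z %% M%:Z)%Z < M%:Z.
  by rewrite ltz_pmod // ltz_nat.
exists `|(u * i%:Z %% M%:Z)%Z|%N, j.
rewrite /f /= gez0_abs //; split=> //; first by rewrite -ltz_nat gez0_abs.
have := VV' _ _ Wij; rewrite -(pV' (u * i%:Z %% M%:Z)%Z j%:Z (u * i%:Z %/ M%:Z)%Z 0) mulr0 addr0.
by rewrite [M%:Z * _]mulrC addrC -divz_eq.
Qed.

Lemma nres_scale (M : nat) (V V' : int -> int -> bool) (u u' : int) : (0 < M)%N ->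
  periodic M V -> periodic M V' -> (M%:Z %| u * u' - 1)%Z ->
  (forall a b, V a b = V' (u * a) b) -> nres M V = nres M V'.
Proof.
move=> M0 pV pV' uu' VV'; apply/eqP; rewrite eqn_leq.
rewrite (@nres_scale_le _ _ _ u u') //=; last by move=> a b; rewrite VV'.
apply: (@nres_scale_le _ _ _ u' u) => // [|a b]; first by rewrite mulrC.
rewrite VV' mulrA; case/dvdzP: uu' => c cE.
have -> : u * u' * a = a + M%:Z * (c * a) by rewrite -(subrK 1 (u * u')) cE; ring.
by rewrite -(pV' a b (c * a) 0) mulr0 addr0.
Qed.

(* The bijection of residue classes is (a, b) |-> (u a, b). *)
Lemma prim_residues_Wset (m q K d t t' : nat) (u : int) :
  (0 < m)%N -> (0 < q)%N -> (0 < K)%N -> (d %| K)%N ->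
  (forall p, p \in primes (modulus m q K) -> ~~ (p%:Z %| u)%Z) ->
  (forall p, orbit_prime m q p -> (p%:Z %| t%:Z - t'%:Z * u ^+ 2)%Z) ->
  prim_residues (modulus m q K) (Wset m q K t d)
  = prim_residues (modulus m q K) (Wset m q K t' d).
Proof.
move=> m0 q0 K0 dK nu tt'; set M := modulus m q K.
have M0 : (0 < M)%N := ltnW (modulus_gt1 m0 q0 K0).
have cu : coprimez u M%:Z.
  apply/coprimez_primeP => p pp; apply/negP => /andP[pu pM].
  by have := nu p; rewrite mem_primes pp M0 => /(_ pM); rewrite pu.
have [u' uu'] : exists u', (M%:Z %| u * u' - 1)%Z.
  have [a [b ab]] := Bezoutz u M%:Z; exists a.
  rewrite (eqP cu) in ab; have -> : u * a - 1 = - b * M%:Z.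
    by apply: (eq_from_sub ab); ring.
  by rewrite dvdz_mull.
apply: (nres_scale M0 _ _ uu').
- by apply: periodic_and; [exact: periodic_Wset|exact: periodic_primes].
- by apply: periodic_and; [exact: periodic_Wset|exact: periodic_primes].
move=> a b; congr andb; last first.
  apply: eq_in_all => p pM; have pp : prime p by move: pM; rewrite mem_primes => /andP[].
  by rewrite /not_both Euclid_dvdzM // (negbTE (nu p pM)).
rewrite /Wset; congr [&& _, _ & _].
  rewrite abszM coprimeMl.
  have -> // : coprime `|u| (K %/ d).
  have : coprime `|u| M by [].
  apply: coprime_dvdr; apply: (@dvdn_trans K); last by rewrite dvdn_mull.
  by apply/dvdnP; exists d; rewrite mulnC divnK.
apply: eq_in_all => p; rewrite mem_filter => /andP[op _].
set c := (K %/ d)%N%:Z; set D := d%:Z.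
have -> : (c * b ^+ 2 - t%:Z * D * a ^+ 2) ^+ 2 - 1 =
  ((c * b ^+ 2 - t'%:Z * D * (u * a) ^+ 2) ^+ 2 - 1)
  + (t%:Z - t'%:Z * u ^+ 2) * (- D * a ^+ 2 * (2 * c * b ^+ 2 - t%:Z * D * a ^+ 2
     - t'%:Z * D * (u * a) ^+ 2)) by ring.
by rewrite (rpredDr _ (dvdz_mulr _ (tt' p op))).
Qed.

Section Genus.
Variables m q s s' : nat.
Hypotheses (m0 : (0 < m)%N) (q0 : (0 < q)%N) (s0 : (0 < s)%N) (s'0 : (0 < s')%N).
Hypothesis good_s : forall p, prime p -> good p (logn p m) (logn p q) (logn p s).
Hypothesis good_s' : forall p, prime p -> good p (logn p m) (logn p q) (logn p s').
Hypothesis loc : forall p, prime p ->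
  exists2 G, ~~ (p%:Z %| \det G)%Z & congruent_mod (p ^ 6) G (Std m q s) (Std m q s').

(** At odd primes m and q determine the exponent of the gcd. At 2 it is determined by s modulo 2^(i
    + 1), with i the exponent of m, and in the exceptional case both s and s' are odd. *)
Lemma h_genus : frame_gcd m s = frame_gcd m s'.
Proof.
have m2 : (0 < 2 * m)%N by rewrite muln_gt0.
apply: eqn_from_log; rewrite ?gcdn_gt0 ?m2 // => p.
have [pp|npp] := boolP (prime p); last first.
  have z n : logn p n = 0%N by rewrite lognE (negbTE npp).
  by rewrite !z.
rewrite !logn_gcd // (lognM p (ltn0Sn 1) m0).
have [p2|np2] := eqVneq p 2%N; last first.
  rewrite logn_prime // (negbTE np2) add0n.
  by rewrite (good_min (good_s pp)) (good_min (good_s' pp)).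
subst p; rewrite -[logn 2 2]/1%N add1n; have [G dG cG] := loc pp.
have [h|[i1 j1 _]] := local_transfer2 m0 q0 s0 s'0 dG (good_s pp) (good_s' pp) cG.
  exact: minn_logn_congr h.
have := good_min (good_s' pp); have := good_min (good_s pp); rewrite i1 j1 /=.
by case: (logn 2 s) => [|n]; case: (logn 2 s') => [|n'] //=; rewrite minnSS.
Qed.

(** From s = s' u^2 modulo p^i, with i the exponent of m; the common gcd has exponent i - 1, and
    cancelling it leaves a congruence modulo p. *)
Lemma tau_genus p : orbit_prime m q p ->
  exists2 u : int, ~~ (p%:Z %| u)%Z & (p%:Z %| (tau m s)%:Z - (tau m s')%:Z * u ^+ 2)%Z.
Proof.
move=> /and3P[pp np2 vp]; have [G _ cG] := loc pp.
have [ds /(_ vp) nu] := local_transfer pp m0 q0 s0 s'0 (good_s pp) (good_s' pp) cG.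
exists (G i0 i0) => //; set u := G i0 i0 in ds nu *.
have [ls i0'] := good_mod pp s0 (good_s pp) vp.
have h0 := h_gt0 s m0; have m2 := m2_gt0 m0.
have lh : logn p (frame_gcd m s) = (logn p m).-1.
  rewrite logn_h // ls (lognM p (ltn0Sn 1) m0) logn_prime // (negbTE np2) add0n.
  by apply/minn_idPr; rewrite leq_pred.
have [h' hE nh'] := pfactorE pp h0; rewrite lh in hE.
have : ((p ^ (logn p m).-1.+1)%N%:Z %| (frame_gcd m s)%:Z * ((tau m s)%:Z - (tau m s')%:Z * u ^+ 2))%Z.
  rewrite prednK //; have -> : (frame_gcd m s)%:Z * ((tau m s)%:Z - (tau m s')%:Z * u ^+ 2) =
    s%:Z - s'%:Z * u ^+ 2.
    have e1 : s%:Z = (tau m s)%:Z * (frame_gcd m s)%:Z by rewrite -PoszM tau_h.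
    have e2 : s'%:Z = (tau m s')%:Z * (frame_gcd m s)%:Z by rewrite -PoszM h_genus tau_h.
    by rewrite [in RHS]e1 [in RHS]e2; ring.
  by [].
rewrite {1}hE expnSr !PoszM -mulrA [(_ %| _)%Z]dvdz_mul2l; last first.
  by rewrite eqz_nat -lt0n expn_gt0 prime_gt0.
by rewrite Euclid_dvdzM // (negbTE nh').
Qed.

Lemma frame_constant_genus (R : realType) (rho : nat -> R) :
  frame_constant rho m q s = frame_constant rho m q s'.
Proof.
rewrite /frame_constant.
have eb : beta m s = beta m s' by rewrite /beta h_genus.
have eK : conic_sqfree m q s = conic_sqfree m q s' by rewrite /conic_sqfree /conic_disc eb.
have ea : alpha m q s = alpha m q s' by rewrite /alpha eK /conic_disc eb.
rewrite -ea -eK; set K := conic_sqfree m q s.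
have K0 : (0 < K)%N := kappa_gt0 s m0 q0.
have M0 : (0 < modulus m q K)%N := ltnW (modulus_gt1 m0 q0 K0).
have [f fP] : exists f : nat -> int, forall p, prime p -> ~~ (p%:Z %| f p)%Z /\
    (orbit_prime m q p -> (p%:Z %| (tau m s)%:Z - (tau m s')%:Z * f p ^+ 2)%Z).
  have [p|f h] := @choice nat int (fun p z => prime p -> ~~ (p%:Z %| z)%Z /\
    (orbit_prime m q p -> (p%:Z %| (tau m s)%:Z - (tau m s')%:Z * z ^+ 2)%Z)); last by exists f.
  have [/tau_genus[z z1 z2]|no] := boolP (orbit_prime m q p); first by exists z.
  (* At the remaining primes the value 1 keeps the glued u invertible modulo [modulus m q K]. *)
  by exists 1 => pp; split=> //; rewrite dvdz1 /= gtn_eqF // prime_gt1.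
have [u uP] := @crt_primes (primes (modulus m q K)) f (primes_uniq _) (all_prime_primes _).
rewrite /leading_constant; apply: eq_big_seq => d; rewrite -dvdn_divisors // => dK.
have inM p : orbit_prime m q p -> p \in primes (modulus m q K).
  move=> /and3P[pp _ vp]; rewrite mem_primes pp M0 /= /modulus.
  have [l|l] := posnP (logn p m).
    have : p \in primes q by rewrite -logn_gt0; move: vp; rewrite l; case: (logn p q).
    by rewrite mem_primes => /and3P[_ _ pq]; rewrite dvdn_mulr // dvdn_mull.
  move: l; rewrite logn_gt0 mem_primes => /and3P[_ _ pm].
  by rewrite dvdn_mulr // dvdn_mulr // dvdn_mull.
rewrite (@prim_residues_Wset m q K d (tau m s) (tau m s') u) // => p pM.
  have pp : prime p by move: pM; rewrite mem_primes => /andP[].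
  apply/negP => pu; have [/negP nf _] := fP p pp; apply: nf.
  by have := uP p pM; rewrite (rpredBl _ pu).
have pp : prime p by case/and3P: pM.
have [_ /(_ pM) h] := fP p pp; have := uP p (inM p pM) => h2.
have -> : (tau m s)%:Z - (tau m s')%:Z * u ^+ 2 = ((tau m s)%:Z - (tau m s')%:Z * f p ^+ 2)
   - (u - f p) * ((tau m s')%:Z * (u + f p)) by ring.
by rewrite rpredB // dvdz_mulr.
Qed.

End Genus.

Lemma same_genus_frame_constant (R : realType) (rho : nat -> R) S S' x x' B B' m q s m' q' s' :
  special S -> special S' -> same_genus R S S' ->
  frame S x B m q s -> frame S' x' B' m' q' s' ->
  frame_constant rho m q s = frame_constant rho m' q' s'.
Proof.
move=> sS sS' gS fS fS'.
have [[_ _ _ D0] _] := sS; have [[_ _ _ D0'] _] := sS'.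
have [uB _ _ [m0 q0 s0 DE gs]] := fS; have [uB' _ _ [m0' q0' s0' DE' gs']] := fS'.
have [em eq] : m = m' /\ q = q'.
  by apply: (@good_mq_unique m q s m' q' s') => //; rewrite -DE -DE'; apply: genus_det gS.
subst m' q'; apply: frame_constant_genus => // p pp.
have [A dA cA] := padic_congruent pp (isT : 0 < 6)%N (gS.1 p pp).
exists (invmx B *m (A *m B')); first exact: frame_congruent_det.
exact: frame_congruent fS fS' cA.
Qed.

Lemma same_genus_refl (R : realType) S : same_genus R S S.
Proof.
split.
  move=> p pp; exists (fun=> 1%:M); split.
  - by move=> k i j.
  - by rewrite det1 dvdz1 /= gtn_eqF // prime_gt1.
  - by move=> k i j; rewrite trmx1 mul1mx mulmx1.
by exists 1%:M; rewrite unitmx1 trmx1 mul1mx mulmx1.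
Qed.

Theorem theorem2 (R : realType) :
  exists kappa : 'M[int]_3 -> R,
    (forall S S' : 'M[int]_3, special S -> special S' -> same_genus R S S' ->
       kappa S = kappa S') /\
    (forall S : 'M[int]_3, special S ->
       0 < kappa S /\
       forall y : 'rV[R]_3, qformR (Sstar S) y = 4 * (Ddet S)%:~R ->
       forall x : 'rV[int]_3, in_cone S x ->
         let P (T : R) (x' : 'rV[int]_3) :=
           in_Sorbit S x x' /\ 0 < pairR x' y /\ pairR x' y <= T in
         (forall T : R, exists n : nat, has_card (P T) n) /\
         (forall eps : R, 0 < eps -> exists T0 : R, forall T : R, T0 <= T ->
            forall n : nat, has_card (P T) n ->
              `| n%:R / T - kappa S | < eps)).
Proof.
have [rho hrho] := @rho_exists R.
(* kappa S is the constant of any frame of S; on matrices that are not special nothing is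
   required. *)
have [kappa kappaP] : exists kappa : 'M[int]_3 -> R, forall S, special S ->
    forall x B m q s, frame S x B m q s -> kappa S = frame_constant rho m q s.
  have [S|kappa h] := @choice 'M[int]_3 R (fun S k => special S ->
    forall x B m q s, frame S x B m q s -> k = frame_constant rho m q s); last by exists kappa.
  have [sS|nS] := pselect (special S); last by exists 0.
  have [[_ _ [x xC] _] _] := sS; have [B [m [q [s fr]]]] := special_frame sS xC.
  exists (frame_constant rho m q s) => _ x' B' m' q' s' fr'.
  (* Since S lies in its own genus, invariance in the genus also shows that the constant depends
     neither on the frame nor on x. *)
  exact: same_genus_frame_constant (same_genus_refl R S) fr fr'.
exists kappa; split=> [S S' sS sS' gS|S sS].
  have [[_ _ [x xC] _] _] := sS; have [[_ _ [x' xC'] _] _] := sS'.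
  have [B [m [q [s fr]]]] := special_frame sS xC.
  have [B' [m' [q' [s' fr']]]] := special_frame sS' xC'.
  rewrite (kappaP S sS _ _ _ _ _ fr) (kappaP S' sS' _ _ _ _ _ fr').
  exact: same_genus_frame_constant gS fr fr'.
split.
  have [[_ _ [x xC] _] _] := sS; have [B [m [q [s fr]]]] := special_frame sS xC.
  rewrite (kappaP S sS _ _ _ _ _ fr); have [_ _ _ [m0 q0 s0 _ g]] := fr.
  exact: frame_constant_gt0.
move=> y hy x xC; have [B [m [q [s fr]]]] := special_frame sS xC.
rewrite (kappaP S sS _ _ _ _ _ fr).
exact: (orbit_count sS xC fr hy hrho).
Qed.
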